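(* Let $[\alpha]\in\mathcal{E}$, i.e. $[\alpha]\in\mathcal{C}$ is the class of a curve having an elliptic diameter. Then every representative $\alpha$ of $[\alpha]$ can be approximated by curves whose associated billiard map has an elliptic island of positive measure; that is, for every $\epsilon>0$ there is $[\beta]\in\mathcal{C}$ which is $\epsilon$-$C^2$-close to $[\alpha]$ and such that the billiard map $T_\beta$ has an elliptic island of positive measure.
   Context: Curves. A plane, closed, regular, strictly convex curve $\alpha$, oriented counterclockwise, is parametrized by $\varphi\in[0,2\pi]$ (extended $2\pi$-periodically), the angle between the tangent vector and a fixed direction. With $\tau(\varphi)=(\cos\varphi,\sin\varphi)$ and inward normal $\eta(\varphi)=(-\sin\varphi,\cos\varphi)$ one has $\alpha'(\varphi)=R(\varphi)\tau(\varphi)$, where $R(\varphi)>0$ is the radius of curvature. Billiard map. The billiard on $\alpha$ is the free motion of a point particle in the region enclosed by $\alpha$, with elastic reflections at the boundary. Let $\varphi$ locate the point of reflection and let $\theta\in(-\pi/2,\pi/2)$ be the angle between the direction of motion just after reflection and the inward normal at that point. The billiard map $T_\alpha$ sends $(\varphi_0,\theta_0)$ to the pair $(\varphi_1,\theta_1)$ describing the next reflection; it is a map of the annulus $[0,2\pi)\times(-\pi/2,\pi/2)$ (with $\varphi$ taken mod $2\pi$) to itself preserving the measure $R(\varphi)\cos\theta\,d\theta\,d\varphi$. Elliptic islands. A point is $n$-periodic if $n$ is the smallest positive integer such that it is fixed by $T^n$; an $n$-periodic point is elliptic if the eigenvalues of $DT^n$ at it are complex and non-real. An elliptic island is a $T^n$-invariant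 subset, homeomorphic to a disk, surrounding an $n$-periodic elliptic point. Diameters. $\varphi_0$ is a diameter of $\alpha$ if $\alpha(\varphi_0)-\alpha(\varphi_0+\pi)$ is parallel to $\eta(\varphi_0)$; then $(\varphi_0,0)$ is a 2-periodic point of $T_\alpha$. Put $L_0=|\alpha(\varphi_0)-\alpha(\varphi_0+\pi)|$, $R_0=R(\varphi_0)$, $R_\pi=R(\varphi_0+\pi)$. The diameter is elliptic (equivalently, the associated 2-periodic point is elliptic) if $L_0-(R_0+R_\pi)<0$ and $(L_0-R_0)(L_0-R_\pi)>0$. Classes of curves. Two curves are equivalent if they differ by a planar rigid motion. $\mathcal{C}$ is the set of equivalence classes $[\alpha]$ of closed, regular, strictly convex plane curves that are $C^5$ when parametrized by the angle $\varphi$. $\mathcal{E}\subset\mathcal{C}$ is the subset of classes of curves with an elliptic diameter. Closeness. For $\epsilon>0$ let $N_\epsilon(\alpha)=\{\alpha(\varphi)+\lambda\eta(\varphi): 0\le\varphi<2\pi,\ -\epsilon<\lambda<\epsilon\}\simeq S^1\times(-\epsilon,\epsilon)$ be a tubular neighbourhood of $\alpha$, with canonical projection $\Pi:S^1\times(-\epsilon,\epsilon)\to S^1$ onto the image of $\alpha$. $[\beta]\in\mathcal{C}$ is $\epsilon$-close to $[\alpha]\in\mathcal{C}$ if there is a representative $\beta$ of $[\beta]$ whose image is in $N_\epsilon(\alpha)$, for $\alpha\in[\alpha]$, and the restriction of $\Pi$ to the image of $\beta$ is a diffeomorphism; then $\beta$ can be written $\beta(\varphi)=\alpha(\varphi)+\lambda(\varphi)\eta(\varphi)$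 with $\lambda$ $2\pi$-periodic. $[\beta]$ is $\epsilon$-$C^2$-close to $[\alpha]$ if moreover $|\lambda|_2<\epsilon$, where $|\lambda|_2=\max_{\varphi\in[0,2\pi]}\{|\lambda(\varphi)|,|\lambda'(\varphi)|,|\lambda''(\varphi)|\}$. *)

(* Defs.v *)
From HB Require Import structures.
From mathcomp Require Import all_boot all_order all_algebra.
From mathcomp Require Import complex.
From mathcomp Require Import all_classical all_reals all_analysis.

Set Implicit Arguments.
Unset Strict Implicit.
Unset Printing Implicit Defensive.

Import Order.TTheory GRing.Theory Num.Theory.
Import numFieldNormedType.Exports.

Local Open Scope classical_set_scope.
Local Open Scope ring_scope.

(* Points of the plane are pairs.  The library norm on [K * K] is the maximum
   norm, hence the separate Euclidean length. *)
Definition dot (K : realType) (x y : K * K) : K := x.1 * y.1 + x.2 * y.2.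
Definition enorm (K : realType) (x : K * K) : K := Num.sqrt (dot x x).

Definition rot (K : realType) (c : K) (x : K * K) : K * K :=
  (cos c * x.1 - sin c * x.2, sin c * x.1 + cos c * x.2).

Definition tau (K : realType) (phi : K) : K * K := (cos phi, sin phi).
Definition eta (K : realType) (phi : K) : K * K := (- sin phi, cos phi).

Definition Cn (K : realType) (V : normedModType K) (n : nat) (f : K -> V) :
    Prop :=
  (forall k x, (k < n)%N -> derivable (derive1n k f) x 1) /\
  (forall k, (k <= n)%N -> continuous (derive1n k f)).

(* As the derivative is required to be [radius a phi *: tau phi], this is the
   usual radius of curvature. *)
Definition radius (K : realType) (a : K -> K * K) (phi : K) : K :=
  dot (derive1 a phi) (tau phi).

(* Closed, regular, strictly convex, counterclockwise curves that are C^5 in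
   their tangent angle, the parameter.  Simplicity and strict convexity follow
   from the last clause and periodicity, as the tangent turns exactly once. *)
Definition convex_curve (K : realType) (a : K -> K * K) : Prop :=
  [/\ periodic a (pi *+ 2),
      Cn 5 a &
      forall phi, derive1 a phi = radius a phi *: tau phi /\ 0 < radius a phi].

(* Rotating a curve by [c] shifts its tangent angle by [c]. *)
Definition rigid_equiv (K : realType) (a b : K -> K * K) : Prop :=
  exists (c : K) (v : K * K), forall phi, b phi = rot c (a (phi - c)) + v.

Definition is_diameter (K : realType) (a : K -> K * K) (phi0 : K) : Prop :=
  exists c : K, a phi0 - a (phi0 + pi) = c *: eta phi0.

Definition elliptic_diameter (K : realType) (a : K -> K * K) (phi0 : K) :
    Prop :=
  let L0 := enorm (a phi0 - a (phi0 + pi)) in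
  let R0 := radius a phi0 in
  let Rpi := radius a (phi0 + pi) in
  [/\ is_diameter a phi0,
      L0 - (R0 + Rpi) < 0 &
      0 < (L0 - R0) * (L0 - Rpi)].

(* The C^1 maps of the line that lift diffeomorphisms of the circle. *)
Definition circle_diffeo (K : realType) (p : K -> K) : Prop :=
  [/\ Cn 1 p,
      forall x, derive1 p x != 0 &
      (forall x, p (x + pi *+ 2) = p x + pi *+ 2) \/
      (forall x, p (x + pi *+ 2) = p x - pi *+ 2)].

Definition C2norm (K : realType) (lam : K -> K) : K :=
  sup [set r | exists k phi, [/\ (k <= 2)%N, 0 <= phi <= pi *+ 2 &
                               r = `|derive1n k lam phi|]].

(* Some curve [b'] congruent to [b] has its image in the tubular neighbourhood
   N_eps(a).  Here [p] is the projection Pi restricted to the image of [b'],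
   read in the angle of [b'] at the source and in the angle of [a] at the
   target; [lam] is the displacement as a function of the angle of [a]. *)
Definition C2_close (K : realType) (eps : K) (a b : K -> K * K) : Prop :=
  exists b' : K -> K * K, rigid_equiv b b' /\
  exists (p lam : K -> K),
    [/\ circle_diffeo p,
        periodic lam (pi *+ 2) /\ Cn 2 lam,
        forall phi, `|lam phi| < eps,
        forall psi, b' psi = a (p psi) + lam (p psi) *: eta (p psi) &
        C2norm lam < eps].

(* The phase annulus is (R / 2 pi Z) x (-pi/2, pi/2).  Its points are
   represented by pairs (phi, theta) in the strip below, which is its universal
   cover, and its subsets by their full, [shift2pi]-invariant, preimages. *)
Definition strip (K : realType) : set (K * K) :=
  [set q | - (pi / 2) < q.2 < pi / 2].

Definition shift2pi (K : realType) (k : int) (q : K * K) : K * K :=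
  (q.1 + (pi *+ 2) *~ k, q.2).

(* theta is measured counterclockwise from the inward normal. *)
Definition velocity (K : realType) (q : K * K) : K * K :=
  cos q.2 *: eta q.1 - sin q.2 *: tau q.1.

(* A ray pointing inwards from a point of a strictly convex curve meets the
   curve exactly once more; the angle of the next impact is normalized to lie
   in (phi, phi + 2 pi). *)
Definition billiard_step (K : realType) (a : K -> K * K) (q q1 : K * K) :
    Prop :=
  [/\ q.1 < q1.1 < q.1 + pi *+ 2,
      strip q1,
      exists2 l : K, 0 < l & a q1.1 = a q.1 + l *: velocity q &
      velocity q1 =
        velocity q - (2 * dot (velocity q) (eta q1.1)) *: eta q1.1].

(* The lift to the strip of the billiard map; it commutes with [shift2pi].
   Only its values on the strip matter, where [billiard_step] has exactly one
   solution. *)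
Definition billiard (K : realType) (a : K -> K * K) (q : K * K) : K * K :=
  xget q [set q1 | billiard_step a q q1].

Definition fixed_mod (K : realType) (f : K * K -> K * K) (q : K * K) : Prop :=
  exists k : int, f q = shift2pi k q.

Definition n_periodic (K : realType) (f : K * K -> K * K) (n : nat)
    (q : K * K) : Prop :=
  [/\ (0 < n)%N,
      fixed_mod (iter n f) q &
      forall m, (0 < m < n)%N -> ~ fixed_mod (iter m f) q].

(* Matrix of the differential, acting on row vectors. *)
Definition jac (K : realType) (f : K * K -> K * K) (q : K * K) : 'M[K]_2 :=
  lin1_mx (fun v : 'rV[K]_2 =>
    let w := 'd f q (v 0 0, v 0 1) in
    \row_(j < 2) (if j == 0 then w.1 else w.2)).

Definition elliptic_matrix (K : realType) (M : 'M[K]_2) : Prop :=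
  forall z : K[i],
    eigenvalue (map_mx (real_complex K) M) z -> z \isn't Num.real.

Definition elliptic_point (K : realType) (a : K -> K * K) (n : nat)
    (q : K * K) : Prop :=
  [/\ strip q,
      n_periodic (billiard a) n q,
      differentiable (iter n (billiard a)) q &
      elliptic_matrix (jac (iter n (billiard a)) q)].

Definition homeomorphic (S T : topologicalType) (A : set S) (B : set T) :
    Prop :=
  exists (f : S -> T) (g : T -> S),
    [/\ {within A, continuous f} /\ {within B, continuous g},
        f @` A `<=` B,
        g @` B `<=` A,
        {in A, cancel f g} &
        {in B, cancel g f}].

Definition disk (K : realType) : set (K * K) := [set x | enorm x <= 1].

(* The strip modulo 2 pi, embedded in three-space as a cylinder. *)
Definition cylinder (K : realType) (q : K * K) : (K * K) * K :=
  ((cos q.1, sin q.1), q.2).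

Definition elliptic_island (K : realType) (a : K -> K * K) (U : set (K * K)) :
    Prop :=
  U `<=` @strip K /\
  (forall k q, U q -> U (shift2pi k q)) /\
  exists n q,
    [/\ elliptic_point a n q,
        iter n (billiard a) @` U = U,
        homeomorphic (@cylinder K @` U) (@disk K) &
        interior U q].

Definition phase_measure (K : realType) (a : K -> K * K) (U : set (K * K)) :
    \bar K :=
  (\int[(@lebesgue_measure K) \x (@lebesgue_measure K)]_(q in
      U `&` [set q : K * K | (0 <= q.1 < pi *+ 2)%R /\ strip q])
    (radius a q.1 * cos q.2)%R%:E)%E.

Definition has_positive_island (K : realType) (a : K -> K * K) : Prop :=
  exists U : set (K * K),
    [/\ elliptic_island a U,
        measurable (U : set (measurableTypeR K * measurableTypeR K)) &
        (0 < phase_measure a U)%E].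

(* Main.v *)
(* Write a convex curve in its tangent angle by its support function [h], so that
   the radius of curvature is [h + h'']. If the diameter has length [L] and end
   radii [R0], [R1], the ellipticity conditions say exactly that there are two
   confocal ellipses having the diameter on their common minor axis, one through
   each end point, with curvature radii [R0] and [R1] there. Replacing the
   support function near the two ends by those of the ellipses changes it only
   in third order, so with a cut-off the new curve is C^2-close to the old one.
   Close to the diameter the new billiard is integrable: reflections on confocal
   ellipses preserve the product of the angular momenta about the foci. In the
   coordinates (signed distance to the center, sine of the direction) of the
   space of lines this product is, up to a constant, a positive definite
   quadratic form, and its small sublevel sets are the islands. *)
From HB Require Import structures.
From mathcomp Require Import all_boot all_order all_algebra.
From mathcomp Require Import ring lra complex.
From mathcomp Require Import all_classical all_reals all_analysis.
From mathcomp Require Import measurable_realfun.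
Require Import Defs.

Set Implicit Arguments.
Unset Strict Implicit.
Unset Printing Implicit Defensive.

Import Order.TTheory GRing.Theory Num.Theory.
Import numFieldNormedType.Exports.

Local Open Scope classical_set_scope.
Local Open Scope ring_scope.

(** The billiard map is chosen from a relation, so the work is moved to the space of oriented lines:
    a line is an angle [w] with an offset [l], and [entry], its entry point into the region, is the
    implicit function behind all differentials. The next impact on a line is the entry point of the
    reversed line. This makes a billiard step [entry] composed with explicit maps, which yields its
    differential at the diameter, and it turns time reversal into a source of preimages, so that the
    island is equal to its image and not only mapped into itself. The second obstacle is that
    closeness is measured along the normals of the first curve, whereas support functions compare
    the curves at equal tangent angles. The change of parameter [psi] between the two points of view
    is controlled only to first order. This suffices because the derivative of the displacement
    [lam] is [(Ra - lam) * tan (psi - p)], which contains [psi] but not its derivative: first order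
    control of [psi], hence zeroth order control of the radii, gives second order control of
    [lam]. *)

Section smooth_functions.
Variable K : realType.
Implicit Types (f g : K -> K) (n : nat).

(** An inductive form of [Cn]: the derivative is carried as a witness, so products, inverses and
    compositions go by induction on [n] with explicit formulas. [smooth_Cn] identifies the two
    notions. *)
Fixpoint smooth n f : Prop :=
  if n is m.+1 then
    exists2 f' : K -> K, (forall x : K, is_derive x 1 f (f' x)) & smooth m f'
  else continuous f.

Lemma is_derive_continuous f (f' : K -> K) :
  (forall x : K, is_derive x 1 f (f' x)) -> continuous f.
Proof.
by move=> df x; apply/differentiable_continuous/derivable1_diffP; case: (df x).
Qed.

Lemma smoothW n f : smooth n.+1 f -> smooth n f.
Proof.
elim: n f => [|n IH] f [f' df sf']; first exact: is_derive_continuous df.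
by exists f' => //; exact: IH.
Qed.

Lemma smooth_le m n f : (m <= n)%N -> smooth n f -> smooth m f.
Proof.
by move/subnK <-; elim: (n - m)%N => //= k IH s; apply: IH; apply: smoothW.
Qed.

Lemma smooth_continuous n f : smooth n f -> continuous f.
Proof. exact: (@smooth_le 0). Qed.

Lemma smooth_ext n f g : f =1 g -> smooth n f -> smooth n g.
Proof. by move/funext ->. Qed.

Lemma is_derive1_fun f (f' : K -> K) :
  (forall x : K, is_derive x 1 f (f' x)) -> derive1 f = f'.
Proof. by move=> df; apply/funext => x; rewrite derive1E; case: (df x). Qed.

Lemma smoothSP n f (f' : K -> K) : (forall x : K, is_derive x 1 f (f' x)) ->
  smooth n.+1 f -> smooth n f'.
Proof.
by move=> /is_derive1_fun <- [g /is_derive1_fun ->].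
Qed.

Lemma smooth_cst n (c : K) : smooth n (fun=> c).
Proof.
elim: n c => [|n IH] c /=; first by move=> x; exact: cst_continuous.
by exists (fun=> 0); [move=> x; exact: is_derive_cst|exact: IH].
Qed.

Lemma smooth_id n : smooth n (fun x : K => x).
Proof.
case: n => [|n] /=; first by move=> x; exact: cvg_id.
by exists (fun=> 1); [move=> x; exact: is_derive_id|exact: smooth_cst].
Qed.

Lemma smoothD n f g : smooth n f -> smooth n g -> smooth n (fun x => f x + g x).
Proof.
elim: n f g => [|n IH] f g /= => [cf cg x|].
  by apply: cvgD; [exact: cf|exact: cg].
by move=> [f' df sf] [g' dg sg]; exists (fun x => f' x + g' x);
  [by move=> x; exact: is_deriveD|exact: IH].
Qed.

Lemma smoothN n f : smooth n f -> smooth n (fun x => - f x).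
Proof.
elim: n f => [|n IH] f /= => [cf x|]; first by apply: cvgN; exact: cf.
by move=> [f' df sf]; exists (fun x => - f' x);
  [by move=> x; exact: is_deriveN|exact: IH].
Qed.

Lemma smoothB n f g : smooth n f -> smooth n g -> smooth n (fun x => f x - g x).
Proof. by move=> sf sg; apply: smoothD => //; exact: smoothN. Qed.

Lemma is_deriveM_fun f g (f' g' : K -> K) (x : K) :
  is_derive x 1 f (f' x) -> is_derive x 1 g (g' x) ->
  is_derive x 1 (fun x => f x * g x) (f' x * g x + f x * g' x).
Proof.
move=> df dg.
by apply: is_derive_eq; rewrite /GRing.scale /= addrC [g x * _]mulrC.
Qed.

Lemma smoothM n f g : smooth n f -> smooth n g -> smooth n (fun x => f x * g x).
Proof.
elim: n f g => [|n IH] f g sf sg.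
  by move=> x; apply: cvgM; [exact: sf|exact: sg].
have [f' df sf'] := sf; have [g' dg sg'] := sg.
exists (fun x => f' x * g x + f x * g' x); first by move=> x; apply: is_deriveM_fun.
by apply: smoothD; apply: IH => //; exact: smoothW.
Qed.

Lemma smooth_comp n f g : smooth n f -> smooth n g -> smooth n (fun x => f (g x)).
Proof.
elim: n f g => [|n IH] f g sf sg.
  by move=> x; apply: continuous_comp; [exact: sg|exact: sf].
have [f' df sf'] := sf; have [g' dg sg'] := sg.
exists (fun x => f' (g x) * g' x); first by move=> x; apply: is_derive1_comp.
by apply: smoothM => //; apply: IH => //; exact: smoothW.
Qed.

Lemma smoothX n f k : smooth n f -> smooth n (fun x => f x ^+ k).
Proof.
move=> sf; elim: k => [|k IH]; first exact: smooth_cst.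
by under eq_fun do rewrite exprS; apply: smoothM.
Qed.

Lemma smoothV n f : (forall x, f x != 0) -> smooth n f ->
  smooth n (fun x => (f x)^-1).
Proof.
move=> f0; elim: n => [|n IH] sf; first by move=> x; apply: cvgV => //; exact: sf.
have [f' df sf'] := sf.
exists (fun x => - ((f x)^-1 ^+ 2) * f' x); last first.
  by apply: smoothM => //; apply/smoothN/smoothX/IH/smoothW.
by move=> x; rewrite exprVn; exact: is_deriveV.
Qed.

Lemma smooth_sqrt n f : (forall x, 0 < f x) -> smooth n f ->
  smooth n (fun x => Num.sqrt (f x)).
Proof.
move=> f0; elim: n => [|n IH] sf.
  by move=> x; apply: (continuous_comp (sf x)); exact: sqrt_continuous.
have [f' df sf'] := sf.
exists (fun x => (2 * Num.sqrt (f x))^-1 * f' x).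
  by move=> x; apply: is_derive1_comp; exact: is_derive1_sqrt.
apply: smoothM => //; apply: smoothV => [x|].
  by rewrite mulf_neq0 // gt_eqF // sqrtr_gt0.
by apply: smoothM; [exact: smooth_cst|exact/IH/smoothW].
Qed.

Lemma smooth_trig n : smooth n (@sin K) /\ smooth n (@cos K).
Proof.
elim: n => [|n [IHs IHc]].
  by split; [exact: continuous_sin|exact: continuous_cos].
split; first by exists cos => // x; exact: is_derive_sin.
by exists (fun x => - sin x); [move=> x; exact: is_derive_cos|exact: smoothN].
Qed.

Lemma smooth_sin n : smooth n (@sin K). Proof. by case: (smooth_trig n). Qed.

Lemma smooth_cos n : smooth n (@cos K). Proof. by case: (smooth_trig n). Qed.

Lemma CnS (V : normedModType K) n (f : K -> V) :
  Cn n.+1 f <-> (forall x : K, derivable f x 1) /\ Cn n (derive1 f).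
Proof.
split=> [[df cf]|[df [df' cf']]].
  split; first by move=> x; exact: (df 0%N).
  split=> [k x kn|k kn]; rewrite -derive1Sn; first exact: df.
  exact: cf.
split=> [[|k] x kn|[|k] kn]; rewrite ?derive1Sn //.
- exact: df'.
- by move=> x; apply/differentiable_continuous/derivable1_diffP; exact: df.
- exact: cf'.
Qed.

Lemma Cn0 (V : normedModType K) (f : K -> V) : Cn 0 f <-> continuous f.
Proof. by split=> [[_ /(_ 0%N)]|cf]; [apply|split=> // -[]]. Qed.

Lemma smooth_Cn n f : smooth n f <-> Cn n f.
Proof.
elim: n f => [|n IH] f; first by rewrite Cn0.
rewrite CnS; split=> [[f' df sf]|[df cf]].
  by split; [move=> x; case: (df x)|rewrite (is_derive1_fun df); apply/IH].
exists (derive1 f); last exact/IH.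
by move=> x; rewrite derive1E; apply/derivableP.
Qed.

Lemma is_derive_pair f g (f' g' : K) (x : K) :
  is_derive x 1 f f' -> is_derive x 1 g g' ->
  is_derive x 1 (fun x => (f x, g x)) (f', g').
Proof.
move=> [/[dup] df /derivable1_diffP Df <-] [/[dup] dg /derivable1_diffP Dg <-].
have D := differentiable_pair Df Dg.
split; first exact: diff_derivable.
by rewrite deriveE // diff_pair // !deriveE.
Qed.

Lemma is_diff_fst (V W : normedModType K) (p : V * W) :
  is_diff p (@fst V W) (@fst V W).
Proof.
have c : continuous (@fst V W) by move=> q; exact: cvg_fst.
by apply: DiffDef; [exact: (@linear_differentiable _ _ _ fst)
                   |exact: (@diff_lin _ _ _ fst)].
Qed.

Lemma is_diff_snd (V W : normedModType K) (p : V * W) :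
  is_diff p (@snd V W) (@snd V W).
Proof.
have c : continuous (@snd V W) by move=> q; exact: cvg_snd.
by apply: DiffDef; [exact: (@linear_differentiable _ _ _ snd)
                   |exact: (@diff_lin _ _ _ snd)].
Qed.

Lemma is_derive_diff_comp (V W : normedModType K) (a : K -> V) (g dg : V -> W)
    (a' : V) (x : K) :
  is_derive x 1 a a' -> is_diff (a x) g dg -> is_derive x 1 (g \o a) (dg a').
Proof.
move=> [/derivable1_diffP Da <-] Dg.
have D : is_diff x (g \o a) (dg \o 'd a x).
  have Da' : is_diff x a ('d a x) by exact: differentiableP.
  exact: is_diff_comp.
split; first exact/diff_derivable.
by rewrite deriveE // diff_val /= deriveE.
Qed.

Lemma is_derive_fst (a : K -> K * K) (a' : K * K) (x : K) :
  is_derive x 1 a a' -> is_derive x 1 (fun x => (a x).1) a'.1.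
Proof. by move=> da; exact: is_derive_diff_comp da (is_diff_fst _). Qed.

Lemma is_derive_snd (a : K -> K * K) (a' : K * K) (x : K) :
  is_derive x 1 a a' -> is_derive x 1 (fun x => (a x).2) a'.2.
Proof. by move=> da; exact: is_derive_diff_comp da (is_diff_snd _). Qed.

Lemma Cn_pairP n (a : K -> K * K) :
  Cn n a <-> smooth n (fun x => (a x).1) /\ smooth n (fun x => (a x).2).
Proof.
elim: n a => [|n IH] a.
  rewrite Cn0; split=> [ca|[c1 c2] x].
    split=> x.
      by apply: (@continuous_comp _ _ _ a fst); [exact: ca|exact: cvg_fst].
    by apply: (@continuous_comp _ _ _ a snd); [exact: ca|exact: cvg_snd].
  have -> : a = (fun x => ((a x).1, (a x).2)) by apply/funext => y; case: (a y).
  by apply: (@cvg_pair _ _ _ _ (nbhs (a x).1) (nbhs (a x).2)); [exact: c1|exact: c2].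
rewrite CnS; split=> [[da /IH[s1 s2]]|[[f df sf] [g dg sg]]].
  have D (x : K) : is_derive x 1 a (derive1 a x) by rewrite derive1E; apply/derivableP.
  split; [exists (fun x => (derive1 a x).1)|exists (fun x => (derive1 a x).2)] => // x.
    exact: is_derive_fst.
  exact: is_derive_snd.
have D (x : K) : is_derive x 1 a (f x, g x).
  have -> : a = (fun x => ((a x).1, (a x).2)) by apply/funext => y; case: (a y).
  exact: is_derive_pair.
split; first by move=> x; case: (D x).
have -> : derive1 a = (fun x => (f x, g x)).
  by apply/funext => x; rewrite derive1E; case: (D x).
by apply/IH.
Qed.

End smooth_functions.

(** * Mean value theorem and a criterion of differentiability *)

Section real_calculus.
Variable K : realType.

Lemma mean_value (f f' : K -> K) (x y : K) :
  (forall x : K, is_derive x 1 f (f' x)) ->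
  exists2 c, Num.min x y <= c <= Num.max x y & f y - f x = f' c * (y - x).
Proof.
move=> df; have cf := is_derive_continuous df.
wlog xy : x y / x <= y => [H|].
  have /orP[|xy] := le_total x y; first exact: H.
  have [c hc e] := H _ _ xy.
  by exists c; rewrite 1?minC 1?maxC // -opprB e -mulrN opprB.
have [c] := MVT_segment xy (fun z _ => df z) (continuous_subspaceT cf).
rewrite in_itv /= => hc e; exists c => //.
by rewrite min_l // max_r.
Qed.

Lemma mean_value_ltr (f f' : K -> K) (x y : K) :
  (forall x : K, is_derive x 1 f (f' x)) -> x < y ->
  (forall z, x < z < y -> 0 < f' z) -> f x < f y.
Proof.
move=> df xy f'0; have cf := is_derive_continuous df.
have [c] := MVT xy (fun z _ => df z) (continuous_subspaceT cf).
rewrite in_itv /= => hc e; rewrite -subr_gt0 e mulr_gt0 ?subr_gt0 //.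
exact: f'0.
Qed.

(** A criterion in the style of Caratheodory: near its zero [x], [N] is bounded by a multiple of the
    distance to [x], so [(c v - c x) * N v] is negligible as soon as [c] is continuous at that
    single point. It serves to differentiate [entry], which is known only through an equation. *)
Lemma is_diff_factor (V : normedModType K) (f N dN c : V -> K) (x : V) :
  is_diff x N dN -> N x = 0 -> {for x, continuous c} ->
  (\forall v \near x, f v - f x = c v * N v) ->
  is_diff x f (fun v => c x * dN v).
Proof.
move=> DN N0 cc fE.
pose E v := f v - f x - c x * N v.
have [k k0 Nk] : exists2 k, 0 < k & \forall h \near (0 : V), `|N (h + x)| <= k * `|h|.
  have [dNc /funext Nx] := (iffLR (diff_locallyxP _ _) (@ex_diff _ _ _ _ _ _ _ DN)).
  have [k k0 dNk] := linear_lipschitz dNc.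
  exists (k + 1); first by rewrite addr_gt0.
  have /eqaddoP /(_ 1 ltr01) := Nx.
  apply: filter_app; near=> h => /=.
  rewrite mul1r !fctE /= N0 add0r.
  move=> H; rewrite -[N (h + x)](subrK ('d N x h)).
  by rewrite (le_trans (ler_normD _ _)) // mulrDl mul1r addrC lerD.
have E0 : E \o shift x = cst (E x) + 0 +o_ 0 id.
  apply/eqaddoP => e e0.
  have e'0 : 0 < e / k by rewrite divr_gt0.
  have Hc : \forall v \near x, `|c x - c v| <= e / k.
    by move/cvgrPdist_le : (cc) => /(_ _ e'0).
  have {}Hc : \forall h \near 0, `|c x - c (h + x)| <= e / k.
    by move: Hc; rewrite (@near_shift _ _ 0 x) /= subr0.
  have fE' : \forall h \near 0, f (h + x) - f x = c (h + x) * N (h + x).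
    by move: fE; rewrite (@near_shift _ _ 0 x) /= subr0.
  near=> h.
  have -> : (E \o shift x - (cst (E x) + 0)) h = (c (h + x) - c x) * N (h + x).
    have fEh : f (h + x) - f x = c (h + x) * N (h + x) by near: h.
    rewrite /= !fctE /= /E subrr N0 mulr0 subrr addr0 subr0 fEh; ring.
  rewrite normrM.
  have H1 : `|c (h + x) - c x| <= e / k.
    by rewrite distrC; near: h.
  have H2 : `|N (h + x)| <= k * `|h| by near: h.
  apply: (le_trans (ler_pM _ _ H1 H2)) => //=.
  by rewrite mulrA divfK ?gt_eqF.
have dE : is_diff x E 0.
  have d0 : 'd E x = 0 :> (V -> K).
    by apply: diff_unique E0 => y; exact: cst_continuous.
  apply: DiffDef => //; apply/diff_locallyP; rewrite d0; split => // y.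
  exact: cst_continuous.
have -> : f = cst (f x) + (c x *: N + E).
  apply/funext => v; rewrite !fctE /E /GRing.scale /=; ring.
apply: (is_diff_eq
  (is_diffD (is_diff_cst (f x) x) (is_diffD (is_diffZ (c x) DN) dE))).
by apply/funext => v; rewrite !fctE /GRing.scale /= add0r addr0.
Unshelve. all: by end_near. Qed.

End real_calculus.

(** * Lines meeting a convex curve *)

Section convex_curves.
Variables (K : realType) (b : K -> K * K).
Hypothesis hb : convex_curve b.
Implicit Types x y w l : K.

(* The line of direction [eta w] through [b x] is [{p | dot p (tau w) = l}] with
   [l = offset x w]; [height x w] is the abscissa of [b x] along it. *)
Definition offset x w := dot (b x) (tau w).
Definition height x w := dot (b x) (eta w).

Lemma curve_derive x : is_derive x 1 b (radius b x *: tau x).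
Proof.
have [_ [/(_ 0%N) D _] /(_ x)[<- _]] := hb.
by rewrite derive1E; apply/derivableP/D.
Qed.

Lemma curve_derive1 x : is_derive x 1 (fun x => (b x).1) (radius b x * cos x).
Proof. exact: is_derive_fst (curve_derive x). Qed.

Lemma curve_derive2 x : is_derive x 1 (fun x => (b x).2) (radius b x * sin x).
Proof. exact: is_derive_snd (curve_derive x). Qed.

Lemma radius_gt0 x : 0 < radius b x.
Proof. by have [_ _ /(_ x)[]] := hb. Qed.

Lemma curve_smooth : smooth 5 (fun x => (b x).1) /\ smooth 5 (fun x => (b x).2).
Proof. by apply/Cn_pairP; have [] := hb. Qed.

Lemma radius_smooth : smooth 4 (radius b).
Proof.
have [s1 s2] := curve_smooth.
have r1 := smoothSP curve_derive1 s1; have r2 := smoothSP curve_derive2 s2.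
apply: (smooth_ext _ (smoothD (smoothM r1 (smooth_cos _ 4))
                              (smoothM r2 (smooth_sin _ 4)))) => x.
by rewrite -!mulrA -mulrDr -!expr2 cos2Dsin2 mulr1.
Qed.

Lemma radius_continuous : continuous (radius b).
Proof. exact: smooth_continuous radius_smooth. Qed.

Lemma curve_periodic x : b (x + pi *+ 2) = b x.
Proof. by have [p _ _] := hb; exact: p. Qed.

Lemma offset_periodic x w : offset (x + pi *+ 2) w = offset x w.
Proof. by rewrite /offset curve_periodic. Qed.

Lemma offsetDpi x w : offset x (w + pi) = - offset x w.
Proof. rewrite /offset /dot /= cosDpi sinDpi; ring. Qed.

Lemma heightDpi x w : height x (w + pi) = - height x w.
Proof. rewrite /height /dot /= cosDpi sinDpi; ring. Qed.

Lemma offset_derive w x :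
  is_derive x 1 (offset^~ w) (radius b x * cos (x - w)).
Proof.
have d1 := curve_derive1 x; have d2 := curve_derive2 x.
by apply: is_derive_eq; rewrite /GRing.scale /= cosB; ring.
Qed.

Lemma height_derive w x :
  is_derive x 1 (height^~ w) (radius b x * sin (x - w)).
Proof.
have d1 := curve_derive1 x; have d2 := curve_derive2 x.
by apply: is_derive_eq; rewrite /GRing.scale /= sinB; ring.
Qed.

Lemma offset_derive_angle x w :
  is_derive w 1 (offset x) (height x w).
Proof.
by apply: is_derive_eq; rewrite /GRing.scale /height /dot /=; ring.
Qed.

Lemma offset_continuous w : continuous (offset^~ w).
Proof. exact: is_derive_continuous (offset_derive w). Qed.

Lemma offset_ltr w x y : w - pi / 2 <= x -> x < y -> y <= w + pi / 2 ->
  offset x w < offset y w.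
Proof.
move=> wx xy yw.
apply: (mean_value_ltr (offset_derive w) xy) => z zxy.
by rewrite mulr_gt0 ?radius_gt0 // cos_gt0_pihalf //; lra.
Qed.

Lemma offset_inj w x y : `|x - w| < pi / 2 -> `|y - w| < pi / 2 ->
  offset x w = offset y w -> x = y.
Proof.
rewrite !ltr_norml => hx hy e; have [xy|yx|//] := ltgtP x y.
  by have := @offset_ltr w x y; rewrite e ltxx; lra.
by have := @offset_ltr w y x; rewrite e ltxx; lra.
Qed.

(** The height above the tangent line at [x] increases during the first half turn and decreases
    during the second, at whose end it is back to zero by periodicity. *)
Lemma support_gt0 x y : x < y < x + pi *+ 2 -> 0 < dot (b y - b x) (eta x).
Proof.
move=> xy.
have -> : dot (b y - b x) (eta x) = height y x - height x x.
  by rewrite /height /dot /=; ring.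
rewrite subr_gt0; have [yx|xpy] := leP y (x + pi).
  apply: (mean_value_ltr (height_derive x)); first by lra.
  move=> z hz; rewrite mulr_gt0 ?radius_gt0 // sin_gt0_pi //; lra.
have -> : height x x = height (x + pi *+ 2) x.
  by rewrite /height curve_periodic.
rewrite -ltrN2.
have dN (z : K) : is_derive z 1 (fun z => - height z x)
    (radius b z * sin (z - pi - x)).
  have dz := height_derive x z; apply: is_derive_eq.
  have -> : z - x = z - pi - x + pi by ring.
  by rewrite sinDpi; ring.
apply: (mean_value_ltr dN); first by lra.
move=> z hz; rewrite mulr_gt0 ?radius_gt0 // sin_gt0_pi //.
move: hz; rewrite mulr2n; lra.
Qed.

(* Where the line of direction [eta v.1] and offset [v.2] enters the region
   bounded by the curve. *)
Definition entry (v : K * K) : K :=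
  xget v.1 [set x | `|x - v.1| < pi / 2 /\ offset x v.1 = v.2].

Lemma entryP (v : K * K) x : `|x - v.1| < pi / 2 -> offset x v.1 = v.2 ->
  entry v = x.
Proof.
move=> xv ox; apply: xget_unique => // y [yv oy].
by apply: (@offset_inj v.1) => //; rewrite oy ox.
Qed.

End convex_curves.

(** * Chain and product rules with explicit differentials *)

Section differentials.
Variables (K : realType) (V : normedModType K).

Lemma is_derive_is_diff (f : K -> K) (f' x : K) :
  is_derive x 1 f f' -> is_diff x f (fun v => f' * v).
Proof.
move=> [df <-]; apply: DiffDef; first exact/derivable1_diffP.
by rewrite deriv1E // derive1E; apply/funext => v; rewrite /GRing.scale /= mulrC.
Qed.

Lemma is_diff_comp1 (f : K -> K) (f' : K) (g dg : V -> K) (x : V) :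
  is_derive (g x) 1 f f' -> is_diff x g dg ->
  is_diff x (fun v => f (g v)) (fun v => f' * dg v).
Proof. by move=> /is_derive_is_diff df Dg; exact: (is_diff_comp Dg df). Qed.

Lemma is_diffM_fun (f g df dg : V -> K) (x : V) :
  is_diff x f df -> is_diff x g dg ->
  is_diff x (fun v => f v * g v) (fun v => f x * dg v + g x * df v).
Proof. by move=> Df Dg; apply: is_diff_eq. Qed.

Lemma is_diffD_fun (f g df dg : V -> K) (x : V) :
  is_diff x f df -> is_diff x g dg ->
  is_diff x (fun v => f v + g v) (fun v => df v + dg v).
Proof. by move=> Df Dg; apply: is_diff_eq. Qed.

Lemma is_diffN_fun (f df : V -> K) (x : V) :
  is_diff x f df -> is_diff x (fun v => - f v) (fun v => - df v).
Proof. by move=> Df; apply: is_diff_eq. Qed.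

Lemma is_diff_fun (f df df' : V -> K) (x : V) :
  is_diff x f df -> df =1 df' -> is_diff x f df'.
Proof. by move=> Df /funext <-. Qed.

Lemma is_diff_continuous (W : normedModType K) (f df : V -> W) (x : V) :
  is_diff x f df -> {for x, continuous f}.
Proof. by move=> [Df _]; exact: differentiable_continuous. Qed.

End differentials.

(** * Differentiability of the entry point of a line *)

Section entry_point.
Variables (K : realType) (b : K -> K * K).
Hypothesis hb : convex_curve b.
Implicit Types x y w l : K.

Lemma offset_diff (p : K * K) :
  is_diff p (fun p => offset b p.1 p.2)
    (fun v => radius b p.1 * cos (p.1 - p.2) * v.1 + height b p.1 p.2 * v.2).
Proof.
have D1 := is_diff_fst p; have D2 := is_diff_snd p.
have b1 := is_diff_comp1 (curve_derive1 hb p.1) D1.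
have b2 := is_diff_comp1 (curve_derive2 hb p.1) D1.
have c2 := is_diff_comp1 (is_derive_cos p.2) D2.
have s2 := is_diff_comp1 (is_derive_sin p.2) D2.
apply: (is_diff_fun (is_diffD_fun (is_diffM_fun b1 c2) (is_diffM_fun b2 s2))).
by move=> v; rewrite /height /dot /= cosB; ring.
Qed.

(** The offsets of [x - d] and [x + d] lie strictly on either side of the offset of the line. This
    persists for nearby lines, and the intermediate value theorem gives an entry point in
    between. *)
Lemma entry_near x w e : `|x - w| < pi / 2 -> 0 < e ->
  \forall v \near (w, offset b x w),
    [/\ `|entry b v - x| < e, `|entry b v - v.1| < pi / 2 &
        offset b (entry b v) v.1 = v.2].
Proof.
move=> xw e0.
(* A third of the slack leaves room both for the move of the entry point and for the change of the
   angle of the line. *)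
pose d := Num.min (e / 2) ((pi / 2 - `|x - w|) / 3).
have d0 : 0 < d by rewrite lt_min; lra.
have de : d < e by rewrite gt_min; apply/orP; left; lra.
have dw : d * 3 <= pi / 2 - `|x - w|.
  by rewrite -ler_pdivlMr // ge_min lexx orbT.
have [u1 u2] := (offset_ltr hb (w := w) (x := x - d) (y := x),
                 offset_ltr hb (w := w) (x := x) (y := x + d)).
have [xw1 xw2] := (ler_norm (x - w), ler_norm (- (x - w))).
rewrite normrN in xw2.
have {}u1 : offset b (x - d) w < offset b x w.
  by apply: u1; lra.
have {}u2 : offset b x w < offset b (x + d) w.
  by apply: u2; lra.
have cl : (fun v : K * K => v.2 - offset b (x - d) v.1) @ (w, offset b x w)
    --> offset b x w - offset b (x - d) w.
  have D1 := is_diff_fst (w, offset b x w).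
  have D2 := is_diff_snd (w, offset b x w).
  have D := is_diff_comp1 (offset_derive_angle b (x - d) w) D1.
  exact: (is_diff_continuous (is_diffD_fun D2 (is_diffN_fun D))).
have cr : (fun v : K * K => v.2 - offset b (x + d) v.1) @ (w, offset b x w)
    --> offset b x w - offset b (x + d) w.
  have D1 := is_diff_fst (w, offset b x w).
  have D2 := is_diff_snd (w, offset b x w).
  have D := is_diff_comp1 (offset_derive_angle b (x + d) w) D1.
  exact: (is_diff_continuous (is_diffD_fun D2 (is_diffN_fun D))).
have c1 : (@fst K K) @ (w, offset b x w) --> w by exact: cvg_fst.
near=> v.
have lv : 0 < v.2 - offset b (x - d) v.1.
  by near: v; apply: (cvgr_gt _ cl); rewrite subr_gt0.
have rv : v.2 - offset b (x + d) v.1 < 0.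
  by near: v; apply: (cvgr_lt _ cr); rewrite subr_lt0.
have wv : `|w - v.1| < d.
  by near: v; move/cvgrPdist_lt : c1; apply.
have [y yd yo] : exists2 y, y \in `[x - d, x + d] & offset b y v.1 = v.2.
  apply: IVT; first by lra.
    by apply: continuous_subspaceT; exact: offset_continuous.
  by rewrite ge_min le_max; apply/andP; split; apply/orP; [left|right]; lra.
have yw : `|y - v.1| < pi / 2.
  have -> : y - v.1 = (y - x) + (x - w) + (w - v.1) by ring.
  have yx : `|y - x| <= d by rewrite ler_norml; move: yd; rewrite in_itv /=; lra.
  have := ler_normD (y - x + (x - w)) (w - v.1).
  have := ler_normD (y - x) (x - w).
  by lra.
rewrite (entryP hb yw yo); split => //.
by rewrite ltr_norml; move: yd; rewrite in_itv /=; lra.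
Unshelve. all: by end_near. Qed.

(** Implicit differentiation of [offset b (entry b v) v.1 = v.2]. Here [N] is the defect of this
    equation at the fixed point [x]; by the mean value theorem the increment of [entry] divided by
    [N] is the inverse of a derivative of [offset] at an intermediate point, and this tends to
    [D^-1]. *)
Lemma entry_diff x w : `|x - w| < pi / 2 ->
  is_diff (w, offset b x w) (entry b)
    (fun v => (v.2 - height b x w * v.1) / (radius b x * cos (x - w))).
Proof.
move=> xw; set p := (w, _).
have e1 : entry b p = x by exact: (entryP hb (v := p)).
pose D := radius b x * cos (x - w).
have D0 : 0 < D.
  by rewrite mulr_gt0 ?radius_gt0 ?cos_gt0_pihalf // -ltr_norml.
pose N (v : K * K) := v.2 - offset b x v.1.
have DN : is_diff p N (fun v => v.2 - height b x w * v.1).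
  have D1 := is_diff_fst p; have D2 := is_diff_snd p.
  have Dg := is_diff_comp1 (offset_derive_angle b x w) D1.
  exact: (is_diffD_fun D2 (is_diffN_fun Dg)).
(* The value for [N v = 0] makes [c] continuous at [p]. For such [v] the entry point is [x] again,
   by injectivity of [offset], and the factorization reads [0 = 0]. *)
pose c v := if N v == 0 then D^-1 else (entry b v - x) / N v.
have N0 : N p = 0 by rewrite /N /= subrr.
have cp : c p = D^-1 by rewrite /c N0 eqxx.
have slope (v : K * K) y : exists2 z, `|z - x| <= `|y - x| &
    offset b y v.1 - offset b x v.1 = radius b z * cos (z - v.1) * (y - x).
  have [z hz e] := mean_value x y (offset_derive hb v.1); exists z => //.
  move: hz; case: (leP x y) => xy /andP[h1 h2].
    by rewrite !ger0_norm; lra.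
  by rewrite !ler0_norm; lra.
have cs : (fun q : K * K => q.1 - q.2) @ (x, w) --> x - w.
  have D1 := is_diff_fst (x, w); have D2 := is_diff_snd (x, w).
  exact: (is_diff_continuous (is_diffD_fun D1 (is_diffN_fun D2))).
have cg : (fun q : K * K => (radius b q.1 * cos (q.1 - q.2))^-1) @ (x, w)
    --> D^-1.
  apply: cvgV; first by rewrite gt_eqF.
  apply: cvgM.
    apply: (cvg_comp fst (radius b) _ (radius_continuous hb (x := x))).
    exact: cvg_fst.
  exact: (cvg_comp _ _ cs (@continuous_cos K (x - w))).
have cc : {for p, continuous c}.
  apply/cvgrPdist_lt => e e0; rewrite cp.
  move/cvgrPdist_lt : cg => /(_ _ e0) [[A B] [/= /nbhs_ballP[d d0 dA] nB] AB].
  have wB : \forall v \near p, B v.1 by exact: (cvg_fst nB).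
  near=> v; rewrite /c; case: eqP => [_|/eqP Nv]; first by rewrite subrr normr0.
  have [vx _ vo] : [/\ `|entry b v - x| < d, `|entry b v - v.1| < pi / 2 &
        offset b (entry b v) v.1 = v.2] by near: v; exact: entry_near.
  have [z zx ez] := slope v (entry b v).
  rewrite /N -vo ez in Nv *.
  have yx : entry b v - x != 0 by apply: contraNN Nv => /eqP ->; rewrite mulr0.
  have -> : (entry b v - x) / (radius b z * cos (z - v.1) * (entry b v - x))
      = (radius b z * cos (z - v.1))^-1 by rewrite invfM mulrCA divff // mulr1.
  apply: (AB (z, v.1)); split => /=; last by near: v.
  by apply: dA; rewrite /ball /= distrC (le_lt_trans zx).
have H := is_diff_factor (f := entry b) DN N0 cc.
rewrite cp in H; apply: (is_diff_fun (H _)); last by move=> v; rewrite mulrC.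
have wn : \forall v \near p, `|x - v.1| < pi / 2.
  have cn : (fun v : K * K => `|x - v.1|) @ p --> `|x - w|.
    by apply: cvg_norm; apply: cvgB; [exact: cvg_cst|exact: cvg_fst].
  exact: (cvgr_lt _ cn).
near=> v.
have [_ vw vo] : [/\ `|entry b v - x| < 1, `|entry b v - v.1| < pi / 2 &
        offset b (entry b v) v.1 = v.2] by near: v; exact: entry_near.
rewrite e1 /c; case: eqP => [Nv|/eqP Nv]; last by rewrite divfK.
apply/eqP; rewrite Nv mulr0 subr_eq0; apply/eqP.
apply: (offset_inj hb vw); first by near: v.
by rewrite vo; apply/eqP; rewrite -subr_eq0; apply/eqP.
Unshelve. all: by end_near. Qed.

End entry_point.

(** * The billiard map in terms of lines *)

Section billiard_map.
Variables (K : realType) (b : K -> K * K).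
Hypothesis hb : convex_curve b.
Implicit Types (x y w l : K) (q : K * K).

Lemma sin_le_norm x : `|sin x| <= `|x|.
Proof.
have [z _ e] := mean_value 0 x (@is_derive_sin K).
move: e; rewrite sin0 !subr0 => ->.
by rewrite normrM ler_piMl // cos_max.
Qed.

Lemma cos_eq1 x : `|x| < pi *+ 2 -> cos x = 1 -> x = 0.
Proof.
move=> hx e.
have s0 : sin (x / 2) = 0.
  have := cos_mulr2n (x / 2); have -> : x / 2 *+ 2 = x by rewrite mulr2n; lra.
  rewrite e cos2sin2 => /eqP; rewrite mulrnBl -subr_eq0 => /eqP h.
  apply/eqP; rewrite -[_ == _]orbb -mulf_eq0; apply/eqP.
  by move: h; rewrite !mulr2n expr2; lra.
move: hx; rewrite ltr_norml mulr2n => /andP[x1 x2].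
have [x0|x0|//] := ltgtP x 0.
  have := @sin_gt0_pi K (- (x / 2)); rewrite sinN s0 oppr0 ltxx.
  by move=> H; have : false by apply: H; lra.
have := @sin_gt0_pi K (x / 2); rewrite s0 ltxx.
by move=> H; have : false by apply: H; lra.
Qed.

(** Hence the outgoing line has angle [q.1 + q.2] and offset [offset b q.1 (q.1 + q.2)]. *)
Lemma velocityE q : velocity q = eta (q.1 + q.2).
Proof.
by rewrite /velocity /eta sinD cosD; congr pair => /=; rewrite /GRing.scale /=; ring.
Qed.

Lemma dot_eta_eta x y : dot (eta x) (eta y) = cos (x - y).
Proof. rewrite /dot /= cosB; ring. Qed.

Lemma dot_eta_tau x y : dot (eta x) (tau y) = - sin (x - y).
Proof. rewrite /dot /= sinB; ring. Qed.

Lemma dot_tau_tau x y : dot (tau x) (tau y) = cos (x - y).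
Proof. by rewrite /dot /= cosB. Qed.

Lemma dotC (p q : K * K) : dot p q = dot q p.
Proof. rewrite /dot; ring. Qed.

Lemma dotDl (p q r : K * K) : dot (p + q) r = dot p r + dot q r.
Proof. rewrite /dot /=; ring. Qed.

Lemma dotBl (p q r : K * K) : dot (p - q) r = dot p r - dot q r.
Proof. rewrite /dot /=; ring. Qed.

Lemma dotZl l (p q : K * K) : dot (l *: p) q = l * dot p q.
Proof. by case: p => p1 p2; rewrite /dot /= /GRing.scale /=; ring. Qed.

Lemma frame_eq w (p q : K * K) :
  dot p (tau w) = dot q (tau w) -> dot p (eta w) = dot q (eta w) -> p = q.
Proof.
rewrite /dot /= => e1 e2; have c2 := cos2Dsin2 w.
case: p q e1 e2 => [p1 p2] [q1 q2] /= e1 e2; congr pair.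
  have : (p1 - q1) * (cos w ^+ 2 + sin w ^+ 2) = 0.
    have -> : (p1 - q1) * (cos w ^+ 2 + sin w ^+ 2) =
      (p1 * cos w + p2 * sin w - (q1 * cos w + q2 * sin w)) * cos w
      - (p1 * - sin w + p2 * cos w - (q1 * - sin w + q2 * cos w)) * sin w by ring.
    by rewrite e1 e2; ring.
  by rewrite c2; lra.
have : (p2 - q2) * (cos w ^+ 2 + sin w ^+ 2) = 0.
  have -> : (p2 - q2) * (cos w ^+ 2 + sin w ^+ 2) =
    (p1 * cos w + p2 * sin w - (q1 * cos w + q2 * sin w)) * sin w
    + (p1 * - sin w + p2 * cos w - (q1 * - sin w + q2 * cos w)) * cos w by ring.
  by rewrite e1 e2; ring.
by rewrite c2; lra.
Qed.

(** [billiard_step] solved for the angles: both impacts are on one line, and the reflection law, a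
    vector identity in [billiard_step], becomes an equation between lifted angles that also fixes
    the multiple of [pi *+ 2]. *)
Definition bounce q q1 := [/\ strip q, strip q1,
  q1.2 = q1.1 - pi - (q.1 + q.2) &
  offset b q1.1 (q.1 + q.2) = offset b q.1 (q.1 + q.2)].

Lemma bounce_step q q1 : bounce q q1 -> billiard_step b q q1.
Proof.
case: q q1 => [x t] [x1 t1]; rewrite /bounce /strip /= => -[ht ht1 e o].
have x1E : x1 = x + t + pi + t1 by rewrite e; ring.
have pi0 := @pi_gt0 K.
have hx : x < x1 < x + pi *+ 2 by rewrite x1E mulr2n; lra.
split => //=.
  have s0 := support_gt0 hb hx.
  have ct : 0 < cos t by apply: cos_gt0_pihalf.
  have E : b x1 - b x = dot (b x1 - b x) (eta (x + t)) *: velocity (x, t).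
    apply: (@frame_eq (x + t)); rewrite velocityE dotZl /=.
      by rewrite dot_eta_tau subrr sin0 oppr0 mulr0 dotBl -/(offset b x1 _) o subrr.
    by rewrite dot_eta_eta subrr cos0 mulr1.
  exists (dot (b x1 - b x) (eta (x + t))).
    move: s0; rewrite {1}E dotZl velocityE /= dot_eta_eta.
    have -> : x + t - x = t by ring.
    by rewrite pmulr_lgt0.
  by rewrite -E addrC subrK.
rewrite !velocityE /=; apply: (@frame_eq x1).
  rewrite dotBl dotZl !dot_eta_tau subrr sin0 oppr0 mulr0 subr0.
  have -> : x1 + t1 - x1 = t1 by ring.
  have -> : x + t - x1 = - (t1 + pi) by rewrite x1E; ring.
  by rewrite sinN sinDpi opprK.
rewrite dotBl dotZl !dot_eta_eta subrr cos0 mulr1.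
have -> : x1 + t1 - x1 = t1 by ring.
have -> : x + t - x1 = - (t1 + pi) by rewrite x1E; ring.
by rewrite cosN cosDpi; ring.
Qed.

(** The reflection law gives [q1.2] only through its sine and cosine. The ranges of the three angles
    keep the difference of the two candidates strictly within one full turn, so [cos_eq1] identifies
    them. *)
Lemma step_bounce q q1 : strip q -> billiard_step b q q1 -> bounce q q1.
Proof.
case: q q1 => [x t] [x1 t1]; rewrite /strip /= => ht.
move=> [/= hx ht1 [l l0 e] r]; split => //=; last first.
  rewrite /offset e dotDl dotZl velocityE /= dot_eta_tau subrr sin0; ring.
rewrite !velocityE /= dot_eta_eta in r.
have rt : - sin t1 = sin (x1 - (x + t)).
  have := congr1 (fun p => dot p (tau x1)) r.
  rewrite dotBl dotZl !dot_eta_tau subrr sin0 oppr0 mulr0 subr0.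
  have -> : x1 + t1 - x1 = t1 by ring.
  by rewrite -[x + t - x1]opprB sinN opprK.
have rn : cos t1 = - cos (x1 - (x + t)).
  have := congr1 (fun p => dot p (eta x1)) r.
  rewrite dotBl dotZl !dot_eta_eta subrr cos0 mulr1.
  have -> : x1 + t1 - x1 = t1 by ring.
  rewrite -[x + t - x1]opprB cosN => ->; ring.
have c : cos (x1 - (x + t) - pi - t1) = 1.
  have -> : x1 - (x + t) - pi - t1 = x1 - (x + t) - (t1 + pi) by ring.
  rewrite cosB cosDpi sinDpi.
  have -> : cos (x1 - (x + t)) = - cos t1 by rewrite rn opprK.
  rewrite -rt mulrNN -expr2 mulrNN -expr2; exact: cos2Dsin2.
have [p0 ht'] := (@pi_gt0 K, ht); have ht1' := ht1.
move: hx; rewrite mulr2n => hx.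
have cos1 : 0 < cos t1 by apply: cos_gt0_pihalf.
apply/eqP; rewrite eq_sym -subr_eq0; apply/eqP; rewrite -[RHS](@cos_eq1 _ _ c).
  ring.
rewrite ltr_norml mulr2n; rewrite /strip /= in ht1'; lra.
Qed.

(** Uniqueness: a second solution would lie on the same line and on the same arc, centered at the
    angle of the reversed line, where [offset] is injective. *)
Lemma billiard_bounce q q1 : bounce q q1 -> billiard b q = q1.
Proof.
move=> B; apply: xget_unique; first exact: bounce_step.
have [sq] := B.
move=> s1 e1 o1 q2 /(step_bounce sq) [_ s2 e2 o2].
have E : q2.1 = q1.1.
  apply: (@offset_inj _ _ hb (q.1 + q.2 + pi)); rewrite ?offsetDpi ?o1 ?o2 //.
    by move: s2; rewrite /strip /= e2 ltr_norml; lra.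
  by move: s1; rewrite /strip /= e1 ltr_norml; lra.
by case: q1 q2 E e1 e2 {B s1 s2 o1 o2} => [x1 t1] [x2 t2] /= -> -> ->.
Qed.

(** A line leaves the region where the reversed line, with angle increased by [pi] and opposite
    offset, enters it. *)
Lemma bounce_entry q x1 : strip q -> `|x1 - (q.1 + q.2 + pi)| < pi / 2 ->
  offset b x1 (q.1 + q.2 + pi) = - offset b q.1 (q.1 + q.2) ->
  bounce q (x1, x1 - pi - (q.1 + q.2)).
Proof.
move=> sq h; rewrite offsetDpi => /oppr_inj o; split => //.
by move: h; rewrite /strip /= ltr_norml; lra.
Qed.

(** Time reversal changes the sign of the angle with the normal. Impact angles always increase in
    the lift, so the reversed step arrives one full turn above [q.1]. *)
Lemma bounce_rev q q1 : bounce q q1 ->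
  bounce (q1.1, - q1.2) (q.1 + pi *+ 2, - q.2).
Proof.
case: q q1 => [x t] [x1 t1]; rewrite /bounce /strip /= => -[ht ht1 e o].
have E : x1 - t1 = x + t + pi by rewrite e; ring.
rewrite E !offsetDpi offset_periodic // o; split => //; first by lra.
  by lra.
by rewrite mulr2n; ring.
Qed.

Lemma periodic_int (T : Type) (f : K -> T) (c : K) (k : int) x :
  (forall x, f (x + c) = f x) -> f (x + c *~ k) = f x.
Proof.
move=> per; have pn n y : f (y + c *+ n) = f y.
  by elim: n y => [|n IH] y; rewrite ?mulr0n ?addr0 // mulrS addrA IH per.
case: k => n; first exact: pn.
by rewrite NegzE mulrNz -(pn n.+1 (x - _)) subrK.
Qed.

Lemma sin_shift (k : int) x : sin (x + (pi *+ 2) *~ k) = sin x.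
Proof. by apply: periodic_int => y; rewrite sinD2pi. Qed.

Lemma cos_shift (k : int) x : cos (x + (pi *+ 2) *~ k) = cos x.
Proof. by apply: periodic_int => y; rewrite cosD2pi. Qed.

Lemma curve_shift (k : int) x : b (x + (pi *+ 2) *~ k) = b x.
Proof. by apply: periodic_int; exact: curve_periodic. Qed.

Lemma offset_shift (k : int) x w :
  offset b (x + (pi *+ 2) *~ k) (w + (pi *+ 2) *~ k) = offset b x w.
Proof. by rewrite /offset curve_shift /tau sin_shift cos_shift. Qed.

Lemma bounce_shift (k : int) q q1 :
  bounce q q1 -> bounce (shift2pi k q) (shift2pi k q1).
Proof.
rewrite /bounce /strip /= => -[h1 h2 e o]; split => //.
  by rewrite e; ring.
by rewrite -!addrA [_ *~ k + _]addrC !addrA !offset_shift.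
Qed.

End billiard_map.

(** * The island around a diameter between two confocal elliptic arcs *)

Section island.
Variables (K : realType) (b : K -> K * K).
Hypothesis hb : convex_curve b.
Variables (phi0 : K) (O : K * K) (c2 rho : K).
Hypotheses (c2_gt0 : 0 < c2) (rho_gt0 : 0 < rho).
Implicit Types (x y w l s d : K) (q : K * K).

(* With [h] the support function relative to [O], the two products are [- h]
   and [h'], so that near the diameter [h ^+ 2] is a constant plus
   [c2 * sin (x - phi0) ^+ 2]: the arcs belong to confocal ellipses. *)
Hypothesis confocal : forall x, `|sin (x - phi0)| < rho ->
  2 * dot (b x - O) (eta x) * dot (b x - O) (tau x) =
  - c2 * sin ((x - phi0) *+ 2).
Hypothesis diam : forall s, sin (s - phi0) = 0 -> dot (b s - O) (tau s) = 0.

Definition lever q := dot (b q.1 - O) (tau (q.1 + q.2)).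

(* Up to a constant, the product of the angular momenta about the two foci. *)
Definition integral_of_motion q :=
  lever q ^+ 2 + c2 * sin (q.1 + q.2 - phi0) ^+ 2.

Lemma leverE q : lever q =
  offset b q.1 (q.1 + q.2) - dot O (tau (q.1 + q.2)).
Proof. by rewrite /lever dotBl. Qed.

Lemma dot_tauD (p : K * K) x y :
  dot p (tau (x + y)) = dot p (tau x) * cos y + dot p (eta x) * sin y.
Proof. by rewrite /dot /= cosD sinD; ring. Qed.

(** The difference of the two values is [- 2 * sin y * cos y] times the defect of the identity
    [confocal] at [x]: that identity is what makes a reflection at [x] preserve the integral. *)
Lemma integral_rev x y : `|sin (x - phi0)| < rho ->
  integral_of_motion (x, - y) = integral_of_motion (x, y).
Proof.
move=> /confocal; rewrite /integral_of_motion /lever /= !dot_tauD cosN sinN.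
set P := dot _ (tau x); set Q := dot _ (eta x); set u := x - phi0 => e.
have -> : x - y - phi0 = u - y by rewrite /u; ring.
have -> : x + y - phi0 = u + y by rewrite /u; ring.
rewrite sin_mulr2n mulr2n in e; rewrite sinB sinD.
apply/eqP; rewrite -subr_eq0; apply/eqP.
transitivity (- 2 * sin y * cos y * (2 * Q * P -
   - c2 * (cos u * sin u + cos u * sin u))); first by ring.
by rewrite e; ring.
Qed.

(** Reversing a line changes the signs of the lever and of the sine but not their squares. The
    reversed arrival at [q1] and the departure from it differ by the sign of the angle, which is the
    case of [integral_rev]. *)
Lemma integral_bounce q q1 : bounce b q q1 -> `|sin (q1.1 - phi0)| < rho ->
  integral_of_motion q1 = integral_of_motion q.
Proof.
move=> [_ _ e o] z; rewrite [q1]surjective_pairing -integral_rev //.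
have w1 : q1.1 - q1.2 = q.1 + q.2 + pi by rewrite e; ring.
rewrite /integral_of_motion !leverE /= w1 offsetDpi o.
have -> : dot O (tau (q.1 + q.2 + pi)) = - dot O (tau (q.1 + q.2)).
  by rewrite dot_tauD cospi sinpi; ring.
have -> : q.1 + q.2 + pi - phi0 = q.1 + q.2 - phi0 + pi by ring.
by rewrite sinDpi; ring.
Qed.

Lemma integral_shift (k : int) q :
  integral_of_motion (shift2pi k q) = integral_of_motion q.
Proof.
rewrite /integral_of_motion /lever /= curve_shift //.
have -> : q.1 + (pi *+ 2) *~ k + q.2 = q.1 + q.2 + (pi *+ 2) *~ k by ring.
have -> : q.1 + q.2 + (pi *+ 2) *~ k - phi0 =
  q.1 + q.2 - phi0 + (pi *+ 2) *~ k by ring.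
by rewrite /tau sin_shift cos_shift sin_shift.
Qed.

Lemma sin_base s w : sin (s - phi0) = 0 ->
  sin (w - phi0) ^+ 2 = sin (w - s) ^+ 2.
Proof.
move=> s0; have -> : w - phi0 = (w - s) + (s - phi0) by ring.
rewrite sinD s0 mulr0 addr0 exprMn cos2sin2 s0; ring.
Qed.

Lemma small_sin s r : 0 < r -> exists2 d, 0 < d & forall w,
  `|w - s| < pi / 2 -> sin (w - s) ^+ 2 <= d -> `|w - s| < r.
Proof.
move=> r0; pose r' := Num.min r (pi / 4).
have pi0 := @pi_gt0 K.
have r'0 : 0 < r' by rewrite lt_min r0; lra.
have r'p : r' <= pi / 4 by rewrite ge_min lexx orbT.
have sr0 : 0 < sin r' by apply: sin_gt0_pi; lra.
exists (sin r' ^+ 2 / 2); first by rewrite divr_gt0 // exprn_gt0.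
move=> w hw hs; suff : `|w - s| < r' by rewrite lt_min => /andP[].
rewrite ltNge; apply/negP => rw.
have : sin r' <= `|sin (w - s)|.
  have -> : `|sin (w - s)| = sin `|w - s|.
    move: hw rw; rewrite ltr_norml => hw.
    have [u0|u0] := leP 0 (w - s); move=> rw.
      by rewrite !ger0_norm // sin_ge0_pi; lra.
    rewrite [in RHS]ler0_norm ?ltW // sinN ler0_norm //.
    by rewrite -oppr_ge0 -sinN sin_ge0_pi //; lra.
  move: rw hw; rewrite le_eqVlt => /orP[/eqP -> //|rw hw].
  by apply/ltW; rewrite ltr_sin ?in_itv /=; lra.
move=> h; have : sin r' ^+ 2 <= sin (w - s) ^+ 2.
  by rewrite -[leRHS]real_normK ?num_real // lerXn2r ?nnegrE // ltW.
have : 0 < sin r' ^+ 2 by rewrite exprn_gt0.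
lra.
Qed.

(** On the line of angle [s] through [O], which carries the diameter, the quadratic expression
    vanishes, and [diam] puts the entry point at [s]. Both terms being nonnegative, a small sum
    bounds the sine and the distance to [O] separately, and [entry_near] applies. The bound [pi / 2]
    excludes the opposite orientation. *)
Lemma near_line s r : sin (s - phi0) = 0 -> 0 < r ->
  exists2 d, 0 < d & forall w l, `|w - s| < pi / 2 ->
  (l - dot O (tau w)) ^+ 2 + c2 * sin (w - phi0) ^+ 2 <= d ->
  [/\ `|w - s| < r, `|entry b (w, l) - s| < r,
      `|entry b (w, l) - w| < pi / 2 & offset b (entry b (w, l)) w = l].
Proof.
move=> s0 r0; have pi0 := @pi_gt0 K.
have ss : `|s - s| < pi / 2 by rewrite subrr normr0; lra.
have [[A B] /= [/nbhs_ballP[eA eA0 hA] /nbhs_ballP[eB eB0 hB]] AB] :=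
  entry_near hb ss r0.
have os : offset b s s = dot O (tau s).
  by apply/eqP; rewrite -subr_eq0; apply/eqP; rewrite -(diam s0) dotBl.
have co : (fun w => dot O (tau w)) @ s --> dot O (tau s).
  have D w : is_derive w 1 (fun w => dot O (tau w)) (dot O (eta w)).
    by apply: is_derive_eq; rewrite /GRing.scale /dot /=; ring.
  exact: (is_derive_continuous D).
have eB2 : 0 < eB / 2 by rewrite divr_gt0.
move/cvgrPdist_lt : co => /(_ _ eB2) /nbhs_ballP[eC eC0 hC].
pose r' := Num.min r (Num.min eA eC).
have r'0 : 0 < r' by rewrite !lt_min r0 eA0 eC0.
have [d1 d10 hd1] := small_sin s r'0.
pose d := Num.min (c2 * d1) ((eB / 2) ^+ 2 / 2).
exists d; first by rewrite lt_min mulr_gt0 // divr_gt0 // exprn_gt0.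
move=> w l hw hd.
have hd' : (l - dot O (tau w)) ^+ 2 <= (eB / 2) ^+ 2 / 2 /\
    c2 * sin (w - phi0) ^+ 2 <= c2 * d1.
  move: hd; rewrite le_min => /andP[h1 h2].
  have := sqr_ge0 (l - dot O (tau w)).
  have : 0 <= c2 * sin (w - phi0) ^+ 2 by rewrite mulr_ge0 ?sqr_ge0 // ltW.
  by lra.
case: hd' => hl; rewrite ler_pM2l // (sin_base w s0) => hs.
have := hd1 w hw hs; rewrite !lt_min => /and3P[wr wA wC].
have lB : `|l - dot O (tau w)| < eB / 2.
  rewrite -(@ltr_pXn2r _ 2) ?nnegrE ?normr_ge0 // ?ltW // real_normK ?num_real //.
  apply: (le_lt_trans hl); have : 0 < (eB / 2) ^+ 2 by rewrite exprn_gt0.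
  lra.
have /AB /= [] : (A `*` B) (w, l).
  split => /=.
    by apply: hA; rewrite /ball /= distrC.
  apply: hB; rewrite /ball /= os.
  have := hC w; rewrite /ball /= distrC => /(_ wC) h.
  have -> : dot O (tau s) - l =
    (dot O (tau s) - dot O (tau w)) - (l - dot O (tau w)) by ring.
  by apply: (le_lt_trans (ler_normB _ _)); rewrite [ltRHS]splitr ltrD.
by split.
Qed.

Lemma zone_near s x : sin (s - phi0) = 0 -> `|x - s| < rho ->
  `|sin (x - phi0)| < rho.
Proof.
move=> s0; apply: le_lt_trans.
rewrite -(@ler_pXn2r _ 2) ?nnegrE ?normr_ge0 // real_normK ?num_real //.
rewrite (sin_base _ s0) -[sin _ ^+ 2]real_normK ?num_real //.
by apply: lerXn2r; rewrite ?nnegrE ?normr_ge0 ?sin_le_norm.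
Qed.

(** The integral does not see the orientation of a line, so a small sublevel set has a piece at each
    lift of either end of the diameter; the condition on [q.1 + q.2] selects the piece at [s]. *)
Definition cell d s : set (K * K) :=
  [set q | [/\ strip q, `|q.1 + q.2 - s| < pi / 2 & integral_of_motion q <= d]].

Lemma cell_small s r : sin (s - phi0) = 0 -> 0 < r ->
  exists2 d, 0 < d &
    forall q, cell d s q -> `|q.1 + q.2 - s| < r /\ `|q.1 - s| < r.
Proof.
move=> s0 r0; have [d d0 H] := near_line s0 r0; exists d => // q [sq qs Fq].
rewrite /integral_of_motion leverE in Fq.
have [h1 h2 _ _] := H _ _ qs Fq; split => //.
move: h2; rewrite (@entryP _ _ hb _ q.1) //=.
by move: sq; rewrite /strip /= ltr_norml; lra.
Qed.

Lemma cell_le d d' s q : d <= d' -> cell d s q -> cell d' s q.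
Proof. by move=> dd' [? ? h]; split => //; exact: le_trans h dd'. Qed.

Lemma cell_shift d s (k : int) q :
  cell d (s + (pi *+ 2) *~ k) (shift2pi k q) <-> cell d s q.
Proof.
rewrite /cell /= integral_shift /strip /=.
by have -> : q.1 + (pi *+ 2) *~ k + q.2 - (s + (pi *+ 2) *~ k) = q.1 + q.2 - s by ring.
Qed.

(** The symmetry under change of sign of the angle is included because, combined with the forward
    step, it produces preimages. *)
Definition good_cell d s :=
  (forall q, cell d s q -> cell d s (q.1, - q.2)) /\
  (forall q, cell d s q -> exists2 q1, cell d (s + pi) q1 & bounce b q q1).

Lemma good_cellP s : sin (s - phi0) = 0 ->
  exists2 d0, 0 < d0 & forall d, d <= d0 -> good_cell d s.
Proof.
move=> s0; have pi0 := @pi_gt0 K.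
(* After a reflection the deviation of the line from the axis is twice that of the impact minus that
   of the incoming line, so it stays below [3 * r < pi / 2]. *)
pose r := Num.min rho (pi / 8).
have r0 : 0 < r by rewrite lt_min rho_gt0; lra.
have rr : r <= rho by rewrite ge_min lexx.
have rp : r <= pi / 8 by rewrite ge_min lexx orbT.
have s0' : sin (s + pi - phi0) = 0.
  by rewrite addrAC sinDpi s0 oppr0.
have [d1 d10 H1] := cell_small s0 r0.
have [d2 d20 H2] := near_line s0' r0.
exists (Num.min d1 d2); first by rewrite lt_min d10.
move=> d; rewrite le_min => /andP[dd1 dd2]; split=> q cq.
  have [h1 h2] := H1 _ (cell_le dd1 cq); have [sq _ Fq] := cq.
  split.
  - by move: sq; rewrite /strip /=; lra.
  - move: h1 h2; rewrite /= !ltr_norml; lra.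
  - rewrite integral_rev -?surjective_pairing //.
    by apply: (zone_near s0); exact: lt_le_trans h2 rr.
have [h1 h2] := H1 _ (cell_le dd1 cq); have [sq ws Fq] := cq.
pose w := q.1 + q.2 + pi; pose l := - offset b q.1 (q.1 + q.2).
have hw : `|w - (s + pi)| < pi / 2.
  by have -> : w - (s + pi) = q.1 + q.2 - s by rewrite /w; ring.
have Fw : (l - dot O (tau w)) ^+ 2 + c2 * sin (w - phi0) ^+ 2 <= d2.
  apply: le_trans dd2; apply: le_trans Fq; rewrite /integral_of_motion leverE.
  have -> : w - phi0 = q.1 + q.2 - phi0 + pi by rewrite /w; ring.
  rewrite /l /w dot_tauD sinDpi cospi sinpi.
  rewrite le_eqVlt; apply/orP; left; apply/eqP; ring.
have [w1 x1s x1w ox] := H2 _ _ hw Fw.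
have B := bounce_entry sq x1w ox.
eexists; last exact: B.
have [_ sq1 _ _] := B; split => //.
  move: w1 x1s; rewrite /w /= !ltr_norml; lra.
rewrite (integral_bounce B) //=.
by apply: (zone_near s0'); exact: lt_le_trans x1s rr.
Qed.

(** Reverse, bounce, reverse. The lift has then advanced to the cell one full turn above [s], and
    the shift by [-1] brings it back. *)
Lemma cell_preimage d s q1 : good_cell d (s + pi) -> good_cell d (s + pi + pi) ->
  cell d (s + pi) q1 -> exists2 q, cell d s q & bounce b q q1.
Proof.
move=> [r1 st1] [r2 _] /r1/st1[q' /r2 cq' /(bounce_rev hb) B].
exists (shift2pi (-1) (q'.1, - q'.2)).
  rewrite -(cell_shift _ _ 1) {1}/shift2pi /= mulr1z mulrN1z addrNK.
  by rewrite mulr2n addrA.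
move/(bounce_shift hb (-1)) : B; rewrite /shift2pi /= mulrN1z opprK addrK.
by rewrite -surjective_pairing.
Qed.

Definition island d : set (K * K) :=
  [set q | exists k : int, cell d phi0 (shift2pi k q)].

Lemma shift2piD (j k : int) q : shift2pi j (shift2pi k q) = shift2pi (k + j) q.
Proof. by rewrite /shift2pi /= -addrA mulrzDr. Qed.

Lemma shift2pi0 q : shift2pi 0 q = q.
Proof. by rewrite /shift2pi mulr0z addr0 -surjective_pairing. Qed.

Lemma island_shift d (k : int) q : island d q -> island d (shift2pi k q).
Proof.
move=> [j cj]; exists (j - k); rewrite shift2piD.
by have -> : k + (j - k) = j by ring.
Qed.

(** Two steps lead to the cell at [phi0 + pi + pi], one shift above the start. Surjectivity pulls
    back from there with [cell_preimage], whose reversed step climbs one cell further; hence four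
    cells. *)
Lemma island_image d : (forall n, (n < 4)%N -> good_cell d (phi0 + pi *+ n)) ->
  iter 2 (billiard b) @` island d = island d.
Proof.
move=> good.
have g0 : good_cell d phi0 by have := good 0%N isT; rewrite mulr0n addr0.
have g1 : good_cell d (phi0 + pi) by have := good 1%N isT.
have g2 : good_cell d (phi0 + pi + pi).
  by have := good 2%N isT; rewrite mulr2n addrA.
have g3 : good_cell d (phi0 + pi + pi + pi).
  by have := good 3%N isT; rewrite !mulrS mulr0n addr0 !addrA.
have up q : cell d (phi0 + pi + pi) q -> cell d phi0 (shift2pi (-1) q).
  move=> cq; rewrite -(cell_shift _ _ 1) shift2piD shift2pi0 mulr1z mulr2n.
  by rewrite addrA.
have iter2 k q q1 q2 : bounce b (shift2pi k q) q1 -> bounce b q1 q2 ->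
    iter 2 (billiard b) q = shift2pi (- k) q2.
  move=> /(bounce_shift hb (- k)) B1 /(bounce_shift hb (- k)) B2.
  rewrite shift2piD subrr shift2pi0 in B1.
  by rewrite /= (billiard_bounce hb B1) (billiard_bounce hb B2).
apply/seteqP; split=> [_ [q [k cq] <-]|q [k cq]].
  have [q1 c1 B1] := g0.2 _ cq; have [q2 c2' B2] := g1.2 _ c1.
  rewrite (iter2 _ _ _ _ B1 B2); apply: island_shift; exists (-1); exact: up.
have c2' : cell d (phi0 + pi + pi) (shift2pi (k + 1) q).
  rewrite -shift2piD -addrA -mulr2n -[pi *+ 2]mulr1z; exact/cell_shift.
have [q1 c1 B2] := cell_preimage g2 g3 c2'.
have [q0 c0 B1] := cell_preimage g1 g2 c1.
exists (shift2pi (- (k + 1)) q0).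
  by exists (k + 1); rewrite shift2piD addNr shift2pi0.
rewrite (iter2 (k + 1) _ q1 (shift2pi (k + 1) q)) //.
  by rewrite shift2piD subrr shift2pi0.
by rewrite shift2piD addNr shift2pi0.
Qed.

End island.

(** * The linearized billiard at a diameter *)

Section diameter_differential.
Local Open Scope complex_scope.
Variables (K : realType) (b : K -> K * K).
Hypothesis hb : convex_curve b.

Lemma is_diff_near (V W : normedModType K) (f g dg : V -> W) (x : V) :
  is_diff x g dg -> (\forall v \near x, f v = g v) -> is_diff x f dg.
Proof.
move=> Dg fg.
pose E v := f v - g v.
have E0 : E \o shift x = cst (E x) + 0 +o_ 0 id.
  apply/eqaddoP => e e0.
  have fg0 : \forall h \near 0, f (h + x) = g (h + x).
    by move: fg; rewrite (@near_shift _ _ 0 x) /= subr0.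
  have fgx : f x = g x by exact: nbhs_singleton fg.
  near=> h.
  have -> : (E \o shift x - (cst (E x) + 0)) h = 0.
    rewrite !fctE /= /E fgx subrr addr0 subr0.
    by apply/eqP; rewrite subr_eq0; apply/eqP; near: h.
  by rewrite normr0 mulr_ge0 // ltW.
have dE : is_diff x E 0.
  have d0 : 'd E x = 0 :> (V -> W).
    by apply: diff_unique E0 => y; exact: cst_continuous.
  apply: DiffDef => //; apply/diff_locallyP; rewrite d0; split => // y.
  exact: cst_continuous.
have -> : f = g + E by apply/funext => v; rewrite !fctE /E addrC subrK.
by apply: is_diff_eq; apply/funext => v; rewrite !fctE addr0.
Unshelve. all: by end_near. Qed.

(** Near the diameter the impact is [entry b (v q)], where [v q] is the reversed outgoing line; [dx]
    is the composition of [entry_diff] with the differential of [v]. *)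
Lemma billiard_diff s : offset b (s + pi) s = offset b s s ->
  let L := dot (b (s + pi) - b s) (eta s) in
  let dx (h : K * K) := (L * (h.1 + h.2) - radius b s * h.1) / radius b (s + pi) in
  billiard b (s, 0) = (s + pi, 0) /\
  is_diff (s, 0) (billiard b) (fun h => (dx h, dx h - (h.1 + h.2))).
Proof.
move=> os L dx; have pi0 := @pi_gt0 K.
set p := (s, 0).
pose v (q : K * K) := (q.1 + q.2 + pi, - offset b q.1 (q.1 + q.2)).
have vp : v p = (s + pi, offset b (s + pi) (s + pi)).
  by rewrite /v /= addr0 offsetDpi os.
have D1 := is_diff_fst p; have D2 := is_diff_snd p.
have D12 := is_diffD_fun D1 D2.
have Dv : is_diff p v (fun h => (h.1 + h.2,
    - (radius b s * h.1 + height b s s * (h.1 + h.2)))).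
  have Dw : is_diff p (fun q : K * K => q.1 + q.2 + pi) (fun h => h.1 + h.2).
    apply: (is_diff_fun (is_diffD_fun D12 (is_diff_cst pi p))) => h.
    by rewrite addr0.
  have Do := is_diff_comp (is_diff_pair D1 D12) (offset_diff hb (p.1, p.1 + p.2)).
  apply: (is_diff_eq (is_diff_pair Dw (is_diffN_fun Do))).
  by apply/funext => h; rewrite /= addr0 subrr cos0 mulr1.
have ss : `|s + pi - (s + pi)| < pi / 2 by rewrite subrr normr0; lra.
have De := entry_diff hb ss; rewrite -vp in De.
have Dx := is_diff_comp Dv De.
have Rp := radius_gt0 hb (s + pi).
have {}Dx : is_diff p (fun q => entry b (v q)) dx.
  apply: (is_diff_fun Dx) => h /=.
  rewrite subrr cos0 mulr1 /dx; congr (_ / _).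
  by rewrite heightDpi /L dotBl -!/(height b _ _); ring.
have Dpi := is_diff_cst pi p.
have DT := is_diff_pair Dx
  (is_diffD_fun (is_diffD_fun Dx (is_diffN_fun Dpi)) (is_diffN_fun D12)).
have B : \forall q \near p, billiard b q =
    (entry b (v q), entry b (v q) - pi - (q.1 + q.2)).
  have cv : v @ p --> v p by exact: (is_diff_continuous Dv).
  have c2 : (@snd K K) @ p --> (0 : K) by exact: cvg_snd.
  have := entry_near hb ss ltr01; rewrite -vp => /cv En.
  near=> q.
  have [_ e1 e2] : [/\ `|entry b (v q) - (s + pi)| < 1,
    `|entry b (v q) - (v q).1| < pi / 2 & offset b (entry b (v q)) (v q).1 = (v q).2].
    by near: q.
  apply: (billiard_bounce hb); apply: bounce_entry => //.
  have : `|0 - q.2| < pi / 2.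
    by near: q; move/cvgrPdist_lt : c2; apply; lra.
  by rewrite sub0r normrN ltr_norml.
split.
  have := nbhs_singleton B; rewrite vp (entryP hb (v := (_, _)) ss erefl) => ->.
  by congr pair; rewrite /=; ring.
apply: (is_diff_near _ B).
apply: (is_diff_eq DT); apply/funext => h /=; congr pair.
by rewrite oppr0 addr0.
Unshelve. all: by end_near. Qed.

(** A real eigenvalue [x] would make [(x - M 0 0) ^+ 2 - M 0 1 * M 1 0] positive, but eliminating
    between the two coordinates of the eigenvector equation shows that this number annihilates the
    eigenvector. *)
Lemma matrix2_elliptic (M : 'M[K]_2) : M 0 0 = M 1 1 -> M 0 1 * M 1 0 < 0 ->
  elliptic_matrix M.
Proof.
move=> M11 Mneg z /eigenvalueP[u /rowP uM u0]; apply/negP => /complex_realP[x zx].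
subst z; move/negP: u0; apply; apply/eqP/rowP.
have e0 := uM 0; have e1 := uM 1.
rewrite !mxE !big_ord_recl !big_ord0 !mxE !addr0 /= in e0 e1.
have l1 : lift ord0 ord0 = 1 :> 'I_2 by apply/val_inj.
rewrite l1 -?M11 in e0 e1.
have {}e0 : u 0 1 * (M 1 0)%:C = (x - M 0 0)%:C * u 0 0.
  by rewrite rmorphB /= mulrBl -e0; ring.
have {}e1 : u 0 0 * (M 0 1)%:C = (x - M 0 0)%:C * u 0 1.
  by rewrite rmorphB /= mulrBl -e1; ring.
have d0 : ((x - M 0 0) ^+ 2 - M 0 1 * M 1 0)%:C != 0 :> K[i].
  rewrite -(rmorph0 (real_complex K)) (inj_eq (@complexI K)) gt_eqF //.
  by have := sqr_ge0 (x - M 0 0); lra.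
have z0 : u 0 0 = 0.
  apply: (mulfI d0); rewrite mulr0 expr2 rmorphB !rmorphM /=.
  by rewrite mulrBl -mulrA -e0 mulrA -e1; ring.
have z1 : u 0 1 = 0.
  apply: (mulfI d0); rewrite mulr0 expr2 rmorphB !rmorphM /=.
  by rewrite mulrBl -mulrA -e1 mulrA -e0; ring.
move=> j; rewrite mxE; case: (unliftP 0 j) => [k|] -> //.
by rewrite (ord1 k) l1.
Qed.

Lemma jacE (f df : K * K -> K * K) (q : K * K) (i j : 'I_2) : is_diff q f df ->
  jac f q i j =
  let w := df ((i == 0)%:R, (i == 1)%:R) in if j == 0 then w.1 else w.2.
Proof.
by move=> Df; rewrite /jac /lin1_mx !mxE diff_val /= [i == 0]eq_sym [i == 1]eq_sym.
Qed.

(** The radius at [s] is the derivative at [s] of the periodic function [offset b ^~ s]. *)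
Lemma radius_periodic s : radius b (s + pi *+ 2) = radius b s.
Proof.
have d : is_derive s 1 (offset b ^~ s) (radius b (s + pi *+ 2) * 1).
  have -> : offset b ^~ s = (offset b ^~ s) \o shift (pi *+ 2).
    by apply/funext => x; rewrite /= offset_periodic.
  apply: is_derive1_comp; last exact: is_derive_shift.
  apply: (is_derive_eq (offset_derive hb s _)).
  by rewrite /= addrAC subrr add0r cos2pi mulr1.
have := offset_derive hb s s; rewrite subrr cos0.
by move=> [_ e1]; case: d => _ e2; rewrite -[LHS]mulr1 -[RHS]mulr1 -e1 -e2.
Qed.

(** The differential of the second iterate has equal diagonal entries, and the product of the other
    two is [(L - (R0 + Rpi)) * ((L - R0) * (L - Rpi))] times a positive factor. *)
Lemma elliptic_diameter_point s : offset b (s + pi) s = offset b s s ->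
  let L := dot (b (s + pi) - b s) (eta s) in
  let R0 := radius b s in let Rpi := radius b (s + pi) in
  L - (R0 + Rpi) < 0 -> 0 < (L - R0) * (L - Rpi) ->
  elliptic_point b 2 (s, 0).
Proof.
move=> os L R0 Rpi h1 h2; have pi0 := @pi_gt0 K.
have [T0 D0] := billiard_diff os.
have os' : offset b (s + pi + pi) (s + pi) = offset b (s + pi) (s + pi).
  by rewrite !offsetDpi -addrA -mulr2n offset_periodic // os.
have [T1 D1] := billiard_diff os'.
have RE : radius b (s + pi + pi) = radius b s.
  by rewrite -addrA -mulr2n radius_periodic.
have LE : dot (b (s + pi + pi) - b (s + pi)) (eta (s + pi)) = L.
  rewrite -addrA -mulr2n curve_periodic // /L /dot /eta /= sinDpi cosDpi; ring.
rewrite RE LE -/R0 -/Rpi -/L in D0 D1.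
rewrite -T0 in D1.
have D := is_diff_comp D0 D1.
have T2 : iter 2 (billiard b) (s, 0) = (s + pi + pi, 0) by rewrite /= T0 T1.
split; first by rewrite /strip /=; lra.
- split=> //; first by exists 1; rewrite T2 /shift2pi /= mulr1z mulr2n -addrA.
  (* Were one step already the identity modulo full turns, [pi] would be a multiple of [pi *+ 2] and
     [1] an even integer. *)
  move=> [|[|m]] // _ [k]; rewrite /= T0 /shift2pi /= => -[/addrI e].
  have {}e : pi * 1%:~R = pi * (2 * k)%:~R :> K.
    by rewrite mulr1 {1}e intrM mulrA mulr_natr mulrzr.
  have : 1 = 2 * k.
    by apply/eqP; rewrite -(eqr_int K); apply/eqP; apply: (mulfI (lt0r_neq0 pi0)).
  by move=> /(congr1 (fun z : int => odd `|z|%N)); rewrite abszM oddM.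
- exact: (@ex_diff _ _ _ _ _ _ _ D).
have R00 : 0 < R0 by exact: radius_gt0.
have Rp0 : 0 < Rpi by exact: radius_gt0.
have L0 : 0 < L by apply: support_gt0 => //; rewrite mulr2n; lra.
have nR : (R0 != 0) && (Rpi != 0) by rewrite !gt_eqF.
case/andP: nR => nR0 nRpi.
apply: matrix2_elliptic; rewrite !(jacE _ _ D) /=.
  rewrite mulr1 !mulr0; field.
  by rewrite ?nR0 ?nRpi.
set X := (X in X < 0); have -> : X = 4 * L * (L - (R0 + Rpi)) *
    ((L - R0) * (L - Rpi)) / (R0 * Rpi) ^+ 2.
  by rewrite /X; field; rewrite ?nR0 ?nRpi.
rewrite pmulr_llt0 ?invr_gt0 ?exprn_gt0 ?mulr_gt0 //.
by rewrite pmulr_llt0 // pmulr_rlt0 // mulr_gt0.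
Qed.

End diameter_differential.

(** * Measurability and positive measure *)

Section positive_measure.
Variables (K : realType) (b : K -> K * K).
Hypothesis hb : convex_curve b.
Let T := (measurableTypeR K * measurableTypeR K)%type.

Lemma measurable_fst_comp (f : K -> K) :
  continuous f -> measurable_fun setT (fun q : T => f q.1).
Proof.
move=> cf; exact: (measurableT_comp (continuous_measurable_fun cf) measurable_fst).
Qed.

Lemma measurable_snd_comp (f : K -> K) :
  continuous f -> measurable_fun setT (fun q : T => f q.2).
Proof.
move=> cf; exact: (measurableT_comp (continuous_measurable_fun cf) measurable_snd).
Qed.

Lemma measurable_lt_set (f g : T -> K) :
  measurable_fun setT f -> measurable_fun setT g -> measurable [set q | f q < g q].
Proof.
move=> mf mg; have := measurable_fun_ltr mf mg measurableT (Y := [set true]) I.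
by rewrite setTI; congr measurable; apply/seteqP; split=> q /= ->.
Qed.

Lemma measurable_le_set (f g : T -> K) :
  measurable_fun setT f -> measurable_fun setT g -> measurable [set q | f q <= g q].
Proof.
move=> mf mg; have := measurable_fun_ler mf mg measurableT (Y := [set true]) I.
by rewrite setTI; congr measurable; apply/seteqP; split=> q /= ->.
Qed.

Lemma measurable_strip : measurable (@strip K : set T).
Proof.
have -> : @strip K = [set q : T | - (pi / 2) < q.2] `&` [set q : T | q.2 < pi / 2].
  by apply/seteqP; split=> q /andP.
by apply: measurableI; apply: measurable_lt_set => //; exact: measurable_snd.
Qed.

(** A shift brings the interior point into the fundamental domain. A small rectangle there has
    positive area, and the continuous density has a positive minimum on it. *)
Lemma phase_measure_gt0 (U : set (K * K)) (x : K) :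
  measurable (U : set T) -> (forall k q, U q -> U (shift2pi k q)) ->
  interior U (x, 0) -> (0 < phase_measure b U)%E.
Proof.
move=> mU sU [[A B] /= [/nbhs_ballP[eA /= eA0 hA] /nbhs_ballP[eB /= eB0 hB]] AB].
have pi0 := @pi_gt0 K.
have tp0 : 0 < pi *+ 2 :> K by rewrite mulr2n; lra.
pose k := - Num.floor (x / (pi *+ 2)).
pose x' := x + (pi *+ 2) *~ k.
have x'_itv : 0 <= x' < pi *+ 2.
  have := floor_itv (x / (pi *+ 2)).
  rewrite intrD ler_pdivlMr // ltr_pdivrMr // mulrDl mul1r => /andP[h1 h2].
  rewrite /x' /k mulrNz -mulrzr mulrC; lra.
(* The rectangle extends only to the right of [x'], which may be the left end [0] of the fundamental
   domain; the bound [pi *+ 2 - x'] keeps it off the right end. *)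
pose r := Num.min (Num.min eA eB) (Num.min (pi *+ 2 - x') (pi / 2)) / 2.
have r0 : 0 < r by rewrite divr_gt0 // !lt_min eA0 eB0 subr_gt0; lra.
have rm : r < Num.min (Num.min eA eB) (Num.min (pi *+ 2 - x') (pi / 2)).
  by rewrite /r ltr_pdivrMr // mulr_natr mulr2n ltrDl; move: r0; rewrite /r; lra.
move: rm; rewrite !lt_min => /andP[/andP[rA rB] /andP[rx rp]].
pose X := `[x', x' + r]%classic : set (measurableTypeR K).
pose Y := `[0, r]%classic : set (measurableTypeR K).
have XY_U : X `*` Y `<=` U `&` [set q : K * K | (0 <= q.1 < pi *+ 2)%R /\ strip q].
  move=> [y t] []; rewrite /X /Y /= !in_itv /= => yX tY; split; last first.
    by rewrite /strip /=; split; lra.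
  have -> : (y, t) = shift2pi k (y - (pi *+ 2) *~ k, t).
    by rewrite /shift2pi /= subrK.
  apply: sU; apply: AB; split => /=.
    apply: hA; rewrite /ball /=; have -> : x = x' - (pi *+ 2) *~ k.
      by rewrite /x' addrK.
    by rewrite ltr_norml; lra.
  by apply: hB; rewrite /ball /= ltr_norml; lra.
have [c cX cm] : exists2 c, c \in `[x', x' + r] &
    forall t, t \in `[x', x' + r] -> radius b c <= radius b t.
  apply: EVT_min; first by lra.
  by apply: continuous_subspaceT; exact: radius_continuous.
have [c' cY cm'] : exists2 c, c \in `[0, r] &
    forall t, t \in `[0, r] -> cos c <= cos t.
  apply: EVT_min; first by lra.
  by apply: continuous_subspaceT; exact: continuous_cos.
have m0 : 0 < radius b c * cos c'.
  rewrite mulr_gt0 ?radius_gt0 ?cos_gt0_pihalf //.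
  by rewrite in_itv /= in cY; lra.
have mf : measurable_fun setT (fun q : T => (radius b q.1 * cos q.2)%:E).
  apply/measurable_EFinP; apply: measurable_funM.
    by apply: measurable_fst_comp; exact: radius_continuous.
  by apply: measurable_snd_comp; exact: continuous_cos.
have mXY : measurable (X `*` Y : set T).
  by apply: measurableX; exact: measurable_itv.
have mD : measurable (U `&` [set q : K * K | (0 <= q.1 < pi *+ 2)%R /\ strip q] : set T).
  apply: measurableI => //.
  have -> : [set q : K * K | (0 <= q.1 < pi *+ 2)%R /\ strip q] =
    [set q : T | 0 <= q.1] `&` [set q : T | q.1 < pi *+ 2] `&` (@strip K).
    by apply/seteqP; split=> q; [move=> [/andP[? ?] ?]|move=> [[? ?] ?]; split => //; apply/andP].
  apply: measurableI; last exact: measurable_strip.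
  apply: measurableI.
    by apply: measurable_le_set => //; exact: measurable_fst.
  by apply: measurable_lt_set => //; exact: measurable_fst.
rewrite /phase_measure.
apply: (@lt_le_trans _ _ (\int[(@lebesgue_measure K) \x (@lebesgue_measure K)]_(q in
   X `*` Y) (cst (radius b c * cos c')%:E) q)%E).
  have E := product_measure1E (@lebesgue_measure K) (@lebesgue_measure K)
    (measurable_itv `[x', x' + r]) (measurable_itv `[0, r]).
  rewrite integral_cst //.
  have lm (u v : K) : u < v ->
      lebesgue_measure (`[u, v]%classic : set (measurableTypeR K)) = (v - u)%:E.
    by move=> uv; rewrite lebesgue_measure_itv /= lte_fin uv.
  have l1 : x' < x' + r by rewrite ltrDl.
  move: E; rewrite [X in (X * _)%E](lm _ _ l1) [X in (_ * X)%E](lm _ _ r0) => E.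
  rewrite [X in (_ * X)%E]E.
  by rewrite -!EFinM lte_fin mulr_gt0 // mulr_gt0 //; lra.
have fge0 (q : T) : strip q -> (0 <= (radius b q.1 * cos q.2)%:E)%E.
  move=> sq; rewrite lee_fin mulr_ge0 ?ltW ?radius_gt0 //.
  exact: cos_gt0_pihalf.
apply: le_trans; last first.
  apply: (ge0_subset_integral _ mXY mD) XY_U.
    exact: measurable_funTS.
  by move=> q [_ [_ sq]]; exact: fge0.
apply: ge0_le_integral => //.
- by move=> q _; rewrite lee_fin ltW.
- exact: measurable_funTS.
- move=> [y t] []; rewrite /X /Y /= => yX tY; rewrite lee_fin.
  apply: ler_pM; [exact/ltW/radius_gt0| |exact: cm|exact: cm'].
  by apply/ltW/cos_gt0_pihalf; rewrite in_itv /= in cY; lra.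
Qed.

End positive_measure.

(** * The island as a disk of positive measure *)

Section positive_island.
Variables (K : realType) (b : K -> K * K).
Hypothesis hb : convex_curve b.
Variables (phi0 : K) (O : K * K) (c2 rho : K).
Hypotheses (c2_gt0 : 0 < c2) (rho_gt0 : 0 < rho).
Hypothesis confocal : forall x : K, `|sin (x - phi0)| < rho ->
  2 * dot (b x - O) (eta x) * dot (b x - O) (tau x) =
  - c2 * sin ((x - phi0) *+ 2).
Hypothesis diam : forall s : K, sin (s - phi0) = 0 -> dot (b s - O) (tau s) = 0.
Let L := dot (b (phi0 + pi) - b phi0) (eta phi0).
Hypothesis L_lt : L - (radius b phi0 + radius b (phi0 + pi)) < 0.
Hypothesis L_out : 0 < (L - radius b phi0) * (L - radius b (phi0 + pi)).
Local Notation cell := (cell b phi0 O c2).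
Local Notation island := (island b phi0 O c2).
Local Notation lever := (lever b O).
Local Notation F := (integral_of_motion b phi0 O c2).

Lemma diff_dot (p : K * K) (V : normedModType K) (g dg : V -> K) (x : V) :
  is_diff x g dg ->
  is_diff x (fun v => dot p (tau (g v))) (fun v => dot p (eta (g x)) * dg v).
Proof.
move=> Dg; have D (w : K) : is_derive w 1 (fun w => dot p (tau w)) (dot p (eta w)).
  by apply: is_derive_eq; rewrite /GRing.scale /dot /=; ring.
exact: (is_diff_comp1 (D _) Dg).
Qed.

(** Only continuity is drawn from this, so the differential is left existential. *)
Lemma lever_diff (V : normedModType K) (g dg h dh : V -> K) (x : V) :
  is_diff x g dg -> is_diff x h dh ->
  exists df, is_diff x (fun v => lever (g v, h v)) df.
Proof.
move=> Dg Dh; have Dgh := is_diffD_fun Dg Dh.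
have Do := is_diff_comp (is_diff_pair Dg Dgh) (offset_diff hb (g x, g x + h x)).
have D := is_diffD_fun Do (is_diffN_fun (diff_dot O Dgh)).
have E : (fun v => lever (g v, h v)) =
  (fun v => ((fun p : K * K => offset b p.1 p.2) \o (fun x => (g x, g x + h x))) v -
            dot O (tau (g v + h v))).
  by apply/funext => v; rewrite leverE.
by rewrite -E in D; eexists; exact: D.
Qed.

Lemma integral_continuous : continuous F.
Proof.
move=> q; have [df D] := lever_diff (is_diff_fst q) (is_diff_snd q).
have D12 := is_diffD_fun (is_diff_fst q) (is_diff_snd q).
have Ds := is_diff_comp1 (g := fun v : K * K => v.1 + v.2 - phi0)
  (is_derive_sin _) (is_diffD_fun D12 (is_diff_cst (- phi0) q)).
have Dc := is_diffM_fun (is_diff_cst c2 q) (is_diffM_fun Ds Ds).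
have := is_diff_continuous (is_diffD_fun (is_diffM_fun D D) Dc).
by congr {for q, continuous _}.
Qed.

Lemma integral_diameter : F (phi0, 0) = 0.
Proof.
rewrite /integral_of_motion /lever /= !addr0 subrr sin0 diam ?subrr ?sin0 //.
by rewrite expr0n /= mulr0 addr0.
Qed.

Lemma island_interior d : 0 < d -> interior (island d) (phi0, 0).
Proof.
move=> d0; have pi0 := @pi_gt0 K.
have ct : (@snd K K) @ (phi0, 0 : K) --> (0 : K) by exact: cvg_snd.
have cw : (fun q : K * K => q.1 + q.2) @ (phi0, 0 : K) --> phi0.
  rewrite -[X in _ --> X]addr0.
  exact: (is_diff_continuous
    (is_diffD_fun (is_diff_fst (phi0, 0)) (is_diff_snd (phi0, 0)))).
have cF : F @ (phi0, 0 : K) --> (0 : K).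
  by rewrite -[X in _ --> X]integral_diameter; exact: integral_continuous.
rewrite /interior; near=> q; exists 0; rewrite shift2pi0; split.
- have : `|0 - q.2| < pi / 2.
    by near: q; move/cvgrPdist_lt : ct; apply; lra.
  by rewrite sub0r normrN ltr_norml.
- by rewrite distrC; near: q; move/cvgrPdist_lt : cw; apply; lra.
- by apply/ltW; near: q; exact: (cvgr_lt _ cF).
Unshelve. all: by end_near. Qed.

Lemma island_measurable d :
  measurable (island d : set (measurableTypeR K * measurableTypeR K)).
Proof.
have -> : island d = \bigcup_(k : int) (shift2pi k @^-1` cell d phi0).
  by apply/seteqP; split=> [q [k ck]|q [k _ ck]]; exists k.
apply: countable_bigcupT_measurable; first exact: countableP.
move=> k; pose T := (measurableTypeR K * measurableTypeR K)%type.
have m1 : measurable_fun setT (fun q : T => q.1) by exact: measurable_fst.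
have m2 : measurable_fun setT (fun q : T => q.2) by exact: measurable_snd.
have m12 : measurable_fun setT (fun q : T => q.1 + q.2) by exact: measurable_funD.
have msin : measurable_fun setT (fun q : T => sin (q.1 + q.2 - phi0)).
  apply: (measurableT_comp (f := fun w : measurableTypeR K => sin (w - phi0)) _ m12).
  apply: continuous_measurable_fun; apply: (smooth_continuous (n := 0)).
  apply: smooth_comp; first exact: smooth_sin.
  by apply: smoothB; [exact: smooth_id|exact: smooth_cst].
have mcos1 : measurable_fun setT (fun q : T => cos (q.1 + q.2)).
  apply: (measurableT_comp (f := @cos K) _ m12).
  by apply: continuous_measurable_fun; exact: continuous_cos.
have msin1 : measurable_fun setT (fun q : T => sin (q.1 + q.2)).
  apply: (measurableT_comp (f := @sin K) _ m12).
  by apply: continuous_measurable_fun; exact: continuous_sin.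
have [s1 s2] := curve_smooth hb.
have mF : measurable_fun setT (F : T -> K).
  rewrite /integral_of_motion /lever /dot /=; apply: measurable_funD.
    apply: measurable_funX; apply: measurable_funD; apply: measurable_funM => //.
      apply: (@measurable_fst_comp _ (fun x => (b x).1 - O.1)).
      exact: (smooth_continuous (smoothB s1 (smooth_cst _ O.1))).
    apply: (@measurable_fst_comp _ (fun x => (b x).2 - O.2)).
    exact: (smooth_continuous (smoothB s2 (smooth_cst _ O.2))).
  by apply: measurable_funM => //; exact: measurable_funX.
have mcell : measurable (cell d phi0 : set T).
  have -> : cell d phi0 = (@strip K) `&`
     [set q : T | `|q.1 + q.2 - phi0| < pi / 2] `&` [set q : T | F q <= d].
    by apply/seteqP; split=> q; [move=> []|move=> [[]]].
  apply: measurableI; last exact: measurable_le_set.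
  apply: measurableI; first exact: measurable_strip.
  apply: measurable_lt_set => //.
  apply: measurableT_comp => //.
  exact: measurable_funB.
have ms : measurable_fun setT (shift2pi k : T -> T).
  apply/measurable_fun_pairP; split=> //.
  by apply: measurable_funD.
by rewrite -[X in measurable X]setTI; exact: ms.
Qed.

Lemma cylinder_shift (k : int) q : cylinder (shift2pi k q) = @cylinder K q.
Proof. by rewrite /cylinder /= sin_shift cos_shift. Qed.

Lemma cylinder_island d :
  @cylinder K @` island d = @cylinder K @` cell d phi0.
Proof.
apply/seteqP; split=> [_ [q [k ck] <-]|_ [q cq <-]].
  by exists (shift2pi k q) => //; rewrite cylinder_shift.
by exists q => //; exists 0; rewrite shift2pi0.
Qed.

Lemma diskP (u : K * K) : @disk K u <-> u.1 ^+ 2 + u.2 ^+ 2 <= 1.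
Proof.
rewrite /disk /enorm /dot /= -!expr2 -[X in _ <= X]sqrtr1.
by rewrite ler_sqrt.
Qed.

Lemma continuous_at_within (S T : topologicalType) (A : set S) (f : S -> T) :
  (forall x, A x -> {for x, continuous f}) -> {within A, continuous f}.
Proof. by move=> cf; apply: continuous_in_subspaceT => x /set_mem /cf. Qed.

(** In the coordinates [lever q / rd] and [rc * sin (q.1 + q.2 - phi0) / rd] the inequality
    [F q <= d] is that of the unit disk. Conversely these coordinates determine the angle and the
    offset of a line, and the line determines the point as its entry point. *)
Lemma cell_homeomorphic d : 0 < d -> d < c2 ->
  (forall q, cell d phi0 q -> `|q.1 - phi0| < pi / 2) ->
  (forall w l, `|w - phi0| < pi / 2 ->
    (l - dot O (tau w)) ^+ 2 + c2 * sin (w - phi0) ^+ 2 <= d ->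
    `|entry b (w, l) - w| < pi / 2 /\ offset b (entry b (w, l)) w = l) ->
  homeomorphic (@cylinder K @` cell d phi0) (@disk K).
Proof.
move=> d0 dc small line; have pi0 := @pi_gt0 K.
set rd := Num.sqrt d; set rc := Num.sqrt c2.
have rd0 : 0 < rd by rewrite sqrtr_gt0.
have rc0 : 0 < rc by rewrite sqrtr_gt0.
have rdc : rd < rc by rewrite ltr_sqrt.
have rdE : rd ^+ 2 = d by rewrite sqr_sqrtr // ltW.
have rcE : rc ^+ 2 = c2 by rewrite sqr_sqrtr // ltW.
(* On the cylinder only the cosine and sine of [q.1] are available; the bound [small] lets [asin]
   recover [q.1 - phi0] from [sn]. *)
pose sn (p : (K * K) * K) := p.1.2 * cos phi0 - p.1.1 * sin phi0.
have snE q : sn (cylinder q) = sin (q.1 - phi0) by rewrite /sn /= sinB; ring.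
pose f (p : (K * K) * K) := (lever (phi0 + asin (sn p), p.2) / rd,
   rc * sin (asin (sn p) + p.2) / rd).
pose wg (u : K * K) := phi0 + asin (rd * u.2 / rc).
pose lg (u : K * K) := rd * u.1 + dot O (tau (wg u)).
pose g (u : K * K) := cylinder (entry b (wg u, lg u), wg u - entry b (wg u, lg u)).
have asin_small x : `|x| < pi / 2 -> asin (sin x) = x.
  by rewrite ltr_norml => hx; rewrite sinK // in_itv /=; lra.
have fE q : `|q.1 - phi0| < pi / 2 ->
    f (cylinder q) = (lever q / rd, rc * sin (q.1 + q.2 - phi0) / rd).
  move=> hq; rewrite /f snE asin_small //=.
  have -> : phi0 + (q.1 - phi0) = q.1 by ring.
  by rewrite -surjective_pairing addrAC.
(* This is where [d < c2] enters: the argument of [asin] stays strictly inside the interval on which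
   [asin] is differentiable. *)
have vB u : @disk K u -> -1 < rd * u.2 / rc < 1.
  move=> /diskP hu; have u2 : `|u.2| <= 1.
    rewrite -(@expr_le1 _ 2) // real_normK ?num_real //.
    by have := sqr_ge0 u.1; lra.
  rewrite -ltr_norml normrM normrM [`|rd|]gtr0_norm // [`|rc^-1|]gtr0_norm ?invr_gt0 //.
  rewrite ltr_pdivrMr // mul1r; apply: le_lt_trans rdc.
  by rewrite ler_piMr // ltW.
have wgB u : @disk K u -> `|wg u - phi0| < pi / 2.
  move=> /vB /andP[v1 v2]; rewrite /wg addrC addKr ltr_norml.
  by rewrite asin_gtNpi2 ?asin_ltpi2 // ?v1 ?v2 ?ltW.
have wgS u : @disk K u -> sin (wg u - phi0) = rd * u.2 / rc.
  move=> /vB /andP[v1 v2]; rewrite /wg addrC addKr asinK //.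
  by rewrite in_itv /= !ltW.
have gcell u : @disk K u -> exists2 q, cell d phi0 q &
    [/\ g u = cylinder q, q.1 + q.2 = wg u & lever q = rd * u.1].
  move=> du; have Fd : (lg u - dot O (tau (wg u))) ^+ 2 + c2 * sin (wg u - phi0) ^+ 2 <= d.
    rewrite wgS // /lg addrK -rcE -rdE.
    have -> : (rd * u.1) ^+ 2 + rc ^+ 2 * (rd * u.2 / rc) ^+ 2 =
       rd ^+ 2 * (u.1 ^+ 2 + u.2 ^+ 2) by field; rewrite gt_eqF.
    by rewrite ler_piMr ?sqr_ge0 //; apply/diskP.
  have [e1 e2] := line _ _ (wgB u du) Fd.
  exists (entry b (wg u, lg u), wg u - entry b (wg u, lg u)).
    split => /=.
    - by rewrite /strip /= -ltr_norml distrC.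
    - by rewrite [_ + (_ - entry _ _)]addrC subrK wgB.
    - by rewrite /integral_of_motion leverE /= [_ + (_ - _)]addrC subrK e2.
  split => //=; first by rewrite addrC subrK.
  by rewrite leverE /= [_ + (_ - _)]addrC subrK e2 /lg addrK.
have FG u : @disk K u -> f (g u) = u.
  move=> du; have [q cq [-> wq lq]] := gcell u du.
  rewrite fE ?small // wq lq wgS //; case: u {du lq wq} => u1 u2 /=.
  by congr pair; field; rewrite ?gt_eqF.
have fdisk q : cell d phi0 q -> @disk K (f (cylinder q)).
  move=> cq; rewrite fE ?small //; apply/diskP => /=.
  have [_ _ Fq] := cq.
  have -> : (lever q / rd) ^+ 2 + (rc * sin (q.1 + q.2 - phi0) / rd) ^+ 2 = F q / d.
    by rewrite /integral_of_motion -rdE -rcE; field; rewrite gt_eqF.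
  by rewrite ler_pdivrMr // mul1r.
have GF q : cell d phi0 q -> g (f (cylinder q)) = cylinder q.
  move=> cq; have dq := fdisk q cq; rewrite fE ?small // in dq *.
  have [sq wq Fq] := cq.
  have wE : wg (lever q / rd, rc * sin (q.1 + q.2 - phi0) / rd) = q.1 + q.2.
    rewrite /wg /=; set v := rd * _ / rc.
    have -> : v = sin (q.1 + q.2 - phi0) by rewrite /v; field; rewrite !gt_eqF.
    by rewrite asin_small //; ring.
  have lE : lg (lever q / rd, rc * sin (q.1 + q.2 - phi0) / rd) = offset b q.1 (q.1 + q.2).
    rewrite /lg wE /= mulrC divfK ?gt_eqF // leverE subrK //.
  rewrite /g wE lE (entryP hb (x := q.1)) //=.
    by rewrite [q.1 + q.2]addrC addrK -surjective_pairing.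
  by move: sq; rewrite /strip /= ltr_norml; lra.
exists f, g; split; first split.
- apply: continuous_at_within => _ [q cq <-]; set p := cylinder q.
  have Da := is_diff_comp (is_diff_fst p) (is_diff_fst p.1).
  have Db := is_diff_comp (is_diff_fst p) (is_diff_snd p.1).
  have Dsn : is_diff p sn _ := is_diffD_fun
    (is_diffM_fun Db (is_diff_cst (cos phi0) p))
    (is_diffN_fun (is_diffM_fun Da (is_diff_cst (sin phi0) p))).
  have sB : -1 < sn p < 1.
    have := small q cq; rewrite ltr_norml => hq.
    have c0 : 0 < cos (q.1 - phi0) by exact: cos_gt0_pihalf.
    rewrite snE -ltr_norml -(@expr_lt1 _ 2) // real_normK ?num_real //.
    by rewrite sin2cos2 ltrBlDr ltrDl exprn_gt0.
  have Das := is_diff_comp1 (is_derive1_asin sB) Dsn.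
  have D2 := is_diff_snd p.
  have [dl Dl] := lever_diff (is_diffD_fun (is_diff_cst phi0 p) Das) D2.
  have Ds := is_diff_comp1 (g := fun p => asin (sn p) + p.2)
    (is_derive_sin _) (is_diffD_fun Das D2).
  have Df1 := is_diffM_fun Dl (is_diff_cst rd^-1 p).
  have Df2 := is_diffM_fun (is_diffM_fun (is_diff_cst rc p) Ds) (is_diff_cst rd^-1 p).
  exact: (is_diff_continuous (is_diff_pair Df1 Df2)).
- apply: continuous_at_within => u du.
  have [q [sq _ _] [_ wq lq]] := gcell u du.
  have qw : `|q.1 - wg u| < pi / 2.
    by move: sq; rewrite -wq /strip /= ltr_norml; lra.
  have D1 := is_diff_fst u; have D2 := is_diff_snd u.
  have Dv := is_diffM_fun (is_diffM_fun (is_diff_cst rd u) D2) (is_diff_cst rc^-1 u).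
  have Dw : is_diff u wg _ := is_diffD_fun (is_diff_cst phi0 u)
    (is_diff_comp1 (g := fun u : K * K => rd * u.2 / rc) (is_derive1_asin (vB u du)) Dv).
  have Dl : is_diff u lg _ := is_diffD_fun
    (is_diffM_fun (is_diff_cst rd u) D1) (diff_dot O Dw).
  have De := entry_diff hb qw.
  have E : offset b q.1 (wg u) = lg u by rewrite -wq /lg -lq leverE wq subrK.
  rewrite E in De.
  have Dx := is_diff_comp (is_diff_pair Dw Dl) De.
  have Dc := is_diff_comp1 (g := fun u => entry b (wg u, lg u)) (is_derive_cos _) Dx.
  have Ds := is_diff_comp1 (g := fun u => entry b (wg u, lg u)) (is_derive_sin _) Dx.
  have Dwx := is_diffD_fun Dw (is_diffN_fun Dx).
  exact: (is_diff_continuous (is_diff_pair (is_diff_pair Dc Ds) Dwx)).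
- by move=> _ [_ [q cq <-] <-]; exact: fdisk.
- by move=> _ [u /gcell[q cq [-> _ _]] <-]; exists q.
- by move=> p /set_mem [q cq <-]; exact: GF.
- by move=> u /set_mem; exact: FG.
Qed.

Lemma confocal_positive_island : has_positive_island b.
Proof.
have pi0 := @pi_gt0 K.
have sn n : sin (phi0 + pi *+ n - phi0) = 0.
  have -> : phi0 + pi *+ n - phi0 = pi *+ n by ring.
  elim: n => [|n IH]; first by rewrite mulr0n sin0.
  by rewrite mulrS addrC sinDpi IH oppr0.
have s0 : sin (phi0 - phi0) = 0 by rewrite subrr sin0.
have p4 : 0 < pi / 4 :> K by lra.
have good n := good_cellP hb c2_gt0 rho_gt0 confocal diam (sn n).
have [d0 d00 g0] := good 0%N; have [d1 d10 g1] := good 1%N.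
have [d2 d20 g2] := good 2%N; have [d3 d30 g3] := good 3%N.
have [d4 d40 Hs] := cell_small hb c2_gt0 diam s0 p4.
have [d5 d50 Hl] := near_line hb c2_gt0 diam s0 p4.
(* The first four thresholds serve [island_image], the last two [cell_homeomorphic], and [c2 / 2]
   ensures [d < c2]. *)
pose d := \big[Num.min/c2 / 2]_(x <- [:: d0; d1; d2; d3; d4; d5]) x.
have : [/\ 0 < d, d <= d0, d <= d1, d <= d2 & [/\ d <= d3, d <= d4, d <= d5 & d <= c2 / 2]].
  rewrite /d !big_cons big_nil !lt_min !ge_min !lexx !orbT.
  by split => //; rewrite d00 d10 d20 d30 d40 d50 divr_gt0.
move=> [dd0 e0 e1 e2 [e3 e4 e5 e6]].
have dc : d < c2 by lra.
have os : offset b (phi0 + pi) phi0 = offset b phi0 phi0.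
  have h0 := diam s0; have h1 := diam (sn 1%N); rewrite mulr1n in h1.
  have : offset b (phi0 + pi) (phi0 + pi) - dot O (tau (phi0 + pi)) = 0.
    by rewrite -h1 dotBl.
  have : offset b phi0 phi0 - dot O (tau phi0) = 0 by rewrite -h0 dotBl.
  rewrite offsetDpi dot_tauD cospi sinpi; lra.
exists (island d); split.
- split.
    by move=> q [k [sq _ _]].
  split; first by move=> k q; exact: island_shift.
  exists 2%N, (phi0, 0); split.
  + exact: elliptic_diameter_point os L_lt L_out.
  + apply: (island_image hb).
    by move=> [|[|[|[|n]]]] // _; [apply: g0|apply: g1|apply: g2|apply: g3].
  + rewrite cylinder_island; apply: cell_homeomorphic => //.
      by move=> q /(cell_le e4)/Hs[_]; lra.
    move=> w l hw hF; have [_ _ h1 h2] := Hl w l hw (le_trans hF e5).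
    by [].
  + exact: island_interior.
- exact: island_measurable.
- apply: (phase_measure_gt0 (x := phi0) hb).
  + exact: island_measurable.
  + by move=> k q; exact: island_shift.
  + exact: island_interior.
Qed.

End positive_island.

(** * Closeness of convex curves *)

Section periodic_functions.
Variable K : realType.

Lemma periodic_representative (x s : K) :
  exists k : int, s <= x + (pi *+ 2) *~ k < s + pi *+ 2.
Proof.
have pi0 := @pi_gt0 K; have tp0 : 0 < pi *+ 2 :> K by rewrite mulr2n; lra.
exists (- Num.floor ((x - s) / (pi *+ 2))).
have := floor_itv ((x - s) / (pi *+ 2)); set m := Num.floor _.
rewrite intrD ler_pdivlMr // ltr_pdivrMr // mulrDl mul1r => /andP[h1 h2].
rewrite mulrNz -mulrzr mulrC; lra.
Qed.

Lemma periodic_bounded (f : K -> K) : continuous f ->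
  (forall x, f (x + pi *+ 2) = f x) -> exists2 A, 0 < A & forall x, `|f x| <= A.
Proof.
move=> cf pf; have pi0 := @pi_gt0 K.
have [c _ cm] : exists2 c, c \in `[0, pi *+ 2] &
    forall t, t \in `[0, pi *+ 2] -> `|f t| <= `|f c|.
  apply: (@EVT_max _ (fun t => `|f t|)); first by rewrite mulr2n; lra.
  by apply: continuous_subspaceT => x; apply: cvg_norm; exact: cf.
exists (`|f c| + 1); first by rewrite ltr_wpDl.
move=> x; have [k hk] := periodic_representative x 0.
rewrite -(periodic_int k x pf); apply: le_trans (cm _ _) _; last by rewrite lerDl.
by rewrite in_itv /=; lra.
Qed.

Lemma periodic_derive (f f' : K -> K) (c : K) :
  (forall x : K, is_derive x 1 f (f' x)) -> (forall x, f (x + c) = f x) ->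
  forall x, f' (x + c) = f' x.
Proof.
move=> df pf x.
have d : is_derive x 1 f (f' (x + c) * 1).
  have E : f \o shift c = f by apply/funext => y; rewrite /= pf.
  have := is_derive1_comp (df (shift c x)) (is_derive_shift x 1 c).
  by rewrite E.
have := df x.
by case: d => _ e1 [_ e2]; rewrite -e2 e1 mulr1.
Qed.

Lemma cos_half_near0 : exists2 r : K, 0 < r < 1 & forall x, `|x| <= r -> 1 / 2 <= cos x.
Proof.
have h : 1 / 2 < cos (0 : K) by rewrite cos0; lra.
have c : cos @ (0 : K) --> cos (0 : K) by exact: continuous_cos.
have /nbhs_ballP[e /= e0 he] : \forall x \near (0 : K), 1 / 2 < cos x.
  exact: (cvgr_gt _ c).
exists (Num.min e 1 / 2).
  have m0 : 0 < Num.min e 1 by rewrite lt_min e0 ltr01.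
  have m1 : Num.min e 1 <= 1 by rewrite ge_min lexx orbT.
  lra.
move=> x hx; apply/ltW/he; rewrite /ball /= sub0r normrN.
have : Num.min e 1 <= e by rewrite ge_min lexx.
lra.
Qed.

Lemma one_sub_cos_le (x : K) : 1 - cos x <= `|x|.
Proof.
have [z _ e] := mean_value 0 x (@is_derive_cos K).
have -> : 1 - cos x = sin z * x by rewrite -[1](@cos0 K) -opprB e; ring.
apply: le_trans (ler_norm _) _.
by rewrite normrM ler_piMl // sin_max.
Qed.

End periodic_functions.

(** * Curves with close positions and close radii *)

Section close_curves.
Variables (K : realType) (a : K -> K * K).
Hypothesis ha : convex_curve a.
Variables (b : K -> K * K) (Ra1 : K -> K) (A sigma eta0 : K).
Hypothesis hb : convex_curve b.
Let Ra := radius a.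
Let Rb := radius b.
Hypothesis dRa : forall x : K, is_derive x 1 Ra (Ra1 x).
(** [A] controls the geometry of the fixed curve [a], [sigma] will bound the difference between the
    two parameters, and [eta0] bounds the distance of the curves at equal tangent angles. *)
Hypotheses (A1 : 1 <= A) (Ra_le : forall x, Ra x <= A)
  (Ra_ge : forall x, A^-1 <= Ra x) (Ra1_le : forall x, `|Ra1 x| <= A).
Hypothesis cos_ge : forall x : K, `|x| <= sigma -> 1 / 2 <= cos x.
Hypotheses (sigma_gt0 : 0 < sigma) (sigma_le1 : sigma <= 1)
  (sigma_le : sigma * (10 * A ^+ 2) <= 1).
Hypotheses (eta_gt0 : 0 < eta0) (eta_le : eta0 * (8 * A) <= sigma).
Hypothesis near_tau : forall x, `|dot (b x - a x) (tau x)| <= eta0.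
Hypothesis near_eta : forall x, `|dot (b x - a x) (eta x)| <= eta0.
Hypothesis near_radius : forall x, `|Rb x - Ra x| <= eta0.

(* [psi p] is the angle of [b] where [b] meets the normal line of [a] at angle
   [p]; the projection of [b] to [a] is its inverse. *)
Definition psi p := entry b (p, offset a p p).
Definition lam p := height b (psi p) p - height a p p.

Let A0 : 0 < A. Proof. exact: lt_le_trans A1. Qed.

Let eA0 : 0 < eta0 * A. Proof. exact: mulr_gt0. Qed.

Let eA_le : 8 * (eta0 * A) <= sigma. Proof. by rewrite mulrCA. Qed.

Let Rb_ge x : (2 * A)^-1 <= Rb x.
Proof.
have e : eta0 <= (2 * A)^-1.
  rewrite -[leRHS]mul1r ler_pdivlMr ?mulr_gt0 //.
  by rewrite mulrCA; have := eA0; have := eA_le; have := sigma_le1; lra.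
have -> : (2 * A)^-1 = A^-1 - (2 * A)^-1 by field; rewrite gt_eqF.
have := near_radius x; rewrite ler_norml; have := Ra_ge x; lra.
Qed.

Let eta_leA : eta0 <= A.
Proof.
have : eta0 * 1 <= eta0 * A by rewrite ler_pM2l.
have := eA_le; have := eA0; have := eta_gt0.
by have := sigma_gt0; have := sigma_le1; have := A1; lra.
Qed.

Let eta_le_sigma : eta0 <= sigma.
Proof.
have : eta0 * 1 <= eta0 * A by rewrite ler_pM2l.
have := eA_le; have := eA0; have := eta_gt0.
by have := sigma_gt0; have := sigma_le1; have := A1; lra.
Qed.

Let Rb_le x : Rb x <= 2 * A.
Proof.
have := near_radius x; rewrite ler_norml.
by have := Ra_le x; have := eta_leA; have := A1; lra.
Qed.

Let Rb_norm x : `|Rb x| <= 2 * A.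
Proof.
by rewrite ger0_norm; [exact: Rb_le|exact: ltW (radius_gt0 hb x)].
Qed.

Let sigma_pi : sigma < pi / 2.
Proof.
rewrite ltNge; apply/negP => h; have := @cos_ge (pi / 2); rewrite cos_pihalf.
have pi0 := @pi_gt0 K.
rewrite ger0_norm; last by lra.
by move=> /(_ h); lra.
Qed.

(** At [p] the two offsets differ by at most [eta0], while the offset along [b] grows at a rate of
    at least [(2 * A)^-1 * (1 / 2)] within [sigma] of [p]; by [eta_le] the growth over [sigma]
    exceeds [eta0], and the intermediate value theorem gives the crossing. *)
Lemma psiP p : `|psi p - p| <= sigma /\ offset b (psi p) p = offset a p p.
Proof.
have e : `|offset b p p - offset a p p| <= eta0 by rewrite -dotBl.
have slope x y : `|x - p| <= sigma -> `|y - p| <= sigma -> x <= y ->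
    (4 * A)^-1 * (y - x) <= offset b y p - offset b x p.
  move=> hx hy xy; have [z hz ->] := mean_value x y (offset_derive hb p).
  rewrite ler_wpM2r ?subr_ge0 //.
  have -> : (4 * A)^-1 = (2 * A)^-1 * (1 / 2) by field; rewrite gt_eqF.
  apply: ler_pM => //; first by rewrite invr_ge0 mulr_ge0 // ltW.
  apply: cos_ge; move: hz hx hy; rewrite (min_l xy) (max_r xy) !ler_norml; lra.
have h4 : (4 * A)^-1 * sigma >= eta0.
  rewrite mulrC ler_pdivlMr ?mulr_gt0 // mulrCA.
  by have := eA0; have := eA_le; have := sigma_le1; lra.
have s1 := slope (p - sigma) p; have s2 := slope p (p + sigma).
have [y yI yo] : exists2 y, y \in `[p - sigma, p + sigma] & offset b y p = offset a p p.
  apply: IVT; first by have := sigma_gt0; lra.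
    by apply: continuous_subspaceT; exact: offset_continuous.
  rewrite ge_min le_max; move: e; rewrite ler_norml => e.
  have {}s1 : (4 * A)^-1 * (p - (p - sigma)) <= offset b p p - offset b (p - sigma) p.
    by apply: s1; rewrite ?ler_norml; have := sigma_gt0; lra.
  have {}s2 : (4 * A)^-1 * (p + sigma - p) <= offset b (p + sigma) p - offset b p p.
    by apply: s2; rewrite ?ler_norml; have := sigma_gt0; lra.
  have e1 : p - (p - sigma) = sigma by ring.
  have e2 : p + sigma - p = sigma by ring.
  rewrite e1 in s1; rewrite e2 in s2.
  by apply/andP; split; apply/orP; [left|right]; lra.
have yp : `|y - p| <= sigma by rewrite ler_norml; move: yI; rewrite in_itv /=; lra.
by rewrite /psi (@entryP _ _ hb _ y) //=; exact: le_lt_trans sigma_pi.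
Qed.

(** Differentiate [b (psi p) = a p + lam p *: eta p]. The right-hand side gives
    [(Ra p - lam p) *: tau p] plus a multiple of [eta p]. Comparing components along [tau p] yields
    this quotient; the components along [eta p] yield the derivative of [lam]. *)
Definition psi' p := (Ra p - lam p) / (Rb (psi p) * cos (psi p - p)).

Let cos_psi p : 1 / 2 <= cos (psi p - p).
Proof. by apply: cos_ge; case: (psiP p). Qed.

Let cos_psi0 p : cos (psi p - p) != 0.
Proof. by have := cos_psi p => h; rewrite gt_eqF //; lra. Qed.

Lemma offset_diag_derive (p : K) :
  is_derive p 1 (fun p => offset a p p) (Ra p + height a p p).
Proof.
have d1 := curve_derive1 ha p; have d2 := curve_derive2 ha p.
apply: is_derive_eq; rewrite /GRing.scale /height /dot /= -/Ra.
transitivity (Ra p * (cos p ^+ 2 + sin p ^+ 2) + ((a p).1 * - sin p + (a p).2 * cos p)).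
  ring.
by rewrite cos2Dsin2 mulr1.
Qed.

Lemma psi_derive (p : K) : is_derive p 1 psi (psi' p).
Proof.
have [h1 h2] := psiP p.
have hp := le_lt_trans h1 sigma_pi.
have De := entry_diff hb hp; rewrite h2 in De.
have Dv := is_derive_pair (@is_derive_id _ _ p 1) (offset_diag_derive p).
have D := is_derive_diff_comp Dv De.
apply: (is_derive_eq D); rewrite /= /psi' /lam /= mulr1; congr (_ / _); ring.
Qed.

Lemma lam_derive (p : K) : is_derive p 1 lam ((Ra p - lam p) * tan (psi p - p)).
Proof.
have dp := psi_derive p.
have d1 := is_derive1_comp (curve_derive1 hb (psi p)) dp.
have d2 := is_derive1_comp (curve_derive2 hb (psi p)) dp.
have e1 := curve_derive1 ha p; have e2 := curve_derive2 ha p.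
have [_ ho] := psiP p; rewrite /offset /dot /= in ho.
have Rb0 : Rb (psi p) != 0 by rewrite gt_eqF ?radius_gt0.
have key : (Ra p - lam p) * tan (psi p - p) =
    Rb (psi p) * psi' p * (sin (psi p) * cos p - cos (psi p) * sin p).
  by rewrite -sinB /psi' /tan; field; rewrite Rb0 cos_psi0.
rewrite key; apply: is_derive_eq; rewrite /GRing.scale /= -/Ra -/Rb.
rewrite -[RHS]subr0 -[X in _ = _ - X](subrr ((a p).1 * cos p + (a p).2 * sin p)).
by rewrite -{1}ho; ring.
Qed.

Let lam1 p := (Ra p - lam p) * tan (psi p - p).

Let lam2 p := (Ra1 p - lam1 p) * tan (psi p - p) +
  (Ra p - lam p) * ((cos (psi p - p))^-2 * (psi' p - 1)).

Lemma lam1_derive (p : K) : is_derive p 1 lam1 (lam2 p).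
Proof.
have dp := psi_derive p; have dl := lam_derive p; have dR := dRa p.
have dd : is_derive p 1 (fun p => psi p - p) (psi' p - 1) by apply: is_derive_eq.
have dt := is_derive1_comp (g := fun p => psi p - p) (is_derive_tan (cos_psi0 p)) dd.
by apply: is_derive_eq; rewrite /lam2 /lam1 /GRing.scale /=; ring.
Qed.

Lemma psi_smooth : smooth 1 psi.
Proof.
have s0 : smooth 0 psi by exact: is_derive_continuous psi_derive.
exists psi'; first exact: psi_derive.
apply: smoothM.
  apply: smoothB; first exact: (smooth_continuous (radius_smooth ha)).
  exact: is_derive_continuous lam_derive.
apply: smoothV => [x|]; first by rewrite mulf_neq0 // gt_eqF ?radius_gt0.
apply: smoothM.
  by apply: (smooth_comp _ s0); exact: (smooth_continuous (radius_smooth hb)).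
apply: smooth_comp; first exact: smooth_cos.
by apply: smoothB => //; exact: smooth_id.
Qed.

(** The derivative of [lam] contains [psi] but not [psi'], so one order of smoothness is gained over
    [psi_smooth]. *)
Lemma lam_smooth : smooth 2 lam.
Proof.
have sl : smooth 1 lam.
  exists lam1; first exact: lam_derive.
  exact: is_derive_continuous lam1_derive.
exists lam1; first exact: lam_derive.
have sd : smooth 1 (fun p => psi p - p).
  by apply: smoothB; [exact: psi_smooth|exact: smooth_id].
apply: smoothM; first by apply: smoothB => //; exact: (smooth_le _ (radius_smooth ha)).
apply: smoothM; first by apply: smooth_comp sd; exact: smooth_sin.
apply: smoothV => //; by apply: smooth_comp sd; exact: smooth_cos.
Qed.

Let A20 : 0 < A ^+ 2. Proof. exact: exprn_gt0. Qed.

(** Moving along [b] from angle [p] to [psi p] costs at most [2 * A * sigma], and the displacement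
    at equal angles at most [eta0 <= A * sigma]. *)
Lemma lam_bound p : `|lam p| <= 3 * A * sigma.
Proof.
have [h _] := psiP p.
have -> : lam p = (height b (psi p) p - height b p p) + dot (b p - a p) (eta p).
  by rewrite dotBl /lam /height; ring.
have [z _ ->] := mean_value p (psi p) (height_derive hb p).
apply: le_trans (ler_normD _ _) _.
have e1 : `|radius b z * sin (z - p) * (psi p - p)| <= 2 * A * sigma.
  rewrite normrM; apply: ler_pM => //; rewrite normrM -[leRHS]mulr1.
  by apply: ler_pM; [| |exact: Rb_norm|exact: sin_max].
have e2 := near_eta p.
have e3 : sigma <= A * sigma by rewrite ler_peMl // ltW.
by have := eta_le_sigma; lra.
Qed.

Let tan_bound p : `|tan (psi p - p)| <= 2 * sigma.
Proof.
have [h _] := psiP p; have c := cos_psi p.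
rewrite /tan normrM normfV ler_pdivrMr; last by rewrite normr_gt0.
rewrite [`|cos _|]ger0_norm; last by lra.
have e1 := sin_le_norm (psi p - p).
have : sigma * (1 / 2) <= sigma * cos (psi p - p) by rewrite ler_pM2l.
lra.
Qed.

Let As_inv : 10 * (A * sigma) <= A^-1.
Proof.
rewrite -[leRHS]mul1r ler_pdivlMr //; apply: le_trans sigma_le.
by rewrite le_eqVlt; apply/orP; left; apply/eqP; ring.
Qed.

Let As0 : 0 < A * sigma. Proof. exact: mulr_gt0. Qed.

Let As_A : A * sigma <= A. Proof. by rewrite ler_piMr // ltW. Qed.

(** By [sigma_le] the bound [3 * A * sigma] of [lam] is at most three tenths of [A^-1]. *)
Let Rlam_ge p : A^-1 / 2 <= Ra p - lam p.
Proof.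
have := lam_bound p; rewrite ler_norml => l; have r := Ra_ge p.
by have := As_inv; have := As0; lra.
Qed.

Let Rlam_bound p : 0 <= Ra p - lam p <= 4 * A.
Proof.
apply/andP; split.
  by apply: le_trans (Rlam_ge p); rewrite divr_ge0 // invr_ge0 ltW.
have := lam_bound p; rewrite ler_norml => l; have r := Ra_le p.
by have := As_A; lra.
Qed.

Lemma psi'_gt0 p : 0 < psi' p.
Proof.
have c := cos_psi p.
rewrite /psi' divr_gt0 ?mulr_gt0 ?radius_gt0 //; last by lra.
by apply: lt_le_trans (Rlam_ge p); rewrite divr_gt0 // invr_gt0.
Qed.

(** The numerator of [psi' p - 1] splits into the variation of [Ra], the difference of the radii,
    the defect of the cosine and [lam], which are at most [1], [1], [2] and [3] times [A * sigma].
    Dividing by at least [(4 * A)^-1] turns [7] into [28 * A]. *)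
Lemma psi'_bound p : `|psi' p - 1| <= 28 * A ^+ 2 * sigma.
Proof.
have [h _] := psiP p; have c := cos_psi p.
have D0 : (4 * A)^-1 <= Rb (psi p) * cos (psi p - p).
  have -> : (4 * A)^-1 = (2 * A)^-1 * (1 / 2) by field; rewrite gt_eqF.
  by apply: ler_pM => //; rewrite invr_ge0 mulr_ge0 // ltW.
have D1 : 0 < Rb (psi p) * cos (psi p - p).
  by apply: lt_le_trans D0; rewrite invr_gt0 mulr_gt0.
have -> : psi' p - 1 = (Ra p - Ra (psi p) + (Ra (psi p) - Rb (psi p)) +
   Rb (psi p) * (1 - cos (psi p - p)) - lam p) / (Rb (psi p) * cos (psi p - p)).
  by rewrite /psi'; field; rewrite cos_psi0 gt_eqF ?radius_gt0.
rewrite normrM normfV [X in _ / X]gtr0_norm // ler_pdivrMr //.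
have e1 : `|Ra p - Ra (psi p)| <= A * sigma.
  have [z _ ->] := mean_value (psi p) p dRa.
  by rewrite normrM distrC; apply: ler_pM.
have e2 : `|Ra (psi p) - Rb (psi p)| <= eta0 by rewrite distrC.
have e3 : `|Rb (psi p) * (1 - cos (psi p - p))| <= 2 * A * sigma.
  rewrite normrM; apply: ler_pM; [| |exact: Rb_norm|] => //.
  rewrite ger0_norm ?subr_ge0 ?cos_le1 //.
  exact: le_trans (one_sub_cos_le _) h.
have e4 := lam_bound p.
have e5 : eta0 <= A * sigma.
  by apply: le_trans eta_le_sigma _; rewrite ler_peMl // ltW.
have num : `|Ra p - Ra (psi p) + (Ra (psi p) - Rb (psi p)) +
   Rb (psi p) * (1 - cos (psi p - p)) - lam p| <= 7 * (A * sigma).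
  have -> : 7 * (A * sigma) =
    A * sigma + A * sigma + 2 * A * sigma + 3 * A * sigma by ring.
  apply: le_trans (ler_normB _ _) (lerD _ e4).
  apply: le_trans (ler_normD _ _) (lerD _ e3).
  exact: le_trans (ler_normD _ _) (lerD e1 (le_trans e2 e5)).
apply: le_trans num _.
have -> : 7 * (A * sigma) = 28 * A ^+ 2 * sigma * (4 * A)^-1.
  by field; rewrite gt_eqF.
by rewrite ler_pM2l // !mulr_gt0.
Qed.

Lemma lam1_bound p : `|lam1 p| <= 8 * A * sigma.
Proof.
have /andP[h1 h2] := Rlam_bound p.
rewrite /lam1 normrM ger0_norm //.
have -> : 8 * A * sigma = 4 * A * (2 * sigma) by ring.
by apply: ler_pM => //; exact: tan_bound.
Qed.

(** [466 = 18 + 448]: the first product contributes [9 * A * (2 * sigma)] and the second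
    [4 * A * (4 * (28 * A ^+ 2 * sigma))]; since [1 <= A], both are absorbed by [A ^+ 3]. *)
Lemma lam2_bound p : `|lam2 p| <= 466 * A ^+ 3 * sigma.
Proof.
have /andP[h1 h2] := Rlam_bound p.
have l1 := lam1_bound p; have t := tan_bound p; have ps := psi'_bound p.
have c := cos_psi p; have r1 := Ra1_le p.
have e1 : `|(Ra1 p - lam1 p) * tan (psi p - p)| <= 9 * A * (2 * sigma).
  rewrite normrM; apply: ler_pM => //.
  by apply: le_trans (ler_normB _ _) _; have := As_A; lra.
have ci : 0 < (cos (psi p - p))^-2 <= 4.
  have c0 : 0 < cos (psi p - p) by lra.
  rewrite invr_gt0 exprn_gt0 //= -[4]invrK lef_pV2 ?posrE ?invr_gt0 ?exprn_gt0 //.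
  have -> : 4^-1 = (1 / 2) ^+ 2 :> K by rewrite expr2; lra.
  by rewrite ler_pXn2r ?nnegrE //; lra.
case/andP: ci => ci0 ci4.
have e2 : `|(Ra p - lam p) * ((cos (psi p - p))^-2 * (psi' p - 1))| <=
    4 * A * (4 * (28 * A ^+ 2 * sigma)).
  rewrite normrM; apply: ler_pM; [| |by rewrite ger0_norm|] => //.
  rewrite normrM; apply: ler_pM => //.
  by rewrite ger0_norm // ltW.
have e3 : A * sigma <= A ^+ 3 * sigma.
  by rewrite ler_pM2r // exprS ler_peMr ?exprn_ege1 // ltW.
apply: le_trans (ler_normD _ _) _.
have e4 : 4 * A * (4 * (28 * A ^+ 2 * sigma)) = 448 * (A ^+ 3 * sigma) by ring.
lra.
Qed.

Lemma psi_lt x y : x < y -> psi x < psi y.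
Proof.
move=> xy; apply: (mean_value_ltr psi_derive xy) => z _; exact: psi'_gt0.
Qed.

Lemma psi_inj : injective psi.
Proof.
by move=> x y e; have [/psi_lt|/psi_lt|//] := ltgtP x y; rewrite e ltxx.
Qed.

Lemma psi_surj y : exists x, psi x = y.
Proof.
have [x _ xy] : exists2 x, x \in `[y - sigma, y + sigma] & psi x = y.
  apply: IVT; first by have := sigma_gt0; lra.
    by apply: continuous_subspaceT; exact: is_derive_continuous psi_derive.
  have [h1 _] := psiP (y - sigma); have [h2 _] := psiP (y + sigma).
  rewrite ge_min le_max; move: h1 h2; rewrite !ler_norml => h1 h2.
  by apply/andP; split; apply/orP; [left|right]; lra.
by exists x.
Qed.

Definition proj y := xget y [set x | psi x = y].

Lemma projK : cancel proj psi.
Proof. by move=> y; rewrite /proj; case: xgetP => // h; have [x /h] := psi_surj y. Qed.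

Lemma psiK : cancel psi proj.
Proof. by move=> x; apply: psi_inj; rewrite projK. Qed.

Lemma psi_periodic x : psi (x + pi *+ 2) = psi x + pi *+ 2.
Proof.
have [h1 h2] := psiP x; rewrite [LHS]/psi; apply: entryP => //=.
  have -> : psi x + pi *+ 2 - (x + pi *+ 2) = psi x - x by ring.
  exact: le_lt_trans h1 sigma_pi.
have := offset_shift hb 1 (psi x) x; have := offset_shift ha 1 x x.
by rewrite !mulr1z h2 => -> ->.
Qed.

Lemma proj_derive (y : K) : is_derive y 1 proj (psi' (proj y))^-1.
Proof.
rewrite -{1}(projK y); apply: (is_derive_inverse (f := psi)).
- by near=> z; exact: psiK.
- by near=> z; exact: (is_derive_continuous psi_derive).
- exact: psi_derive.
- by rewrite gt_eqF // psi'_gt0.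
Unshelve. all: by end_near. Qed.

Lemma proj_diffeo : circle_diffeo proj.
Proof.
have d := proj_derive; split.
- apply/smooth_Cn; exists (fun y => (psi' (proj y))^-1) => //.
  apply: smoothV; first by move=> y; rewrite gt_eqF // psi'_gt0.
  apply: smooth_comp; last exact: is_derive_continuous d.
  exact: smoothSP psi_derive psi_smooth.
- by move=> x; rewrite (is_derive1_fun d) invr_neq0 // gt_eqF // psi'_gt0.
- by left=> x; apply: psi_inj; rewrite psi_periodic !projK.
Qed.

Lemma lam_periodic : periodic lam (pi *+ 2).
Proof.
move=> x; rewrite /lam psi_periodic /height (curve_periodic hb).
by rewrite (curve_periodic ha) /eta (sinD2pi x) (cosD2pi x).
Qed.

(** The component along [tau] is the equation defining [psi], the one along [eta] is the definition
    of [lam]. *)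
Lemma proj_decomposition y : b y = a (proj y) + lam (proj y) *: eta (proj y).
Proof.
have [_ h] := psiP (proj y); rewrite projK in h.
apply: (@frame_eq _ (proj y)); rewrite dotDl dotZl.
  by rewrite dot_eta_tau subrr sin0 oppr0 mulr0 addr0.
by rewrite dot_eta_eta subrr cos0 mulr1 /lam projK /height addrC subrK.
Qed.

Lemma close_curves_C2 (eps : K) : 466 * A ^+ 3 * sigma < eps -> C2_close eps a b.
Proof.
move=> he.
have A13 : A <= A ^+ 3 by rewrite exprS ler_peMr ?exprn_ege1 // ltW.
have As3 : A * sigma <= A ^+ 3 * sigma by rewrite ler_pM2r.
have l0 p := lam_bound p; have l1 p := lam1_bound p; have l2 p := lam2_bound p.
have l0e p : `|lam p| <= 466 * A ^+ 3 * sigma.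
  by apply: le_trans (l0 p) _; have := As0; lra.
have l1e p : `|lam1 p| <= 466 * A ^+ 3 * sigma.
  by apply: le_trans (l1 p) _; have := As0; lra.
exists b; split.
  exists 0, 0 => x; rewrite subr0 addr0 /rot cos0 sin0 !mul1r !mul0r subr0 add0r.
  by case: (b x).
exists proj, lam; split.
- exact: proj_diffeo.
- by split; [exact: lam_periodic|apply/smooth_Cn; exact: lam_smooth].
- by move=> p; exact: le_lt_trans (l0e p) he.
- exact: proj_decomposition.
apply: le_lt_trans he; apply: ge_sup.
  by exists `|derive1n 0 lam 0|, 0%N, 0; split => //; rewrite lexx mulr2n addr_ge0 // pi_ge0.
move=> _ [k [p [k2 _ ->]]]; case: k k2 => [|[|[|//]]] _.
- exact: l0e.
- by rewrite derive1n1 (is_derive1_fun lam_derive); exact: l1e.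
- rewrite derive1nS derive1n1 (is_derive1_fun lam_derive) (is_derive1_fun lam1_derive).
  exact: l2.
Qed.

End close_curves.

(** The bounds on the radius of [a], on its inverse and on its derivative come from periodicity, so
    [e] is fixed by [a] and [eps] before [b] is given. *)
Lemma close_curves_C2_near (K : realType) (a : K -> K * K) (eps : K) :
  convex_curve a -> 0 < eps -> exists2 e, 0 < e & forall b, convex_curve b ->
    (forall x, `|dot (b x - a x) (tau x)| <= e) ->
    (forall x, `|dot (b x - a x) (eta x)| <= e) ->
    (forall x, `|radius b x - radius a x| <= e) -> C2_close eps a b.
Proof.
move=> ha eps0; have sR := radius_smooth ha.
have [R1 dR sR1] : smooth 2 (radius a) by exact: (smooth_le _ sR).
have pR x : radius a (x + pi *+ 2) = radius a x := radius_periodic ha x.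
have R0 x : radius a x != 0 by rewrite gt_eqF ?radius_gt0.
have [B1 B10 hB1] := periodic_bounded (radius_continuous ha) pR.
have [B2 B20 hB2] := periodic_bounded (smooth_continuous (n := 1) sR1) (periodic_derive dR pR).
have [B3 B30 hB3] : exists2 A, 0 < A & forall x, `|(radius a x)^-1| <= A.
  apply: periodic_bounded; last by move=> x; rewrite pR.
  exact: (smooth_continuous (smoothV R0 sR)).
pose A := 1 + B1 + B2 + B3.
have [r /andP[r0 r1] hr] := cos_half_near0 K.
have A1 : 1 <= A by rewrite /A; lra.
have A0 : 0 < A by lra.
(* The three bounds serve the lower bound of the cosine, [sigma_le], and the final estimate, where
   [466 < 10 ^+ 3] makes the inequality strict. *)
pose sigma := Num.min r (Num.min (10 * A ^+ 2)^-1 (eps / ((10 * A) ^+ 3))).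
have A10 : 0 < 10 * A by rewrite mulr_gt0.
have A20 : 0 < 10 * A ^+ 2 by rewrite mulr_gt0 // exprn_gt0.
have A30 : 0 < (10 * A) ^+ 3 by rewrite exprn_gt0.
have A40 : 0 < A ^+ 3 by rewrite exprn_gt0.
have A80 : 0 < 8 * A by rewrite mulr_gt0.
have s0 : 0 < sigma by rewrite !lt_min r0 invr_gt0 A20 (divr_gt0 eps0 A30).
have sr : sigma <= r by rewrite ge_min lexx.
have sA : sigma <= (10 * A ^+ 2)^-1 by rewrite !ge_min lexx orbT.
have se : sigma <= eps / ((10 * A) ^+ 3) by rewrite !ge_min lexx !orbT.
exists (sigma / (8 * A)); first exact: divr_gt0.
move=> b hb h1 h2 h3.
apply: (@close_curves_C2 _ _ ha b R1 A sigma (sigma / (8 * A)) hb dR) => //.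
- by move=> x; apply: le_trans (ler_norm _) _; apply: le_trans (hB1 x) _; rewrite /A; lra.
- move=> x; have := hB3 x; rewrite normfV gtr0_norm ?radius_gt0 // => h.
  rewrite -[leRHS]invrK lef_pV2 ?posrE ?invr_gt0 ?radius_gt0 //.
  by apply: le_trans h _; rewrite /A; lra.
- by move=> x; apply: le_trans (hB2 x) _; rewrite /A; lra.
- by move=> x hx; apply: hr; exact: le_trans hx sr.
- by lra.
- by rewrite -ler_pdivlMr // mul1r.
- exact: divr_gt0.
- by rewrite divfK // gt_eqF.
rewrite ler_pdivlMr // exprMn in se.
have := mulr_gt0 s0 A40; move: se.
have -> : 466 * A ^+ 3 * sigma = 466 * (sigma * A ^+ 3) by ring.
have -> : sigma * (10 ^+ 3 * A ^+ 3) = 1000 * (sigma * A ^+ 3) by ring.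
lra.
Qed.

(** * Local replacement of a support function *)

Section cutoff.
Variable K : realType.

Definition pospow n (x : K) := if 0 < x then x ^+ n else 0.

Lemma pospow_continuous n : continuous (pospow n.+1).
Proof.
have -> : pospow n.+1 = (fun x => Num.max x 0 ^+ n.+1).
  apply/funext => x; rewrite /pospow; case: ltP => // _.
  by rewrite expr0n.
apply: (@smoothX _ 0) => x.
have -> : (fun x : K => Num.max x 0) = (fun x => (x + `|x|) / 2).
  apply/funext => y; have [y0|y0] := leP y 0.
    by rewrite ler0_norm // subrr mul0r.
  by rewrite gtr0_norm //; lra.
apply: cvgM; last exact: cvg_cst.
by apply: cvgD; [exact: cvg_id|exact: norm_continuous].
Qed.

Lemma pospow_derive n (x : K) :
  is_derive x 1 (pospow n.+2) (n.+2%:R * pospow n.+1 x).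
Proof.
have [x0|x0|->] := ltgtP x 0.
- apply: (@near_eq_is_derive _ _ _ (fun _ : K => 0 : K)).
    near=> y; rewrite /pospow ltNge ltW //; near: y.
    exact: lt_nbhsl.
  by rewrite /pospow ltNge (ltW x0) /= mulr0; exact: is_derive_cst.
- apply: (@near_eq_is_derive _ _ _ (fun y : K => y ^+ n.+2)).
    near=> y; rewrite /pospow ifT //; near: y.
    exact: lt_nbhsr.
  rewrite /pospow x0; split; first exact: exprn_derivable.
  by rewrite exp_derive /GRing.scale /= mulr1.
(* At zero the difference quotient is [pospow n.+1] itself, continuous and zero there. *)
- rewrite {2}/pospow ltxx mulr0; apply/is_derive1_caratheodory.
  exists (pospow n.+1); split; last by rewrite /pospow ltxx.
    move=> z; rewrite /pospow ltxx !subr0; case: ifP => _; last by rewrite mul0r.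
    by rewrite [LHS]exprSr.
  exact: pospow_continuous.
Unshelve. all: by end_near. Qed.

Lemma pospow_smooth n m : (n < m)%N -> smooth n (pospow m).
Proof.
elim: n m => [|n IH] [|m] //= nm; first exact: pospow_continuous.
case: m nm => // m nm.
exists (fun x => m.+2%:R * pospow m.+1 x); first exact: pospow_derive.
by apply: smoothM; [exact: smooth_cst|exact: IH].
Qed.

(** A power of the positive part has one continuous derivative less than its exponent. The exponent
    [7] gives the six derivatives of the support function of a curve with five. *)
Definition bump (x : K) := pospow 7 (2 - x) / (pospow 7 (2 - x) + pospow 7 (x - 1)).

Lemma bump_den_gt0 x : 0 < pospow 7 (2 - x) + pospow 7 (x - 1).
Proof.
have h y : 0 <= pospow 7 y.
  by rewrite /pospow; case: ltP => // y0; rewrite exprn_ge0 // ltW.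
have [x2|x2] := ltP x 2.
  by rewrite ltr_pwDl // /pospow subr_gt0 x2 exprn_gt0 // subr_gt0.
rewrite ltr_wpDl // /pospow; have x1 : 0 < x - 1 by lra.
by rewrite x1 exprn_gt0.
Qed.

Lemma bump_smooth : smooth 6 bump.
Proof.
have s1 : smooth 6 (fun x => pospow 7 (2 - x)).
  apply: smooth_comp; first exact: pospow_smooth.
  by apply: smoothB; [exact: smooth_cst|exact: smooth_id].
have s2 : smooth 6 (fun x => pospow 7 (x - 1)).
  apply: smooth_comp; first exact: pospow_smooth.
  by apply: smoothB; [exact: smooth_id|exact: smooth_cst].
apply: smoothM => //; apply: smoothV; last exact: smoothD.
by move=> x; rewrite gt_eqF // bump_den_gt0.
Qed.

Lemma bump1 x : x <= 1 -> bump x = 1.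
Proof.
move=> x1; have e : pospow 7 (x - 1) = 0 by rewrite /pospow ltNge subr_le0 x1.
have := bump_den_gt0 x; rewrite /bump e addr0 => h.
by rewrite divff // gt_eqF.
Qed.

Lemma bump0 x : 2 <= x -> bump x = 0.
Proof. by move=> x2; rewrite /bump {1}/pospow ltNge subr_le0 x2 mul0r. Qed.

Lemma near_cst_derive0 (f f' : K -> K) (c : K) (x : K) :
  (forall x : K, is_derive x 1 f (f' x)) -> (\forall y \near x, f y = c) -> f' x = 0.
Proof.
move=> df fc.
have d : is_derive x 1 f 0.
  apply: (@near_eq_is_derive _ _ _ (fun _ : K => c)).
  by apply: filterS fc => y ->.
by have [_ e1] := df x; case: d => _ <-.
Qed.

Lemma bump_data : exists S1 S2 : K -> K,
  [/\ forall x : K, is_derive x 1 bump (S1 x),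
      forall x : K, is_derive x 1 S1 (S2 x),
      forall x, x < 1 \/ 2 < x -> S1 x = 0 /\ S2 x = 0 &
      exists2 C, 0 < C & forall x, 0 <= x <= 2 ->
        [/\ `|bump x| <= C, `|S1 x| <= C & `|S2 x| <= C] ].
Proof.
have [S1 d1 [S2 d2 s2]] := bump_smooth.
exists S1, S2; split => //.
  have z1 x : x < 1 \/ 2 < x -> S1 x = 0.
    case=> hx.
      apply: (near_cst_derive0 (c := 1) d1); near=> y; apply: bump1; apply: ltW.
      by near: y; exact: lt_nbhsl.
    apply: (near_cst_derive0 (c := 0) d1); near=> y; apply: bump0; apply: ltW.
    by near: y; exact: lt_nbhsr.
  move=> x hx; split; first exact: z1.
  apply: (near_cst_derive0 (c := 0) d2); case: hx => hx; near=> y; apply: z1.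
    by left; near: y; exact: lt_nbhsl.
  by right; near: y; exact: lt_nbhsr.
have bd (f : K -> K) : continuous f -> exists2 C, 0 < C & forall x, 0 <= x <= 2 -> `|f x| <= C.
  move=> cf.
  have [c _ cm] : exists2 c, c \in `[0, 2] & forall t, t \in `[0, 2] -> `|f t| <= `|f c|.
    apply: (@EVT_max _ (fun t => `|f t|)) => //.
    by apply: continuous_subspaceT => x; apply: cvg_norm; exact: cf.
  by exists (`|f c| + 1); [rewrite ltr_wpDl|move=> x hx; rewrite ler_wpDr // cm // in_itv].
have [C0 C00 h0] := bd _ (smooth_continuous bump_smooth).
have [C1 C10 h1] := bd _ (is_derive_continuous d2).
have [C2 C20 h2] := bd _ (smooth_continuous (n := 4) s2).
exists (C0 + C1 + C2); first by rewrite !addr_gt0.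
move=> x hx; split; [have := h0 x hx|have := h1 x hx|have := h2 x hx]; lra.
Unshelve. all: by end_near. Qed.

(** Where the cosine is at least [1 / 2], the mean value theorem from [0] gives first
    [z / 2 <= sin z] and then [y ^+ 2 / 4 <= 1 - cos y]. *)
Lemma sqr_le_one_sub_cos : exists2 r : K, 0 < r <= pi & forall y, `|y| < r ->
  y ^+ 2 <= 4 * (1 - cos y).
Proof.
have [r /andP[r0 r1] hr] := cos_half_near0 K.
exists r; first by rewrite r0; have := @pi_ge2 K; lra.
move=> y; wlog y0 : y / 0 <= y => [H yr|].
  have [|/ltW] := leP 0 y; first by move/H; exact.
  by rewrite -oppr_ge0 -sqrrN -[cos y]cosN => /H; apply; rewrite normrN.
rewrite ger0_norm // => yr.
have d1 (z : K) : is_derive z 1 (fun z => sin z - z / 2) (cos z - 1 / 2).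
  by apply: is_derive_eq; rewrite /GRing.scale /=; ring.
have h z : 0 <= z -> z < r -> 0 <= sin z - z / 2.
  move=> z0 zr; have [c hc] := mean_value 0 z d1.
  rewrite sin0 mul0r !subr0 => ->; move: hc; rewrite min_l // max_r // => hc.
  by rewrite mulr_ge0 // subr_ge0 hr // ger0_norm; lra.
have d2 (z : K) : is_derive z 1 (fun z => 1 - cos z - z ^+ 2 / 4) (sin z - z / 2).
  by apply: is_derive_eq; rewrite /GRing.scale /=; field.
have [c hc] := mean_value 0 y d2.
rewrite cos0 expr0n /= mul0r !subr0 subrr => e; move: hc; rewrite min_l // max_r // => hc.
have : 0 <= (sin c - c / 2) * y by rewrite mulr_ge0 // h //; lra.
by rewrite -e; lra.
Qed.

Lemma flat_bounds (w w1 w2 : K -> K) (s e : K) :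
  (forall x : K, is_derive x 1 w (w1 x)) ->
  (forall x : K, is_derive x 1 w1 (w2 x)) -> continuous w2 ->
  w s = 0 -> w1 s = 0 -> w2 s = 0 -> 0 < e ->
  exists2 r, 0 < r & forall x, `|x - s| < r ->
    [/\ `|w x| <= e * (x - s) ^+ 2, `|w1 x| <= e * `|x - s| & `|w2 x| <= e].
Proof.
move=> d1 d2 c2 w0 w10 w20 e0.
have c : w2 @ s --> (0 : K) by rewrite -[X in _ --> X]w20; exact: c2.
move/cvgrPdist_lt : c => /(_ _ e0) /nbhs_ballP[r /= r0 hr].
have b2 x : `|x - s| < r -> `|w2 x| <= e.
  by move=> xr; have := hr x; rewrite /ball /= distrC sub0r normrN => h; apply/ltW/h.
have between x z : Num.min s x <= z <= Num.max s x -> `|z - s| <= `|x - s|.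
  case: (leP s x) => sx /andP[z1 z2].
    by rewrite !ger0_norm; lra.
  by rewrite !ler0_norm; lra.
have b1 x : `|x - s| < r -> `|w1 x| <= e * `|x - s|.
  move=> xr; have [z /between zs] := mean_value s x d2.
  rewrite w10 subr0 => ->; rewrite normrM ler_wpM2r //.
  by apply: b2; exact: le_lt_trans xr.
exists r => // x xr; split; [|exact: b1|exact: b2].
have [z /between zs] := mean_value s x d1.
rewrite w0 subr0 => ->; rewrite normrM -real_normK ?num_real // expr2 mulrA.
rewrite ler_wpM2r //; apply: le_trans (b1 z _) _; first exact: le_lt_trans xr.
by rewrite ler_wpM2l // ltW.
Qed.

(** The cut-off is applied to [(1 - cos (x - s)) / D], which is periodic and quadratic at [s], so
    the transition takes place where [(x - s) ^+ 2] is of order [D]. Each derivative of the cut-off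
    costs the inverse square root of [D]; the vanishing of [w] to second order at [s] pays for two
    of them, and the bounds are uniform as [D] shrinks. *)
Lemma local_replacement (w w1 w2 : K -> K) (s e : K) :
  (forall x : K, is_derive x 1 w (w1 x)) ->
  (forall x : K, is_derive x 1 w1 (w2 x)) -> smooth 6 w ->
  (forall x, w (x + pi *+ 2) = w x) ->
  w s = 0 -> w1 s = 0 -> w2 s = 0 -> 0 < e ->
  exists (k k1 k2 : K -> K) (D : K),
  [/\ [/\ forall x : K, is_derive x 1 k (k1 x),
          forall x : K, is_derive x 1 k1 (k2 x), smooth 6 k &
          forall x, k (x + pi *+ 2) = k x],
      0 < D < 1,
      forall x, 1 - cos (x - s) < D -> [/\ k x = w x, k1 x = w1 x & k2 x = w2 x],
      forall x, 1 <= 1 - cos (x - s) -> [/\ k x = 0, k1 x = 0 & k2 x = 0] &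
      forall x, [/\ `|k x| <= e, `|k1 x| <= e & `|k2 x| <= e] ].
Proof.
move=> d1 d2 sw pw w0 w10 w20 e0.
have pw1 := periodic_derive d1 pw; have pw2 := periodic_derive d2 pw1.
have sw2 : smooth 4 w2 by apply: (smoothSP d2); exact: (smoothSP d1).
have [S1 [S2 [dS1 dS2 Sout [C C0 hC]]]] := bump_data.
(* The worst case is [k2], whose four terms are bounded by [64], [8], [16] and [1] times
   [C * e']. *)
pose e' := e / (100 * C).
have e'0 : 0 < e' by rewrite divr_gt0 // mulr_gt0.
have Ce' : C * e' * 100 = e by rewrite /e'; field; rewrite gt_eqF.
have [r1 r10 hw] := flat_bounds d1 d2 (smooth_continuous sw2) w0 w10 w20 e'0.
have [r2 /andP[r20 r2pi] hcos] := sqr_le_one_sub_cos.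
pose r := Num.min 1 (Num.min r1 r2).
have r0 : 0 < r by rewrite !lt_min r10 r20 ltr01.
have rpi : r <= pi by rewrite !ge_min r2pi !orbT.
have cr : 0 < 1 - cos r.
  by rewrite subr_gt0 -cos0 ltr_cos // in_itv /= ?pi_ge0 ?lexx //; lra.
(* With [D <= 1 / 3] the bump vanishes wherever [1 <= 1 - cos (x - s)]. With [4 * D <= 1 - cos r]
   its support lies, modulo full turns, within [r] of [s]. *)
pose D := Num.min (1 / 3) ((1 - cos r) / 4).
have D0 : 0 < D by rewrite lt_min !divr_gt0.
have D3 : D <= 1 / 3 by rewrite ge_min lexx.
have Dr : 4 * D <= 1 - cos r.
  have : D <= (1 - cos r) / 4 by rewrite ge_min lexx orbT.
  lra.
pose u x := 1 - cos (x - s).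
pose v x := u x / D.
have dv (x : K) : is_derive x 1 v (sin (x - s) / D).
  by apply: is_derive_eq; rewrite /GRing.scale /=; ring.
have dsn (x : K) : is_derive x 1 (fun x => sin (x - s) / D) (cos (x - s) / D).
  by apply: is_derive_eq; rewrite /GRing.scale /=; ring.
pose k x := bump (v x) * w x.
pose k1 x := S1 (v x) * (sin (x - s) / D) * w x + bump (v x) * w1 x.
pose k2 x := S2 (v x) * (sin (x - s) / D) ^+ 2 * w x +
  S1 (v x) * (cos (x - s) / D) * w x +
  2 * (S1 (v x) * (sin (x - s) / D) * w1 x) + bump (v x) * w2 x.
have u0 x : 0 <= v x by rewrite divr_ge0 ?subr_ge0 ?cos_le1 // ltW.
exists k, k1, k2, D; split.
- have dB (x : K) := is_derive1_comp (dS1 (v x)) (dv x).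
  have dB1 (x : K) := is_derive1_comp (dS2 (v x)) (dv x).
  split.
  + move=> x; exact: (@is_deriveM_fun _ (bump \o v) w
      (fun x => S1 (v x) * (sin (x - s) / D)) w1).
  + move=> x.
    have h1 := @is_deriveM_fun _ (S1 \o v) (fun x => sin (x - s) / D)
      (fun x => S2 (v x) * (sin (x - s) / D)) (fun x => cos (x - s) / D) x
      (dB1 x) (dsn x).
    have h2 := @is_deriveM_fun _ (fun x => S1 (v x) * (sin (x - s) / D)) w
      (fun x => S2 (v x) * (sin (x - s) / D) * (sin (x - s) / D) +
         S1 (v x) * (cos (x - s) / D)) w1 x h1 (d1 x).
    have h3 := @is_deriveM_fun _ (bump \o v) w1
      (fun x => S1 (v x) * (sin (x - s) / D)) w2 x (dB x) (d2 x).
    apply: (is_derive_eq (is_deriveD h2 h3)).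
    by rewrite /k2 /=; ring.
  + apply: smoothM => //; apply: smooth_comp; first exact: bump_smooth.
    apply: smoothM; last exact: smooth_cst.
    apply: smoothB; first exact: smooth_cst.
    apply: smooth_comp; first exact: smooth_cos.
    by apply: smoothB; [exact: smooth_id|exact: smooth_cst].
  + by move=> x; rewrite /k pw /v /u addrAC cosD2pi.
- by rewrite D0; lra.
- move=> x ux; have v1 : v x < 1 by rewrite ltr_pdivrMr // mul1r.
  have [z1 z2] := Sout _ (or_introl v1).
  by rewrite /k /k1 /k2 bump1 ?ltW // z1 z2; split; ring.
- move=> x ux; have v2 : 2 < v x by rewrite ltr_pdivlMr //; rewrite /u; lra.
  have [z1 z2] := Sout _ (or_intror v2).
  by rewrite /k /k1 /k2 bump0 ?ltW // z1 z2; split; ring.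
move=> x; have [v2|v2] := ltP 2 (v x).
  have [z1 z2] := Sout _ (or_intror v2).
  have -> : k x = 0 by rewrite /k bump0 ?ltW //; ring.
  have -> : k1 x = 0 by rewrite /k1 bump0 ?ltW // z1; ring.
  have -> : k2 x = 0 by rewrite /k2 bump0 ?ltW // z1 z2; ring.
  by rewrite normr0; split; apply: ltW.
(* Everything is periodic, so the estimates may be made at the representative within [pi] of [s],
   where [flat_bounds] applies. *)
have [m hm] := periodic_representative x (s - pi).
pose x' := x + (pi *+ 2) *~ m; pose y := x' - s.
have wE : [/\ w x = w x', w1 x = w1 x' & w2 x = w2 x'].
  by split; rewrite /x' periodic_int.
have [tE1 tE2] : sin (x - s) = sin y /\ cos (x - s) = cos y.
  have -> : y = x - s + (pi *+ 2) *~ m by rewrite /y /x'; ring.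
  by rewrite sin_shift cos_shift.
have yr : `|y| < r.
  have ypi : `|y| <= pi.
    by move: hm; rewrite -/x' ler_norml /y mulr2n; lra.
  have iy : `|y| \in `[0, pi] by rewrite in_itv /= normr_ge0.
  have ir : r \in `[0, pi] by rewrite in_itv /= ltW.
  rewrite -(ltr_cos iy ir).
  rewrite cos_norm -tE2; move: v2; rewrite ler_pdivrMr // /u; lra.
have yr1 : `|y| < 1 by move: yr; rewrite lt_min => /andP[].
have [b0 b1 b2] : [/\ `|w x| <= e' * y ^+ 2, `|w1 x| <= e' * `|y| & `|w2 x| <= e'].
  case: wE => -> -> ->; apply: hw; move: yr; rewrite !lt_min; case/and3P => *.
  by [].
have [h0 h1 h2] := hC (v x) (introT andP (conj (u0 x) v2)).
have q8 : y ^+ 2 <= 8 * D.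
  have : y ^+ 2 <= 4 * (1 - cos y).
    by apply: hcos; move: yr; rewrite !lt_min => /and3P[].
  rewrite -tE2; move: v2; rewrite ler_pdivrMr // /u; lra.
have sy := sin_le_norm y; have cy := cos_max y.
have t1 : `|sin (x - s) / D| <= `|y| / D.
  by rewrite tE1 normrM normfV [`|D|]gtr0_norm // ler_pM2r ?invr_gt0.
have t2 : `|cos (x - s) / D| <= 1 / D.
  by rewrite tE2 normrM normfV [`|D|]gtr0_norm // ler_pM2r ?invr_gt0.
(* After cancellation the products depend on [D] only through powers of [q], and [q <= 8] however
   small [D] is. *)
pose q := y ^+ 2 / D.
have q0 : 0 <= q by rewrite /q divr_ge0 ?sqr_ge0 // ltW.
have q1 : q <= 8 by rewrite ler_pdivrMr.
have yy : `|y| ^+ 2 = y ^+ 2 by rewrite real_normK ?num_real.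
have Ce0 : 0 < C * e' by rewrite mulr_gt0.
have Ce_le t : t <= 100 -> C * e' * t <= e by rewrite -Ce' ler_pM2l.
have m1 : `|bump (v x) * w2 x| <= C * e'.
  by rewrite normrM; exact: ler_pM.
have m2 : `|S1 (v x) * (sin (x - s) / D) * w1 x| <= C * e' * 8.
  apply: (@le_trans _ _ (C * (`|y| / D) * (e' * `|y|))).
    rewrite normrM; apply: ler_pM => //; rewrite normrM; exact: ler_pM.
  have -> : C * (`|y| / D) * (e' * `|y|) = C * e' * q by rewrite /q -yy; ring.
  by rewrite ler_pM2l.
have m3 : `|S1 (v x) * (cos (x - s) / D) * w x| <= C * e' * 8.
  apply: (@le_trans _ _ (C * (1 / D) * (e' * y ^+ 2))).
    rewrite normrM; apply: ler_pM => //; rewrite normrM; exact: ler_pM.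
  have -> : C * (1 / D) * (e' * y ^+ 2) = C * e' * q by rewrite /q; ring.
  by rewrite ler_pM2l.
have m4 : `|S2 (v x) * (sin (x - s) / D) ^+ 2 * w x| <= C * e' * 64.
  apply: (@le_trans _ _ (C * (`|y| / D) ^+ 2 * (e' * y ^+ 2))).
    rewrite normrM; apply: ler_pM => //; rewrite normrM; apply: ler_pM => //.
    by rewrite normrX; apply: lerXn2r; rewrite ?nnegrE ?divr_ge0 // ltW.
  have -> : C * (`|y| / D) ^+ 2 * (e' * y ^+ 2) = C * e' * (q * q).
    by rewrite /q -yy; ring.
  rewrite ler_pM2l //; have -> : 64 = 8 * 8 :> K by ring.
  exact: ler_pM.
have m5 : `|bump (v x) * w1 x| <= C * e'.
  rewrite normrM; apply: ler_pM => //; apply: le_trans b1 _.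
  by rewrite -[leRHS]mulr1 ler_pM2l // ltW.
have m6 : `|S1 (v x) * (sin (x - s) / D) * w x| <= C * e' * 8.
  apply: (@le_trans _ _ (C * (`|y| / D) * (e' * y ^+ 2))).
    rewrite normrM; apply: ler_pM => //; rewrite normrM; exact: ler_pM.
  have -> : C * (`|y| / D) * (e' * y ^+ 2) = C * e' * q * `|y| by rewrite /q; ring.
  rewrite -[leRHS]mulr1; apply: ler_pM => //.
  - by rewrite mulr_ge0 // ltW.
  - by rewrite ler_pM2l.
  - exact: ltW.
have m7 : `|bump (v x) * w x| <= C * e'.
  rewrite normrM; apply: ler_pM => //; apply: le_trans b0 _.
  rewrite -[leRHS]mulr1 ler_pM2l // -yy expr_le1 //; exact: ltW.
split.
- by apply: le_trans m7 _; rewrite -[leLHS]mulr1; apply: Ce_le; lra.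
- apply: le_trans (ler_normD _ _) _; apply: le_trans (lerD m6 m5) _.
  by rewrite -[X in _ + X]mulr1 -mulrDr; apply: Ce_le; lra.
- apply: le_trans (ler_normD _ _) _; apply: (@le_trans _ _ (C * e' * 64 +
    C * e' * 8 + 2 * (C * e' * 8) + C * e')); last first.
    have -> : C * e' * 64 + C * e' * 8 + 2 * (C * e' * 8) + C * e' =
      C * e' * 89 by ring.
    by apply: Ce_le; lra.
  apply: lerD m1; apply: le_trans (ler_normD _ _) _; apply: lerD.
    by apply: le_trans (ler_normD _ _) _; apply: lerD.
  by rewrite normrM ger0_norm // ler_pM2l.
Qed.

End cutoff.

(** * Curves with confocal elliptic arcs at the ends of a diameter *)

Section support_functions.
Variable K : realType.
Implicit Types (x s : K).

Lemma convex_curveI (b : K -> K * K) (R : K -> K) :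
  smooth 5 (fun x => (b x).1) -> smooth 5 (fun x => (b x).2) ->
  (forall x : K, is_derive x 1 (fun x => (b x).1) (R x * cos x)) ->
  (forall x : K, is_derive x 1 (fun x => (b x).2) (R x * sin x)) ->
  (forall x, 0 < R x) -> periodic b (pi *+ 2) ->
  convex_curve b /\ forall x, radius b x = R x.
Proof.
move=> s1 s2 d1 d2 R0 pb.
have db x : derive1 b x = R x *: tau x.
  have -> : b = (fun x => ((b x).1, (b x).2)) by apply/funext => y; case: (b y).
  by rewrite derive1E; case: (is_derive_pair (d1 x) (d2 x)) => _ ->.
have Rb x : radius b x = R x.
  by rewrite /radius db dotZl dot_tau_tau subrr cos0 mulr1.
split=> //; split => //; first by apply/Cn_pairP.
by move=> x; rewrite Rb.
Qed.

(** The point [O + h1 *: tau x - h *: eta x], with [h1] meant as the derivative of [h]; since [eta]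
    points inwards, [h] measures the tangent line from [O] along the outward normal. *)
Definition support_curve (O : K * K) (h h1 : K -> K) x : K * K :=
  (O.1 + (h1 x * cos x + h x * sin x), O.2 + (h1 x * sin x - h x * cos x)).

Lemma support_curve_convex (O : K * K) (h h1 h2 : K -> K) :
  (forall x : K, is_derive x 1 h (h1 x)) -> (forall x : K, is_derive x 1 h1 (h2 x)) ->
  smooth 6 h -> (forall x, h (x + pi *+ 2) = h x) -> (forall x, 0 < h x + h2 x) ->
  convex_curve (support_curve O h h1) /\
  forall x, radius (support_curve O h h1) x = h x + h2 x.
Proof.
move=> d1 d2 sh ph R0.
have sh1 : smooth 5 h1 := smoothSP d1 sh; have sh5 := smoothW sh.
have ph1 := periodic_derive d1 ph.
apply: (@convex_curveI _ (fun x => h x + h2 x)) => //.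
- apply: smoothD; first exact: smooth_cst.
  by apply: smoothD; apply: smoothM => //; [exact: smooth_cos|exact: smooth_sin].
- apply: smoothD; first exact: smooth_cst.
  by apply: smoothB; apply: smoothM => //; [exact: smooth_sin|exact: smooth_cos].
- move=> x; have e1 := d1 x; have e2 := d2 x.
  by apply: is_derive_eq; rewrite /GRing.scale /=; ring.
- move=> x; have e1 := d1 x; have e2 := d2 x.
  by apply: is_derive_eq; rewrite /GRing.scale /=; ring.
- by move=> x; rewrite /support_curve ph ph1 (sinD2pi x) (cosD2pi x).
Qed.

Lemma support_curve_tau (O : K * K) (h h1 : K -> K) x :
  dot (support_curve O h h1 x - O) (tau x) = h1 x.
Proof.
rewrite /dot /=; transitivity (h1 x * (cos x ^+ 2 + sin x ^+ 2)); first by ring.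
by rewrite cos2Dsin2 mulr1.
Qed.

Lemma support_curve_eta (O : K * K) (h h1 : K -> K) x :
  dot (support_curve O h h1 x - O) (eta x) = - h x.
Proof.
rewrite /dot /=; transitivity (- h x * (cos x ^+ 2 + sin x ^+ 2)); first by ring.
by rewrite cos2Dsin2 mulr1.
Qed.

(** The support function gains one order of smoothness over the curve, because its derivative [h1]
    already has the class of the curve. *)
Lemma curve_support (a : K -> K * K) (O : K * K) : convex_curve a ->
  let h x := - dot (a x - O) (eta x) in
  let h1 x := dot (a x - O) (tau x) in
  [/\ forall x : K, is_derive x 1 h (h1 x),
      forall x : K, is_derive x 1 h1 (radius a x - h x), smooth 6 h &
      forall x, h (x + pi *+ 2) = h x].
Proof.
move=> ha h h1.
have d (x : K) : is_derive x 1 h (h1 x).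
  have e1 := curve_derive1 ha x; have e2 := curve_derive2 ha x.
  by apply: is_derive_eq; rewrite /h1 /GRing.scale /dot /=; ring.
split => //.
- move=> x; have e1 := curve_derive1 ha x; have e2 := curve_derive2 ha x.
  apply: is_derive_eq; rewrite /h /GRing.scale /dot /=.
  transitivity (radius a x * (cos x ^+ 2 + sin x ^+ 2) +
    ((a x).1 - O.1) * - sin x + ((a x).2 - O.2) * cos x); first by ring.
  by rewrite cos2Dsin2; ring.
- exists h1 => //; have [s1 s2] := curve_smooth ha.
  apply: (@smooth_ext _ _ (fun x => ((a x).1 - O.1) * cos x +
    ((a x).2 - O.2) * sin x)) => //; apply: smoothD; apply: smoothM.
  + by apply: smoothB => //; exact: smooth_cst.
  + exact: smooth_cos.
  + by apply: smoothB => //; exact: smooth_cst.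
  + exact: smooth_sin.
- by move=> x; rewrite /h (curve_periodic ha) /eta (sinD2pi x) (cosD2pi x).
Qed.

(* The support function, relative to its center, of the ellipse with semi-axes
   [B] and [sqrt (B ^+ 2 + c2)], the former in the direction [eta phi0]. *)
Lemma ellipse_support (B c2 phi0 : K) : 0 < B -> 0 < c2 ->
  exists E E1 E2 : K -> K,
  [/\ [/\ forall x : K, is_derive x 1 E (E1 x), forall x : K, is_derive x 1 E1 (E2 x),
       smooth 6 E & forall x, E (x + pi *+ 2) = E x],
     forall x, 2 * E x * E1 x = c2 * sin ((x - phi0) *+ 2) &
     forall s, sin (s - phi0) = 0 -> [/\ E s = B, E1 s = 0 & E2 s = c2 / B] ].
Proof.
move=> B0 c20.
pose Q x := B ^+ 2 + c2 * sin (x - phi0) ^+ 2.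
have Q0 x : 0 < Q x by rewrite ltr_pwDl ?exprn_gt0 // mulr_ge0 ?sqr_ge0 // ltW.
pose E x := Num.sqrt (Q x).
have E0 x : 0 < E x by rewrite sqrtr_gt0.
have En x : E x != 0 by rewrite gt_eqF.
pose P x := c2 * (sin (x - phi0) * cos (x - phi0)).
pose E1 x := P x / E x.
pose E2 x := (c2 * (cos (x - phi0) ^+ 2 - sin (x - phi0) ^+ 2) - E1 x ^+ 2) / E x.
have dQ (x : K) : is_derive x 1 Q (2 * P x).
  by apply: is_derive_eq; rewrite /P /GRing.scale /=; ring.
have dE (x : K) : is_derive x 1 E (E1 x).
  have := is_derive1_comp (is_derive1_sqrt (Q0 x)) (dQ x) => D.
  apply: (is_derive_eq D); rewrite /E1 -/(E x); field; exact: En.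
have dP (x : K) : is_derive x 1 P (c2 * (cos (x - phi0) ^+ 2 - sin (x - phi0) ^+ 2)).
  by apply: is_derive_eq; rewrite /GRing.scale /=; ring.
exists E, E1, E2; split.
- split => //.
  + move=> x; have eP := dP x; have eE := is_deriveV (En x) (dE x).
    apply: (is_derive_eq (@is_deriveM_fun _ P (fun x => (E x)^-1)
      (fun x => c2 * (cos (x - phi0) ^+ 2 - sin (x - phi0) ^+ 2))
      (fun x => - (E x) ^- 2 *: E1 x) x eP eE)).
    by rewrite /E2 /E1 /GRing.scale /=; field; exact: En.
  + apply: smooth_sqrt => //; apply: smoothD; first exact: smooth_cst.
    apply: smoothM; first exact: smooth_cst.
    apply: smoothX; apply: smooth_comp; first exact: smooth_sin.
    by apply: smoothB; [exact: smooth_id|exact: smooth_cst].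
  + by move=> x; rewrite /E /Q addrAC (sinD2pi (x - phi0)).
- move=> x; rewrite sin_mulr2n mulr2n /E1 /P; field; exact: En.
move=> s s0.
have Es : E s = B by rewrite /E /Q s0 expr0n /= mulr0 addr0 sqrtr_sqr gtr0_norm.
have E1s : E1 s = 0 by rewrite /E1 /P s0 mul0r mulr0 mul0r.
split => //; rewrite /E2 E1s Es cos2sin2 s0 expr0n /=.
by rewrite !subr0 mulr1.
Qed.

(** Equating the two values [B0 * (R0 - B0)] and [B1 * (R1 - B1)] of [c2] and using [B0 + B1 = L]
    leaves [B0 * (R0 - L) = B1 * (R1 - L)], a linear system that gives the witnesses. [R0 - L],
    [R1 - L] and hence their sum [S] have one sign, so the semi-axes are positive; [c2] is positive
    because [R0 + R1 > L]. *)
Lemma confocal_axes (L R0 R1 : K) : 0 < L -> L - (R0 + R1) < 0 ->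
  0 < (L - R0) * (L - R1) -> exists B0 B1 c2 : K,
  [/\ 0 < B0 /\ 0 < B1, 0 < c2, B0 + B1 = L, B0 + c2 / B0 = R0 & B1 + c2 / B1 = R1].
Proof.
move=> L0 LR LRR; pose S := R0 + R1 - 2 * L.
have pos : 0 < (R1 - L) * S /\ 0 < (R0 - L) * S.
  have e : (L - R0) * (L - R1) = (R1 - L) * (R0 - L) by ring.
  have h0 := sqr_ge0 (R0 - L); have h1 := sqr_ge0 (R1 - L).
  split.
    have -> : (R1 - L) * S = (R1 - L) ^+ 2 + (L - R0) * (L - R1) by rewrite /S; ring.
    lra.
  have -> : (R0 - L) * S = (R0 - L) ^+ 2 + (L - R0) * (L - R1) by rewrite /S; ring.
  lra.
case: pos => p1 p0.
have S0 : S != 0 by apply: contraTneq p0 => ->; rewrite mulr0 ltxx.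
have q x : 0 < x * S -> 0 < x / S.
  move=> h; have -> : x / S = x * S / S ^+ 2 by field.
  by rewrite divr_gt0 // lt_def sqrf_eq0 S0 sqr_ge0.
have n0 : R0 - L != 0 by apply: contraTneq p0 => ->; rewrite mul0r ltxx.
have n1 : R1 - L != 0 by apply: contraTneq p1 => ->; rewrite mul0r ltxx.
have Ln : L != 0 by rewrite gt_eqF.
have h0 := q _ p0; have h1 := q _ p1.
have B00 : 0 < L * ((R1 - L) / S) by rewrite mulr_gt0.
have B10 : 0 < L * ((R0 - L) / S) by rewrite mulr_gt0.
exists (L * ((R1 - L) / S)), (L * ((R0 - L) / S)),
  (L * ((R1 - L) / S) * (((R0 - L) / S) * (R0 + R1 - L))).
split => //.
- by rewrite mulr_gt0 // mulr_gt0 //; lra.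
- by rewrite /S; field; exact: S0.
- by rewrite /S; field; rewrite Ln n1 S0.
- by rewrite /S; field; rewrite Ln n0 S0.
Qed.

Lemma enorm_eta (c s : K) : enorm (c *: eta s) = `|c|.
Proof.
rewrite /enorm dotZl dotC dotZl dot_eta_eta subrr cos0 mulr1 -expr2.
exact: sqrtr_sqr.
Qed.

End support_functions.

Lemma elliptic_diameter_approximation (K : realType) (a : K -> K * K) (phi0 eps : K) :
  convex_curve a -> elliptic_diameter a phi0 -> 0 < eps ->
  exists b, [/\ convex_curve b, C2_close eps a b & has_positive_island b].
Proof.
move=> ha [[c hc] hL1 hL2] eps0; have pi0 := @pi_gt0 K.
pose L := dot (a (phi0 + pi) - a phi0) (eta phi0).
have L0 : 0 < L by apply: (support_gt0 ha); rewrite mulr2n; lra.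
have cL : a (phi0 + pi) - a phi0 = L *: eta phi0.
  have e : a (phi0 + pi) - a phi0 = (- c) *: eta phi0 by rewrite -opprB hc scaleNr.
  by rewrite /L e dotZl dot_eta_eta subrr cos0 mulr1.
have LE : enorm (a phi0 - a (phi0 + pi)) = L.
  by rewrite -opprB cL -scaleNr enorm_eta normrN gtr0_norm.
rewrite LE in hL1 hL2.
have [B0 [B1 [c2 [[B00 B10] c20 BL BR0 BR1]]]] := confocal_axes L0 hL1 hL2.
(* The common center of the two ellipses, at distance [B0] from one end of the diameter and [B1]
   from the other. *)
pose O := a phi0 + B0 *: eta phi0.
have aO0 : a phi0 - O = (- B0) *: eta phi0 by rewrite /O opprD addrA subrr add0r scaleNr.
have aO1 : a (phi0 + pi) - O = B1 *: eta phi0.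
  have -> : a (phi0 + pi) - O = (a (phi0 + pi) - a phi0) - B0 *: eta phi0.
    by rewrite /O opprD addrA.
  by rewrite cL -scalerBl -BL addrC addKr.
pose h x := - dot (a x - O) (eta x); pose h1 x := dot (a x - O) (tau x).
have [dh dh1 sh ph] : [/\ forall x : K, is_derive x 1 h (h1 x),
  forall x : K, is_derive x 1 h1 (radius a x - h x), smooth 6 h &
  forall x, h (x + pi *+ 2) = h x] := curve_support O ha.
have h_0 : h phi0 = B0.
  by rewrite /h aO0 dotZl dot_eta_eta subrr cos0 mulr1 opprK.
have h_1 : h (phi0 + pi) = B1.
  by rewrite /h aO1 dotZl dot_eta_eta opprD addrA subrr add0r cosN cospi mulrN1 opprK.
have h1_0 : h1 phi0 = 0 by rewrite /h1 aO0 dotZl dot_eta_tau subrr sin0 oppr0 mulr0.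
have h1_1 : h1 (phi0 + pi) = 0.
  by rewrite /h1 aO1 dotZl dot_eta_tau opprD addrA subrr add0r sinN sinpi !oppr0 mulr0.
have [e e0 close] := close_curves_C2_near ha eps0.
have pR x : radius a (x + pi *+ 2) = radius a x := radius_periodic ha x.
have R0 x : radius a x != 0 by rewrite gt_eqF ?radius_gt0.
have [B3 B30 hB3] : exists2 A, 0 < A & forall x, `|(radius a x)^-1| <= A.
  apply: periodic_bounded; last by move=> x; rewrite pR.
  exact: (smooth_continuous (smoothV R0 (radius_smooth ha))).
have R_ge x : B3^-1 <= radius a x.
  have := hB3 x; rewrite normfV gtr0_norm ?radius_gt0 // => hx.
  by rewrite -[leRHS]invrK lef_pV2 ?posrE ?invr_gt0 ?radius_gt0.
have iB3 : 0 < B3^-1 by rewrite invr_gt0.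
(* The radius will change by four terms of size [e']. The first bound serves [close]; the second
   keeps at least half of the lower bound [B3^-1] of the radius. *)
pose e' := Num.min (e / 4) (B3^-1 / 8).
have e'0 : 0 < e' by rewrite lt_min !divr_gt0.
have e'e : e' <= e / 4 by rewrite ge_min lexx.
have e'B : e' <= B3^-1 / 8 by rewrite ge_min lexx orbT.
(* At an end of the diameter the support functions of the curve and of the ellipse share value,
   first and second derivative, which is the flatness that [local_replacement] asks of their
   difference. *)
have piece s B : 0 < B -> sin (s - phi0) = 0 -> h s = B -> h1 s = 0 ->
    radius a s - h s = c2 / B -> exists (E E1 E2 k k1 k2 : K -> K) (D : K),
  [/\ [/\ forall x : K, is_derive x 1 k (k1 x),
          forall x : K, is_derive x 1 k1 (k2 x), smooth 6 k &
          forall x, k (x + pi *+ 2) = k x],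
      0 < D < 1,
      forall x, 1 - cos (x - s) < D ->
        [/\ h x + k x = E x, h1 x + k1 x = E1 x & radius a x - h x + k2 x = E2 x],
      forall x, 1 <= 1 - cos (x - s) -> [/\ k x = 0, k1 x = 0 & k2 x = 0] &
      (forall x, [/\ `|k x| <= e', `|k1 x| <= e' & `|k2 x| <= e']) /\
      (forall x, 2 * E x * E1 x = c2 * sin ((x - phi0) *+ 2)) /\
      (forall s, sin (s - phi0) = 0 -> [/\ E s = B, E1 s = 0 & E2 s = c2 / B]) ].
  move=> B_0 ss hs h1s h2s.
  have [E [E1 [E2 [[dE dE1 sE pE] conf jet]]]] := ellipse_support phi0 B_0 c20.
  have [Es E1s E2s] := jet s ss.
  have [||||k [k1 [k2 [D [hk D01 hin hout hb]]]]] :=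
    @local_replacement _ (fun x => E x - h x) (fun x => E1 x - h1 x)
      (fun x => E2 x - (radius a x - h x)) s e' _ _ (smoothB sE sh) _ _ _ _ e'0.
  - by move=> x; rewrite pE ph.
  - by rewrite Es hs subrr.
  - by rewrite E1s h1s subrr.
  - by rewrite E2s h2s subrr.
  exists E, E1, E2, k, k1, k2, D; split => //.
  by move=> x /hin[-> -> ->]; split; ring.
have sn0 : sin (phi0 - phi0) = 0 by rewrite subrr sin0.
have sn1 : sin (phi0 + pi - phi0) = 0 by rewrite addrAC subrr add0r sinpi.
have [|E [E1 [E2 [k [k1 [k2 [D [[dk dk1 sk pk] D01 kin kout [kb [conf jet]]]]]]]]]] :=
  piece phi0 B0 B00 sn0 h_0 h1_0; first by rewrite h_0 -BR0; ring.
have [|F [F1 [F2 [l [l1 [l2 [D' [[dl dl1 sl pl] D'01 lin lout [lb [conf' jet']]]]]]]]]] :=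
  piece (phi0 + pi) B1 B10 sn1 h_1 h1_1; first by rewrite h_1 -BR1; ring.
(* The two corrections do not interfere: [k] vanishes where [cos (x - phi0)] is at most zero and [l]
   where it is at least zero. *)
pose H x := h x + k x + l x.
pose H1 x := h1 x + k1 x + l1 x.
pose H2 x := radius a x - h x + k2 x + l2 x.
have dH (x : K) : is_derive x 1 H (H1 x).
  by have e1 := dh x; have e2 := dk x; have e3 := dl x; apply: is_deriveD.
have dH1 (x : K) : is_derive x 1 H1 (H2 x).
  by have e1 := dh1 x; have e2 := dk1 x; have e3 := dl1 x; apply: is_deriveD.
have sH : smooth 6 H by apply: smoothD => //; apply: smoothD.
have pH x : H (x + pi *+ 2) = H x by rewrite /H ph pk pl.
have HR x : H x + H2 x = radius a x + (k x + k2 x + l x + l2 x) by rewrite /H /H2; ring.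
have small x : `|k x + k2 x + l x + l2 x| <= 4 * e'.
  have [a1 _ a2] := kb x; have [a3 _ a4] := lb x.
  have -> : 4 * e' = e' + e' + e' + e' by ring.
  apply: le_trans (ler_normD _ _) (lerD _ a4).
  apply: le_trans (ler_normD _ _) (lerD _ a3).
  exact: le_trans (ler_normD _ _) (lerD a1 a2).
have Hpos x : 0 < H x + H2 x.
  by rewrite HR; have := small x; rewrite ler_norml; have := R_ge x; lra.
have [cb Rb] := support_curve_convex O dH dH1 sH pH Hpos.
set b := support_curve O H H1 in cb Rb.
have bt x : dot (b x - O) (tau x) = H1 x by exact: support_curve_tau.
have be x : dot (b x - O) (eta x) = - H x by exact: support_curve_eta.
have ba x : b x - a x = (b x - O) - (a x - O).
  by rewrite opprB addrA subrK.
clearbody b; exists b; split; first exact: cb.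
  apply: close => // x.
  - rewrite ba dotBl bt -/(h1 x).
    have -> : H1 x - h1 x = k1 x + l1 x by rewrite /H1; ring.
    have [_ a1 _] := kb x; have [_ a2 _] := lb x.
    by apply: le_trans (ler_normD _ _) _; lra.
  - rewrite ba dotBl be -[dot (a x - O) _]opprK -/(h x).
    have -> : - H x - - h x = - (k x + l x) by rewrite /H; ring.
    have [a1 _ _] := kb x; have [a2 _ _] := lb x.
    by rewrite normrN; apply: le_trans (ler_normD _ _) _; lra.
  - rewrite Rb HR addrC addKr; apply: le_trans (small x) _; lra.
pose rho := Num.min D D'.
have rho0 : 0 < rho by rewrite lt_min; move: D01 D'01 => /andP[-> _] /andP[-> _].
(* Near either end [1 - |cos| <= sin ^+ 2 <= |sin|], so a small sine puts [x] where the replacement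
   is complete; the sign of the cosine tells which end it is. *)
have zone x : `|sin (x - phi0)| < rho ->
    [/\ H x = E x, H1 x = E1 x & H2 x = E2 x] /\ 0 <= cos (x - phi0) \/
    [/\ H x = F x, H1 x = F1 x & H2 x = F2 x] /\ cos (x - phi0) < 0.
  rewrite lt_min => /andP[xD xD'].
  have cpi : cos (x - (phi0 + pi)) = - cos (x - phi0).
    by rewrite opprD addrA -[in RHS](subrK pi (x - phi0)) cosDpi opprK.
  have s1 : sin (x - phi0) ^+ 2 <= `|sin (x - phi0)|.
    rewrite -[leLHS]real_normK ?num_real // expr2 ler_piMl //; exact: sin_max.
  have c1 := cos_le1 (x - phi0); have c2' := cos_geN1 (x - phi0).
  rewrite sin2cos2 in s1.
  have [c0|c0] := leP 0 (cos (x - phi0)); [left|right]; split => //.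
    have [|h_ h1_ h2_] := kin x.
      apply: le_lt_trans xD; apply: le_trans s1; rewrite lerD2l lerN2.
      by rewrite expr2 ler_piMr.
    have [|z0 z1 z2] := lout x; first by rewrite cpi; lra.
    by rewrite /H /H1 /H2 z0 z1 z2 !addr0.
  have [|h_ h1_ h2_] := lin x.
    rewrite cpi opprK; apply: le_lt_trans xD'; apply: le_trans s1.
    rewrite lerD2l -sqrrN expr2 -[leLHS]opprK lerN2 ler_piMr //; lra.
  have [|z0 z1 z2] := kout x; first by lra.
  by rewrite /H /H1 /H2 z0 z1 z2 !addr0.
have base s : sin (s - phi0) = 0 -> `|sin (s - phi0)| < rho by move=> ->; rewrite normr0.
have [[[H_0 _ H2_0] _]|[_]] := zone _ (base _ sn0); last first.
  by rewrite subrr cos0 ltr10.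
have [[_]|[[H_1 _ H2_1] _]] := zone _ (base _ sn1).
  by rewrite addrAC subrr add0r cospi; lra.
have [E_0 _ E2_0] := jet _ sn0; have [F_1 _ F2_1] := jet' _ sn1.
have R_0 : radius b phi0 = radius a phi0 by rewrite Rb H_0 H2_0 E_0 E2_0.
have R_1 : radius b (phi0 + pi) = radius a (phi0 + pi) by rewrite Rb H_1 H2_1 F_1 F2_1.
have L_b : dot (b (phi0 + pi) - b phi0) (eta phi0) = L.
  have -> : b (phi0 + pi) - b phi0 = (b (phi0 + pi) - O) - (b phi0 - O).
    by rewrite opprB [RHS]addrA subrK.
  rewrite dotBl be H_0 E_0 opprK -BL addrC; congr (_ + _).
  have -> : dot (b (phi0 + pi) - O) (eta phi0) = - dot (b (phi0 + pi) - O) (eta (phi0 + pi)).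
    by rewrite /dot /= sinDpi cosDpi; ring.
  by rewrite be H_1 F_1 opprK.
apply: (@confocal_positive_island _ b cb phi0 O c2 rho c20 rho0).
- move=> x xr; rewrite be bt.
  have [[[-> -> _] _]|[[-> -> _] _]] := zone x xr.
    by rewrite mulrN mulNr conf mulNr.
  by rewrite mulrN mulNr conf' mulNr.
- move=> s s0; rewrite bt; have [[[_ -> _] _]|[[_ -> _] _]] := zone s (base s s0).
    by have [] := jet s s0.
  by have [] := jet' s s0.
- by rewrite L_b R_0 R_1.
- by rewrite L_b R_0 R_1.
Qed.

(** A rotation by [c] moves the tangent angle by [c], so the diameter of the given representative
    appears at [phi0 + c], with the same length and the same end radii. *)
Lemma rigid_convex_curve (K : realType) (a0 a : K -> K * K) (phi0 : K) :
  convex_curve a0 -> elliptic_diameter a0 phi0 -> rigid_equiv a0 a ->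
  convex_curve a /\ exists phi1, elliptic_diameter a phi1.
Proof.
move=> ha0 [[k hk] h1 h2] [c [v ae]].
have [s1 s2] := curve_smooth ha0.
have sh : smooth 5 (fun x : K => x - c).
  by apply: smoothB; [exact: smooth_id|exact: smooth_cst].
have E1 : (fun x => (a x).1) =
    (fun x => cos c * (a0 (x - c)).1 - sin c * (a0 (x - c)).2 + v.1).
  by apply/funext => x; rewrite ae.
have E2 : (fun x => (a x).2) =
    (fun x => sin c * (a0 (x - c)).1 + cos c * (a0 (x - c)).2 + v.2).
  by apply/funext => x; rewrite ae.
have ds (x : K) : is_derive x 1 (fun x : K => x - c) 1.
  by apply: is_derive_eq; rewrite subr0.
have [ca Ra] : convex_curve a /\ forall x, radius a x = radius a0 (x - c).
  apply: convex_curveI.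
  - rewrite E1; apply: smoothD; last exact: smooth_cst.
    apply: smoothB; (apply: smoothM; first exact: smooth_cst);
      [exact: smooth_comp s1 sh|exact: smooth_comp s2 sh].
  - rewrite E2; apply: smoothD; last exact: smooth_cst.
    apply: smoothD; (apply: smoothM; first exact: smooth_cst);
      [exact: smooth_comp s1 sh|exact: smooth_comp s2 sh].
  - move=> x; rewrite E1.
    have d1 := is_derive1_comp (g := fun x => x - c) (curve_derive1 ha0 (x - c)) (ds x).
    have d2 := is_derive1_comp (g := fun x => x - c) (curve_derive2 ha0 (x - c)) (ds x).
    apply: is_derive_eq; rewrite /GRing.scale /=.
    have -> : cos x = cos c * cos (x - c) - sin c * sin (x - c).
      by rewrite -cosD; congr cos; ring.
    by ring.
  - move=> x; rewrite E2.
    have d1 := is_derive1_comp (g := fun x => x - c) (curve_derive1 ha0 (x - c)) (ds x).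
    have d2 := is_derive1_comp (g := fun x => x - c) (curve_derive2 ha0 (x - c)) (ds x).
    apply: is_derive_eq; rewrite /GRing.scale /=.
    have -> : sin x = sin c * cos (x - c) + cos c * sin (x - c).
      by rewrite -sinD; congr sin; ring.
    by ring.
  - by move=> x; exact: radius_gt0.
  - by move=> x; rewrite !ae addrAC curve_periodic.
split => //; exists (phi0 + c).
have e1 : phi0 + c - c = phi0 by ring.
have e2 : phi0 + c + pi - c = phi0 + pi by ring.
have D : a (phi0 + c) - a (phi0 + c + pi) = k *: eta (phi0 + c).
  rewrite !ae e1 e2 opprD addrACA subrr addr0.
  have -> : rot c (a0 phi0) - rot c (a0 (phi0 + pi)) = rot c (a0 phi0 - a0 (phi0 + pi)).
    by congr pair; rewrite /=; ring.
  rewrite hk; have -> : k *: eta phi0 = (k * - sin phi0, k * cos phi0) by [].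
  have -> : k *: eta (phi0 + c) = (k * - sin (phi0 + c), k * cos (phi0 + c)) by [].
  by rewrite /rot /= sinD cosD; congr pair; ring.
by split; rewrite ?D ?enorm_eta ?Ra ?e1 ?e2 -?(enorm_eta k phi0) -?hk //; exists k.
Qed.

Theorem theorem1 (K : realType) (a0 : K -> K * K)
    (ha0 : convex_curve a0)
    (hdiam : exists phi0 : K, elliptic_diameter a0 phi0)
    (a : K -> K * K) (ha : rigid_equiv a0 a)
    (eps : K) (heps : 0 < eps) :
  exists b : K -> K * K,
    [/\ convex_curve b, C2_close eps a b & has_positive_island b].
Proof.
have [phi0 ell] := hdiam.
have [ca [phi1 ell1]] := rigid_convex_curve ha0 ell ha.
exact: elliptic_diameter_approximation ca ell1 heps.
Qed.
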